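(* There exist constants $c_1,C_1,C_2>0$ such that the following holds. Let $S\subseteq\{1,\dots,n\}$ with $|S|=s$, let $x\in\mathbb{R}^n$ or $\mathbb{C}^n$ be supported on $S$ and satisfy the random sign assumption, let $A$ be the random sensing matrix of the setting, and let $y=Ax+\epsilon$ with $\|\epsilon\|_2\le\eta$. For every $0<\varepsilon<1$, if $$m\ge c_1\max_{j\in S^c}\Lambda(S\cup\{j\},F)\,\ln\!\left(\tfrac{6(s+1)(n-s)}{\varepsilon}\right)\ln\!\left(\tfrac{6n}{\varepsilon}\right),$$ then with probability at least $1-\varepsilon$ every minimizer $x^\sharp$ of (qBP) satisfies $\|x-x^\sharp\|_2\le(C_1+C_2\sqrt s)\eta$. In the noiseless case $\eta=0$, one may take $c_1=19$, and then $x$ is exactly recovered as the unique minimizer of (BP) with probability at least $1-\varepsilon$.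
   Context: Setting: Let $n,m\ge 1$. For $\ell=1,\dots,m$ let $F_\ell$ be a probability distribution on $\mathbb{C}^{p_\ell\times n}$ ($p_\ell\ge1$), $F=(F_\ell)_{\ell=1}^m$, let $B_1,\dots,B_m$ be independent random matrices with $B_\ell\sim F_\ell$, and $A=\frac{1}{\sqrt m}\begin{pmatrix}B_1\\ \vdots\\ B_m\end{pmatrix}$. Isotropy is assumed: $\mathbb{E}(A^*A)=\frac1m\sum_{\ell=1}^m\mathbb{E}(B_\ell^*B_\ell)=\mathrm{Id}_n$. For $T\subseteq\{1,\dots,n\}$, $P_T$ is the restriction $P_Tx=x_T$, $M_T:=MP_T^*$, $B_{\ell,T}=B_\ell P_T^*$, and $\Lambda(T,F)$ denotes any positive real number such that almost surely $\|B_{\ell,T}^*B_{\ell,T}\|_{2\to2}\le\Lambda(T,F)$ for all $\ell$. Random sign assumption: the vector $(x_i/|x_i|)_{i\in S}$ is a Rademacher sequence (independent uniform $\pm1$ entries) if $x$ is real, or a Steinhaus sequence (independent entries uniform on the complex unit circle) if $x$ is complex, independent of $A$. (BP): $\min_{z\in\mathbb{C}^n}\|z\|_1$ s.t. $Az=y$. (qBP): $\min_{z\in\mathbb{C}^n}\|z\|_1$ s.t. $\|y-Az\|_2\le\eta$. *)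

(* Defs.v *)
From HB Require Import structures.
From mathcomp Require Import all_boot all_order all_algebra.
From mathcomp Require Import all_classical all_reals all_analysis.
From mathcomp Require Import complex.

Set Implicit Arguments.
Unset Strict Implicit.
Unset Printing Implicit Defensive.

Import Order.TTheory GRing.Theory Num.Theory.
Local Open Scope ring_scope.
Local Open Scope classical_set_scope.

Section Defs.
Context {R : realType}.
Local Notation C := (R[i]).

Definition reim (b : bool) (z : C) : R := if b then complex.Re z else complex.Im z.

Definition cabs (z : C) : R := Num.sqrt (complex.Re z ^+ 2 + complex.Im z ^+ 2).
Definition csign (z : C) : C := z / (cabs z)%:C%C.

Definition adjmx (a b : nat) (M : 'M[C]_(a, b)) : 'M[C]_(b, a) :=
  map_mx (@conjc R) M^T.

Definition l2norm (k : nat) (v : 'cV[C]_k) : R :=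
  Num.sqrt (\sum_(i < k) cabs (v i 0) ^+ 2).
Definition l1norm (k : nat) (v : 'cV[C]_k) : R :=
  \sum_(i < k) cabs (v i 0).

Definition opnorm_le (a b : nat) (M : 'M[C]_(a, b)) (L : R) : Prop :=
  forall v : 'cV[C]_b, l2norm (M *m v) <= L * l2norm v.

(** P_T^* : C^{|T|} -> C^n, extension by zero; so M_T = M *m restr_mx T. *)
Definition restr_mx (n : nat) (T : {set 'I_n}) : 'M[C]_(n, #|T|) :=
  \matrix_(i < n, k < #|T|) ((i == enum_val k)%:R : C).

Definition sensing (T : Type) (n m : nat) (p : 'I_m -> nat)
  (B : forall l : 'I_m, T -> 'M[C]_(p l, n)) (w : T) : 'M[C]_(\sum_(l < m) p l, n) :=
  ((Num.sqrt (m%:R : R))^-1)%:C%C *: \mxcol_(l < m) B l w.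

Definition BP_minimizer (M k : nat) (A : 'M[C]_(M, k)) (y : 'cV[C]_M)
    (z : 'cV[C]_k) : Prop :=
  A *m z = y /\ forall w : 'cV[C]_k, A *m w = y -> l1norm z <= l1norm w.

Definition BP_unique_minimizer (M k : nat) (A : 'M[C]_(M, k)) (y : 'cV[C]_M)
    (z : 'cV[C]_k) : Prop :=
  BP_minimizer A y z /\ forall w, BP_minimizer A y w -> w = z.

Definition qBP_minimizer (M k : nat) (A : 'M[C]_(M, k)) (y : 'cV[C]_M) (eta : R)
    (z : 'cV[C]_k) : Prop :=
  l2norm (y - A *m z) <= eta /\
  forall w : 'cV[C]_k, l2norm (y - A *m w) <= eta -> l1norm z <= l1norm w.

End Defs.

Section Prob.
Context {d : measure_display} {T : measurableType d} {R : realType}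
  (P : probability T R).
Local Notation C := (R[i]).

(** Mutual independence of a finite family (indexed by I) of finite
    families of real random variables: the product rule for all
    rectangles of Borel sets (these form a pi-system generating the
    sigma-algebras sigma(X_i), so this is the usual notion). *)
Definition indep_families (I : finType) (J : I -> finType)
    (X : forall i : I, J i -> T -> R) : Prop :=
  forall E : forall i : I, J i -> set R, (forall i j, measurable (E i j)) ->
  P (\bigcap_(i in [set: I]) \bigcap_(j in [set: J i]) (X i j @^-1` E i j))
  = \big[*%E/1%E]_(i : I) P (\bigcap_(j in [set: J i]) (X i j @^-1` E i j)).

Definition indep_pair (J1 J2 : finType) (X : J1 -> T -> R) (Y : J2 -> T -> R)
    : Prop :=
  forall (E : J1 -> set R) (F : J2 -> set R),
  (forall j, measurable (E j)) -> (forall j, measurable (F j)) ->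
  P ((\bigcap_(j in [set: J1]) (X j @^-1` E j)) `&`
     (\bigcap_(j in [set: J2]) (Y j @^-1` F j)))
  = (P (\bigcap_(j in [set: J1]) (X j @^-1` E j)) *
     P (\bigcap_(j in [set: J2]) (Y j @^-1` F j)))%E.

Definition cexpect (X : T -> C) : C :=
  (fine ('E_P[fun w => complex.Re (X w)]) +i* fine ('E_P[fun w => complex.Im (X w)]))%C.
Definition mexpect (a b : nat) (M : T -> 'M[C]_(a, b)) : 'M[C]_(a, b) :=
  \matrix_(i, j) cexpect (fun w => M w i j).

(** The setting: B_1..B_m independent random matrices (B_l ~ F_l),
    with isotropy E(A^*A) = (1/m) sum_l E(B_l^* B_l) = Id_n. *)
Definition sensing_setting (n m : nat) (p : 'I_m -> nat)
    (B : forall l : 'I_m, T -> 'M[C]_(p l, n)) : Prop :=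
  [/\ (0 < n)%N, (0 < m)%N, (forall l, 0 < p l)%N &
   (forall l r c b, measurable_fun setT (fun w => reim b (B l w r c)))] /\
  indep_families (J := fun l : 'I_m => ('I_(p l) * 'I_n * bool)%type)
     (fun l rcb w => reim rcb.2 (B l w rcb.1.1 rcb.1.2)) /\
  (forall l i j b, P.-integrable setT
       (fun w => (reim b ((adjmx (B l w) *m B l w) i j))%:E)) /\
  ((m%:R : R)^-1)%:C%C *: \sum_(l < m) mexpect (fun w => adjmx (B l w) *m B l w)
     = 1%:M.

Definition Lambda_bound (n m : nat) (p : 'I_m -> nat)
    (B : forall l : 'I_m, T -> 'M[C]_(p l, n)) (S : {set 'I_n})
    (Lam : 'I_n -> R) : Prop :=
  forall j, j \notin S -> 0 < Lam j /\
    {ae P, forall w, forall l : 'I_m,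
      opnorm_le (adjmx (B l w *m restr_mx (S :|: [set j]))
                   *m (B l w *m restr_mx (S :|: [set j]))) (Lam j)}.

Definition rademacher (K : finType) (sig : K -> T -> C) : Prop :=
  indep_families (J := fun _ : K => bool) (fun k b w => reim b (sig k w)) /\
  forall k, P [set w | sig k w = 1] = (2^-1)%:E /\
            P [set w | sig k w = -1] = (2^-1)%:E.

Definition steinhaus (K : finType) (sig : K -> T -> C) : Prop :=
  indep_families (J := fun _ : K => bool) (fun k b w => reim b (sig k w)) /\
  forall k (a b : R), 0 <= a -> a <= b -> b <= 2 * pi ->
    P [set w | exists2 th : R, a <= th <= b & sig k w = (cos th +i* sin th)%C]
    = ((b - a) / (2 * pi))%:E.

Definition random_sign_assumption (n M : nat) (A : T -> 'M[C]_(M, n))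
    (x : T -> 'cV[C]_n) (S : {set 'I_n}) : Prop :=
  let sig := fun (i : {i : 'I_n | i \in S}) w => csign (x w (val i) 0) in
  [/\ (forall w i, i \notin S -> x w i 0 = 0),
   (forall i b, measurable_fun setT (fun w => reim b (x w i 0))),
   ((forall w i, complex.Im (x w i 0) = 0) /\ rademacher sig) \/ steinhaus sig &
   indep_pair (fun rcb w => reim rcb.2 (A w rcb.1.1 rcb.1.2))
              (fun ib w => reim ib.2 (sig ib.1 w))].

End Prob.

(* Main.v *)
Require Import Defs.
From HB Require Import structures.
From mathcomp Require Import all_boot all_order all_algebra.
From mathcomp Require Import all_classical all_reals all_analysis.
From mathcomp Require Import measurable_realfun complex.
From mathcomp Require Import ring lra.
Import Order.TTheory GRing.Theory Num.Theory.
Local Open Scope ring_scope.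
Local Open Scope classical_set_scope.
Set Implicit Arguments.
Unset Strict Implicit.
Unset Printing Implicit Defensive.

(** Recovery follows deterministically from two facts: A^*A is within dl of the identity on every S + {j}, and <adj(G) A_S^* a_j, sgn x> is smaller in modulus than rho |det G|, where G is the Gram matrix of the columns in S. Cramer's form replaces the pseudo-inverse by polynomials in the entries of A, which makes the failure event measurable.

Both facts come from moments of even order. Let Z be a sum of independent centered Hermitian matrices H_l - E H_l of size t. Exchanging one summand with an independent copy H_l' bounds E tr Z^(2p) by 2p-1 times the expected trace of Z^(2p-2) against the conditional variance sum_l E'(H_l - H_l')^2 / 2. With 0 <= H_l <= r and sum_l E H_l = 1 this variance is at most r (Z + 2), and the recursion gives E tr Z^(2p) <= (2p-1)!! (19 r/8)^p t as long as 2 p r <= 1/19. The same recursion on 2x2 dilations yields the Khintchine inequality for the signs, used conditionally on A. Markov's inequality at p = floor of the logarithm and (2p-1)!! <= ((2p+1)/e)^p turn the moments into tails, and a union bound over j concludes. *)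

(** * Adjoints, moduli and traces of complex matrices *)

(** The two logarithms have different origins. If adj(A) A is within dl of the identity on S + {j},
    the coefficient vector u of column j over the columns in S satisfies |u|^2 <= dl^2 / (1 - dl^2).
    The certificate at j is a sign sum of that variance, so it exceeds rho with probability about
    exp (- rho^2 / (2 dl^2)), and the union over j asks for dl^2 of order 1 / ln (6n / eps).
    Isometry at this level in dimension s + 1, again for n - s sets, costs m of order Lambda dl^-2
    ln (6 (s+1) (n-s) / eps), and the logarithms multiply. Treating S + {j} as one block controls
    column j together with those in S, which is why Lambda (S + {j}) enters.

    Moments are preferred to matrix exponentials because exchanging a summand then needs only a
    trace inequality for powers, which the spectral theorem reduces to scalars. The threshold 1/19
    in the recursion matches c_1 = 19: with r = Lambda / m, L1 and L2 the two logarithms, 19 r L1 L2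
    <= 1 and L2 >= 2 give 2 L1 r <= 1/19. *)

Section Adjoint.
Variable R : realType.
Local Notation C := (R[i]).

Lemma adjmxE a b (M : 'M[C]_(a, b)) i j : adjmx M i j = conjc (M j i).
Proof. by rewrite !mxE. Qed.

Lemma adjmxK a b (M : 'M[C]_(a, b)) : adjmx (adjmx M) = M.
Proof. by apply/matrixP => i j; rewrite !adjmxE conjcK. Qed.

Lemma adjmxM a b c (A : 'M[C]_(a, b)) (B : 'M[C]_(b, c)) :
  adjmx (A *m B) = adjmx B *m adjmx A.
Proof. by rewrite /adjmx trmx_mul map_mxM. Qed.

Lemma adjmxD a b (A B : 'M[C]_(a, b)) : adjmx (A + B) = adjmx A + adjmx B.
Proof. by rewrite /adjmx linearD map_mxD. Qed.

Lemma adjmxN a b (A : 'M[C]_(a, b)) : adjmx (- A) = - adjmx A.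
Proof. by rewrite /adjmx linearN map_mxN. Qed.

Lemma adjmxB a b (A B : 'M[C]_(a, b)) : adjmx (A - B) = adjmx A - adjmx B.
Proof. by rewrite adjmxD adjmxN. Qed.

Lemma adjmx0 a b : adjmx (0 : 'M[C]_(a, b)) = 0.
Proof. by rewrite /adjmx trmx0 map_mx0. Qed.

Lemma adjmxZ a b (k : C) (A : 'M[C]_(a, b)) : adjmx (k *: A) = conjc k *: adjmx A.
Proof. by apply/matrixP => i j; rewrite !mxE rmorphM. Qed.

Lemma adjmxZr a b (k : R) (A : 'M[C]_(a, b)) :
  adjmx (k%:C%C *: A) = k%:C%C *: adjmx A.
Proof. by rewrite adjmxZ conjc_real. Qed.

Lemma adjmx1 n : adjmx (1%:M : 'M[C]_n) = 1%:M.
Proof. by rewrite /adjmx trmx1 map_mx1. Qed.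

Lemma adjmx_sum a b (I : Type) (r : seq I) (P : pred I) (F : I -> 'M[C]_(a, b)) :
  adjmx (\sum_(i <- r | P i) F i) = \sum_(i <- r | P i) adjmx (F i).
Proof. exact: (big_morph _ (@adjmxD a b) (adjmx0 a b)). Qed.

Lemma adjmxX n (A : 'M[C]_n) k : adjmx (A ^+ k) = adjmx A ^+ k.
Proof.
elim: k => [|k IH]; first by rewrite !expr0 adjmx1.
by rewrite exprS exprSr -!mulmxE adjmxM IH.
Qed.

Lemma hermX n (A : 'M[C]_n) k : adjmx A = A -> adjmx (A ^+ k) = A ^+ k.
Proof. by rewrite adjmxX => ->. Qed.

Lemma cReD (x y : C) : complex.Re (x + y) = complex.Re x + complex.Re y.
Proof. by case: x => a b; case: y. Qed.
Lemma cImD (x y : C) : complex.Im (x + y) = complex.Im x + complex.Im y.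
Proof. by case: x => a b; case: y. Qed.
Lemma cReN (x : C) : complex.Re (- x) = - complex.Re x.
Proof. by case: x. Qed.
Lemma cReB (x y : C) : complex.Re (x - y) = complex.Re x - complex.Re y.
Proof. by rewrite cReD cReN. Qed.
Lemma cReM (x y : C) :
  complex.Re (x * y) = complex.Re x * complex.Re y - complex.Im x * complex.Im y.
Proof. by case: x => a b; case: y. Qed.
Lemma cImM (x y : C) :
  complex.Im (x * y) = complex.Re x * complex.Im y + complex.Im x * complex.Re y.
Proof. by case: x => a b; case: y. Qed.
Lemma cReZ (k : R) (x : C) : complex.Re (k%:C%C * x) = k * complex.Re x.
Proof. by rewrite cReM /= mul0r subr0. Qed.
Lemma cImZ (k : R) (x : C) : complex.Im (k%:C%C * x) = k * complex.Im x.
Proof. by rewrite cImM /= mul0r addr0. Qed.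
Lemma cRe_sum (I : Type) (r : seq I) (P : pred I) (F : I -> C) :
  complex.Re (\sum_(i <- r | P i) F i) = \sum_(i <- r | P i) complex.Re (F i).
Proof. exact: (big_morph _ cReD). Qed.
Lemma cIm_sum (I : Type) (r : seq I) (P : pred I) (F : I -> C) :
  complex.Im (\sum_(i <- r | P i) F i) = \sum_(i <- r | P i) complex.Im (F i).
Proof. exact: (big_morph _ cImD). Qed.

Lemma cabs_ge0 (z : C) : 0 <= cabs z.
Proof. exact: sqrtr_ge0. Qed.

Lemma cabsE (z : C) : (cabs z)%:C%C = `|z|.
Proof. by rewrite normc_def. Qed.

Lemma cabs_sq (z : C) : cabs z ^+ 2 = complex.Re z ^+ 2 + complex.Im z ^+ 2.
Proof. by rewrite sqr_sqrtr // addr_ge0 ?sqr_ge0. Qed.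

Lemma cabsM (z w : C) : cabs (z * w) = cabs z * cabs w.
Proof. by apply: complexI; rewrite rmorphM /= !cabsE normrM. Qed.

Lemma cabsD (z w : C) : cabs (z + w) <= cabs z + cabs w.
Proof. by rewrite -lecR rmorphD /= !cabsE ler_normD. Qed.

Lemma cabsN (z : C) : cabs (- z) = cabs z.
Proof. by apply: complexI; rewrite !cabsE normrN. Qed.

Lemma cabsJ (z : C) : cabs (conjc z) = cabs z.
Proof. by case: z => a b; rewrite /cabs /= sqrrN. Qed.

Lemma cabs0 : cabs (0 : C) = 0.
Proof. by apply: complexI; rewrite !cabsE normr0. Qed.

Lemma cabsR (k : R) : cabs k%:C%C = `|k|.
Proof. by rewrite /cabs /= expr0n addr0 sqrtr_sqr. Qed.

Lemma cabs_eq0 (z : C) : cabs z = 0 -> z = 0.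
Proof. by move=> h; apply/eqP; rewrite -normr_eq0 -cabsE h. Qed.

Lemma cabs_sum (I : Type) (r : seq I) (P : pred I) (F : I -> C) :
  cabs (\sum_(i <- r | P i) F i) <= \sum_(i <- r | P i) cabs (F i).
Proof.
elim/big_rec2: _ => [|i x y _ h]; first by rewrite cabs0.
by apply: (le_trans (cabsD _ _)); rewrite lerD2l.
Qed.

Lemma Re_le_cabs (z : C) : complex.Re z <= cabs z.
Proof.
apply: (le_trans (ler_norm _)).
rewrite -[X in X <= _]sqrtr_sqr ler_wsqrtr // lerDl sqr_ge0 //.
Qed.

Lemma conjc_mul_self (z : C) : conjc z * z = (cabs z ^+ 2)%:C%C.
Proof.
rewrite cabs_sq; case: z => a b; rewrite /= ; apply/eqP; rewrite eq_complex /=.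
by apply/andP; split; apply/eqP; ring.
Qed.

End Adjoint.

(** * A mean value inequality for traces of odd powers *)

Section TraceInequality.
Variable R : realType.
Local Notation C := (R[i]).

Definition rtr n (M : 'M[C]_n) : R := complex.Re (\tr M).

Lemma rtrD n (A B : 'M[C]_n) : rtr (A + B) = rtr A + rtr B.
Proof. by rewrite /rtr mxtraceD cReD. Qed.
Lemma rtrN n (A : 'M[C]_n) : rtr (- A) = - rtr A.
Proof. by rewrite /rtr linearN cReN. Qed.
Lemma rtrB n (A B : 'M[C]_n) : rtr (A - B) = rtr A - rtr B.
Proof. by rewrite rtrD rtrN. Qed.
Lemma rtrZ n (k : R) (A : 'M[C]_n) : rtr (k%:C%C *: A) = k * rtr A.
Proof. by rewrite /rtr linearZ cReZ. Qed.
Lemma rtr_sum n (I : Type) (r : seq I) (P : pred I) (F : I -> 'M[C]_n) :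
  rtr (\sum_(i <- r | P i) F i) = \sum_(i <- r | P i) rtr (F i).
Proof.
by apply: (big_morph _ (@rtrD n)); rewrite /rtr linear0.
Qed.
Lemma rtrC n m (A : 'M[C]_(n, m)) (B : 'M[C]_(m, n)) : rtr (A *m B) = rtr (B *m A).
Proof. by rewrite /rtr mxtrace_mulC. Qed.

Lemma mulmx_exprS n (A : 'M[C]_n) k : A *m A ^+ k = A ^+ k.+1.
Proof. by rewrite exprS. Qed.

Lemma mulmx_exprSr n (A : 'M[C]_n) k : A ^+ k *m A = A ^+ k.+1.
Proof. by rewrite exprSr. Qed.

Lemma mulmx_conj n (U V D E : 'M[C]_n) : U *m V = 1%:M ->
  (V *m D *m U) *m (V *m E *m U) = V *m (D *m E) *m U.
Proof. by move=> h; rewrite !mulmxA -(mulmxA _ U V) h mulmx1. Qed.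

(** The spectral theorem with real eigenvalues. One unitary serves all exponents, so that different
    powers can be compared eigenvalue by eigenvalue. *)
Lemma herm_diag n (A : 'M[C]_n) : adjmx A = A ->
  exists (U : 'M[C]_n) (a : 'I_n -> R),
    [/\ adjmx U *m U = 1%:M, U *m adjmx U = 1%:M &
     forall k, A ^+ k = adjmx U *m diag_mx (\row_i ((a i) ^+ k)%:C%C) *m U].
Proof.
move=> hA.
have hA' : A \is hermsymmx.
  apply/is_hermitianmxP; rewrite expr0 scale1r -{1}hA.
  by apply/matrixP => i j; rewrite !mxE.
have /orthomx_spectralP := hermitian_normalmx hA'.
have hu := spectral_unitarymx A.
have hr := hermitian_spectral_diag_real hA'.
set U := spectralmx A in hu *; set sp := spectral_diag A in hr *.
have eU : invmx U = adjmx U.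
  by rewrite invmx_unitary //; apply/matrixP => i j; rewrite !mxE.
have hUU : U *m adjmx U = 1%:M by rewrite -eU mulmxV // unitarymx_unit.
have hUU' : adjmx U *m U = 1%:M by rewrite -eU mulVmx // unitarymx_unit.
rewrite eU => eA.
clearbody U sp; clear hu eU hA' hA.
exists U, (fun i => complex.Re (sp 0 i)); split; [exact: hUU'|exact: hUU|move=> k].
have -> : \row_i (complex.Re (sp 0 i) ^+ k)%:C%C = \row_i (sp 0 i ^+ k).
  apply/rowP => i; rewrite !mxE rmorphXn /= RRe_real //.
  by move/mxOverP : hr => /(_ 0 i).
elim: k => [|k IH].
  rewrite expr0 (_ : \row_i _ = const_mx 1); last by apply/rowP => i; rewrite !mxE expr0.
  by rewrite diag_const_mx mulmx1 hUU'.
rewrite -mulmx_exprS IH [X in X *m _]eA (mulmx_conj _ _ hUU) mulmx_diag; congr (_ *m diag_mx _ *m _).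
by apply/rowP => i; rewrite !mxE exprS.
Qed.

(** The weights are the squared overlaps |(U adj V)_ij|^2 of the two eigenbases. Being independent
    of the exponents, they let two noncommuting matrices be treated like scalars in any inequality
    that is linear in such traces. *)
Lemma herm_trace_pow n (A B : 'M[C]_n) : adjmx A = A -> adjmx B = B ->
  exists (a b : 'I_n -> R) (c : 'I_n -> 'I_n -> R),
    (forall i j, 0 <= c i j) /\
    forall k l, rtr (A ^+ k *m B ^+ l) = \sum_i \sum_j a i ^+ k * b j ^+ l * c i j.
Proof.
move=> /herm_diag [U [a [_ _ hA]]] /herm_diag [V [b [_ _ hB]]].
exists a, b, (fun i j => cabs ((U *m adjmx V) i j) ^+ 2); split=> [i j|k l].
  exact: sqr_ge0.
rewrite hA hB -!mulmxA rtrC -!mulmxA (mulmxA U).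
set W := U *m adjmx V.
have -> : V *m adjmx U = adjmx W by rewrite adjmxM adjmxK.
pose da := \row_i (a i ^+ k)%:C%C; pose db := \row_i (b i ^+ l)%:C%C.
rewrite -/da -/db.
rewrite /rtr /mxtrace cRe_sum; apply: eq_bigr => i _.
rewrite mul_diag_mx mxE [da 0 i]mxE cReZ [(W *m _) i i]mxE cRe_sum mulr_sumr.
apply: eq_bigr => j _.
rewrite mul_diag_mx mxE adjmxE [db 0 j]mxE mulrCA cReZ [W i j * _]mulrC conjc_mul_self /=.
by rewrite mulrA.
Qed.

(** Factor out a - b and pair the monomials of indices i and N - i, where N = 2k. Each pair is at
    most a^N + b^N by rearrangement, and N + 1 monomials make (N + 1) / 2 pairs. *)
Lemma power_mean_value (a b : R) k :
  (a - b) * (a ^+ k.*2.+1 - b ^+ k.*2.+1)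
    <= (k.*2.+1%:R / 2) * ((a - b) ^+ 2 * (a ^+ k.*2 + b ^+ k.*2)).
Proof.
rewrite subrXX mulrA -expr2 mulrCA ler_wpM2l ?sqr_ge0 //=.
set N := k.*2.
have pair i : (i <= N)%N ->
    a ^+ (N - i) * b ^+ i + a ^+ i * b ^+ (N - i) <= a ^+ N + b ^+ N.
  move=> iN.
  have h (x y : R) : x ^+ (N - i) * y ^+ i <= `|x| ^+ (N - i) * `|y| ^+ i.
    by rewrite -!normrX -normrM; exact: ler_norm.
  apply: (@le_trans _ _ (`|a| ^+ (N - i) * `|b| ^+ i + `|b| ^+ (N - i) * `|a| ^+ i)).
    by rewrite lerD // [X in X <= _]mulrC.
  have e (x : R) : x ^+ N = `|x| ^+ (N - i) * `|x| ^+ i.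
    by rewrite -exprD subnK // -normrX ger0_norm // /N -mul2n exprM exprn_ge0 ?sqr_ge0.
  rewrite !e -subr_ge0.
  set p := `|a|; set q := `|b|.
  rewrite (_ : _ - _ = (p ^+ (N - i) - q ^+ (N - i)) * (p ^+ i - q ^+ i)); last by ring.
  have p0 : 0 <= p by exact: normr_ge0.
  have q0 : 0 <= q by exact: normr_ge0.
  case: (leP p q) => pq.
    by rewrite -mulrNN mulr_ge0 // oppr_ge0 subr_le0; apply: lerXn2r.
  by rewrite mulr_ge0 // subr_ge0; apply: lerXn2r => //; apply: ltW.
pose G (i : 'I_N.+1) := a ^+ (N.+1 - i.+1) * b ^+ i.
have e1 : \sum_i G i = \sum_i G (rev_ord i) by rewrite (reindex_inj rev_ord_inj).
have e2 : \sum_i G i = 2^-1 * \sum_i (G i + G (rev_ord i)).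
  by rewrite big_split /= -e1; field.
rewrite -/(\sum_i G i) e2.
have : \sum_i (G i + G (rev_ord i)) <= \sum_(i < N.+1) (a ^+ N + b ^+ N).
  apply: ler_sum => i _; rewrite /G /= !subSS.
  have iN : (i <= N)%N by rewrite -ltnS.
  have := pair i iN; rewrite subKn //.
rewrite sumr_const card_ord -[X in _ <= X]mulr_natl => h.
by rewrite [_ / 2]mulrC -mulrA ler_wpM2l // invr_ge0.
Qed.

Lemma rtr_rot n (X Y Z : 'M[C]_n) : rtr (X *m (Y *m Z)) = rtr (Z *m X *m Y).
Proof. by rewrite mulmxA rtrC mulmxA. Qed.

Lemma rtr_mulBB n (A B P Q : 'M[C]_n) : rtr ((A - B) *m (P - Q)) =
  rtr (A *m P) - rtr (A *m Q) - rtr (B *m P) + rtr (B *m Q).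
Proof. by rewrite mulmxBl !mulmxBr !rtrB; ring. Qed.

Lemma rtr_sqB n (A B P : 'M[C]_n) : rtr ((A - B) *m (A - B) *m P) =
  rtr (A *m (A *m P)) - rtr (A *m (B *m P)) - rtr (B *m (A *m P))
  + rtr (B *m (B *m P)).
Proof. by rewrite -mulmxA (mulmxBl A B P) rtr_mulBB. Qed.

(* Expanded in the eigenbases of A and B, both sides become sums over pairs of eigenvalues with the same nonnegative weights. *)
Lemma mean_value_trace n (A B : 'M[C]_n) k : adjmx A = A -> adjmx B = B ->
  rtr ((A - B) *m (A ^+ k.*2.+1 - B ^+ k.*2.+1))
    <= (k.*2.+1%:R / 2) * rtr ((A - B) *m (A - B) *m (A ^+ k.*2 + B ^+ k.*2)).
Proof.
move=> hA hB; have [a [b [c [c0 E]]]] := herm_trace_pow hA hB.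
have EA l : rtr (A ^+ l) = \sum_i \sum_j a i ^+ l * b j ^+ 0 * c i j.
  by rewrite -E expr0 mulmx1.
have EB l : rtr (B ^+ l) = \sum_i \sum_j a i ^+ 0 * b j ^+ l * c i j.
  by rewrite -E expr0 mul1mx.
set N := k.*2; set q := N.+1.
have sq (X : 'M[C]_n) : X *m X = X ^+ 2 by exact: (mulmx_exprS X 1).
(* By cyclicity of the trace, every word met below can be brought to the form A^k B^l. *)
pose S (k l : nat) := \sum_i \sum_j a i ^+ k * b j ^+ l * c i j.
have hA1 : rtr (A *m A ^+ q) = S q.+1 0.
  exact: etrans (congr1 (@rtr n) (mulmx_exprS A q)) (EA _).
have hB1 : rtr (B *m B ^+ q) = S 0 q.+1.
  exact: etrans (congr1 (@rtr n) (mulmx_exprS B q)) (EB _).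
have h1q : rtr (A *m B ^+ q) = S 1 q by exact: (E 1%N q).
have hq1 : rtr (A ^+ q *m B) = S q 1 by exact: (E q 1%N).
have hq1' : rtr (B *m A ^+ q) = S q 1 by exact: etrans (rtrC _ _) hq1.
have -> : rtr ((A - B) *m (A ^+ q - B ^+ q)) = S q.+1 0 - S 1 q - S q 1 + S 0 q.+1.
  apply: etrans (rtr_mulBB _ _ _ _) _.
  exact: (f_equal2 +%R (f_equal2 +%R (f_equal2 +%R hA1 (congr1 -%R h1q)) (congr1 -%R hq1')) hB1).
have g1 : rtr (A *m (A *m A ^+ N)) = S q.+1 0.
  exact: etrans (congr1 (fun X => rtr (A *m X)) (mulmx_exprS A N)) hA1.
have g2 : rtr (A *m (B *m A ^+ N)) = S q 1.
  apply: etrans (rtr_rot _ _ _) _.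
  exact: etrans (congr1 (fun X => rtr (X *m B)) (mulmx_exprSr A N)) hq1.
have g3 : rtr (B *m (A *m A ^+ N)) = S q 1.
  exact: etrans (congr1 (fun X => rtr (B *m X)) (mulmx_exprS A N)) hq1'.
have g4 : rtr (B *m (B *m A ^+ N)) = S N 2.
  apply: etrans (rtr_rot _ _ _) _; rewrite -mulmxA.
  exact: etrans (congr1 (fun X => rtr (A ^+ N *m X)) (sq B)) (E _ _).
have g5 : rtr (A *m (A *m B ^+ N)) = S 2 N.
  rewrite mulmxA.
  exact: etrans (congr1 (fun X => rtr (X *m B ^+ N)) (sq A)) (E _ _).
have g6 : rtr (A *m (B *m B ^+ N)) = S 1 q.
  exact: etrans (congr1 (fun X => rtr (A *m X)) (mulmx_exprS B N)) h1q.
have g7 : rtr (B *m (A *m B ^+ N)) = S 1 q.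
  apply: etrans (rtr_rot _ _ _) _.
  apply: etrans (congr1 (fun X => rtr (X *m A)) (mulmx_exprSr B N)) _.
  exact: etrans (rtrC _ _) h1q.
have g8 : rtr (B *m (B *m B ^+ N)) = S 0 q.+1.
  exact: etrans (congr1 (fun X => rtr (B *m X)) (mulmx_exprS B N)) hB1.
have comb (x y z t x' y' z' t' : R) : x = x' -> y = y' -> z = z' -> t = t' ->
  x - y - z + t = x' - y' - z' + t' by move=> -> -> -> ->.
have -> : rtr ((A - B) *m (A - B) *m (A ^+ N + B ^+ N)) =
    S q.+1 0 - S q 1 - S q 1 + S N 2 + (S 2 N - S 1 q - S 1 q + S 0 q.+1).
  rewrite mulmxDr rtrD.
  apply: f_equal2; apply: etrans (rtr_sqB _ _ _) _.
    exact: comb g1 g2 g3 g4.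
  exact: comb g5 g6 g7 g8.
rewrite /S; clear -c0.
pose T (F : 'I_n -> 'I_n -> R) := \sum_i \sum_j F i j.
have SD F G : T F + T G = T (fun i j => F i j + G i j).
  by rewrite /T -big_split; apply: eq_bigr => i _; rewrite -big_split.
have SZ t F : t * T F = T (fun i j => t * F i j).
  by rewrite /T mulr_sumr; apply: eq_bigr => i _; rewrite mulr_sumr.
have SN F : - T F = T (fun i j => - F i j).
  by rewrite -mulN1r SZ; apply: eq_bigr => i _; apply: eq_bigr => j _; rewrite mulN1r.
rewrite -/(T (fun i j => a i ^+ q.+1 * b j ^+ 0 * c i j)).
rewrite -/(T (fun i j => a i ^+ 0 * b j ^+ q.+1 * c i j)).
rewrite -/(T (fun i j => a i ^+ 1 * b j ^+ q * c i j)).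
rewrite -/(T (fun i j => a i ^+ q * b j ^+ 1 * c i j)).
rewrite -/(T (fun i j => a i ^+ N * b j ^+ 2 * c i j)).
rewrite -/(T (fun i j => a i ^+ 2 * b j ^+ N * c i j)).
rewrite !(SZ, SN, SD).
apply: ler_sum => i _; apply: ler_sum => j _.
have := power_mean_value (a i) (b j) k.
move/(ler_wpM2r (c0 i j)); rewrite -/N -/q.
set u := a i; set v := b j; set w := c i j.
have e (x : R) : x ^+ q.+1 = x * (x * x ^+ N) by rewrite !exprS.
have e' (x : R) : x ^+ q = x * x ^+ N by rewrite !exprS.
rewrite !(e, e') !expr0 !expr1 !expr2.
set U := u ^+ _; set V := v ^+ _; set Q := q%:R.
by congr (_ <= _); ring.
Qed.
End TraceInequality.

(** * Inner products and the Euclidean norm *)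

Section Norms.
Variable R : realType.
Local Notation C := (R[i]).

Definition dot n (u v : 'cV[C]_n) : C := (adjmx u *m v) 0 0.

Lemma dotE n (u v : 'cV[C]_n) : dot u v = \sum_i conjc (u i 0) * v i 0.
Proof. by rewrite /dot mxE; apply: eq_bigr => i _; rewrite adjmxE. Qed.

Lemma dotDr n (u v w : 'cV[C]_n) : dot u (v + w) = dot u v + dot u w.
Proof. by rewrite /dot mulmxDr mxE. Qed.
Lemma dotNr n (u v : 'cV[C]_n) : dot u (- v) = - dot u v.
Proof. by rewrite /dot mulmxN mxE. Qed.
Lemma dotBr n (u v w : 'cV[C]_n) : dot u (v - w) = dot u v - dot u w.
Proof. by rewrite dotDr dotNr. Qed.
Lemma dotDl n (u v w : 'cV[C]_n) : dot (v + w) u = dot v u + dot w u.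
Proof. by rewrite /dot adjmxD mulmxDl mxE. Qed.
Lemma dotZr n (k : C) (u v : 'cV[C]_n) : dot u (k *: v) = k * dot u v.
Proof. by rewrite /dot -scalemxAr mxE. Qed.
Lemma dotC n (u v : 'cV[C]_n) : dot u v = conjc (dot v u).
Proof.
rewrite !dotE rmorph_sum /=; apply: eq_bigr => i _.
by rewrite rmorphM /= conjcK mulrC.
Qed.

Lemma dot_adj m n (A : 'M[C]_(m, n)) (u : 'cV[C]_m) (v : 'cV[C]_n) :
  dot u (A *m v) = dot (adjmx A *m u) v.
Proof. by rewrite /dot adjmxM adjmxK mulmxA. Qed.

Lemma l2norm_ge0 n (v : 'cV[C]_n) : 0 <= l2norm v.
Proof. exact: sqrtr_ge0. Qed.

Lemma l2norm_sq n (v : 'cV[C]_n) : l2norm v ^+ 2 = \sum_i cabs (v i 0) ^+ 2.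
Proof. by rewrite sqr_sqrtr // sumr_ge0 // => i _; exact: sqr_ge0. Qed.

Lemma dot_self n (v : 'cV[C]_n) : dot v v = (l2norm v ^+ 2)%:C%C.
Proof.
rewrite dotE l2norm_sq rmorph_sum /=; apply: eq_bigr => i _; exact: conjc_mul_self.
Qed.

Lemma l2norm_eq0 n (v : 'cV[C]_n) : l2norm v = 0 -> v = 0.
Proof.
move=> h; have : \sum_i cabs (v i 0) ^+ 2 = 0 by rewrite -l2norm_sq h expr0n.
move/psumr_eq0P => h'; apply/colP => i; rewrite mxE.
apply: cabs_eq0; apply/eqP; rewrite -sqrf_eq0; apply/eqP.
by apply: h' => // j _; exact: sqr_ge0.
Qed.

(** Lagrange's identity: the double sum of (a_i b_j - a_j b_i)^2 equals 2 (X Y - W^2). *)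
Lemma sum_mul_le_sqrt (I : finType) (a b : I -> R) :
  \sum_i a i * b i <= Num.sqrt (\sum_i a i ^+ 2) * Num.sqrt (\sum_i b i ^+ 2).
Proof.
set X := \sum_i a i ^+ 2; set Y := \sum_i b i ^+ 2; set W := \sum_i _.
have X0 : 0 <= X by apply: sumr_ge0 => i _; exact: sqr_ge0.
have Y0 : 0 <= Y by apply: sumr_ge0 => i _; exact: sqr_ge0.
rewrite -sqrtrM //; apply: (le_trans (ler_norm _)).
rewrite -sqrtr_sqr ler_wsqrtr //.
have : 0 <= \sum_i \sum_j (a i * b j - a j * b i) ^+ 2.
  by apply: sumr_ge0 => i _; apply: sumr_ge0 => j _; exact: sqr_ge0.
have -> : \sum_i \sum_j (a i * b j - a j * b i) ^+ 2 = 2 * (X * Y) - 2 * (W ^+ 2).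
  have E (F G : I -> R) : (\sum_i F i) * (\sum_j G j) = \sum_i \sum_j F i * G j.
    by rewrite mulr_suml; apply: eq_bigr => i _; rewrite mulr_sumr.
  have -> : 2 * (X * Y) - 2 * W ^+ 2 = X * Y + Y * X - W * W - W * W by ring.
  rewrite !E -big_split -!sumrB; apply: eq_bigr => i _ /=.
  rewrite -big_split -!sumrB; apply: eq_bigr => j _ /=; ring.
by move=> h; lra.
Qed.

Lemma dot_cs n (u v : 'cV[C]_n) : cabs (dot u v) <= l2norm u * l2norm v.
Proof.
rewrite dotE; apply: (le_trans (cabs_sum _ _ _)).
under eq_bigr => i _ do rewrite cabsM cabsJ.
exact: sum_mul_le_sqrt.
Qed.

Lemma Re_dot_cs n (u v : 'cV[C]_n) : complex.Re (dot u v) <= l2norm u * l2norm v.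
Proof. exact: le_trans (Re_le_cabs _) (dot_cs _ _). Qed.

Lemma l2norm_sq_dot n (v : 'cV[C]_n) : l2norm v ^+ 2 = complex.Re (dot v v).
Proof. by rewrite dot_self. Qed.

Lemma Re_dotC n (u v : 'cV[C]_n) : complex.Re (dot u v) = complex.Re (dot v u).
Proof. by rewrite dotC; case: (dot v u). Qed.

Lemma l2norm_sqD n (u v : 'cV[C]_n) :
  l2norm (u + v) ^+ 2 = l2norm u ^+ 2 + 2 * complex.Re (dot u v) + l2norm v ^+ 2.
Proof.
rewrite !l2norm_sq_dot dotDl !dotDr !cReD [complex.Re (dot v u)]Re_dotC.
by ring.
Qed.

Lemma l2normN n (v : 'cV[C]_n) : l2norm (- v) = l2norm v.
Proof. by congr Num.sqrt; apply: eq_bigr => i _; rewrite mxE cabsN. Qed.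

Lemma l2norm_sqB n (u v : 'cV[C]_n) :
  l2norm (u - v) ^+ 2 = l2norm u ^+ 2 - 2 * complex.Re (dot u v) + l2norm v ^+ 2.
Proof. by rewrite l2norm_sqD l2normN dotNr cReN mulrN. Qed.

Lemma l2norm_parallelogram n (u v : 'cV[C]_n) :
  l2norm (u + v) ^+ 2 + l2norm (u - v) ^+ 2 = 2 * l2norm u ^+ 2 + 2 * l2norm v ^+ 2.
Proof. by rewrite l2norm_sqB l2norm_sqD; ring. Qed.

Lemma l2normD n (u v : 'cV[C]_n) : l2norm (u + v) <= l2norm u + l2norm v.
Proof.
have h : 0 <= l2norm u + l2norm v by rewrite addr_ge0 ?l2norm_ge0.
rewrite -(@ler_pXn2r _ 2) ?nnegrE ?l2norm_ge0 // l2norm_sqD sqrrD.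
rewrite lerD2r lerD2l -[leRHS]mulr_natl; apply: ler_wpM2l => //; exact: Re_dot_cs.
Qed.

Lemma l2normZ n (k : C) (v : 'cV[C]_n) : l2norm (k *: v) = cabs k * l2norm v.
Proof.
rewrite /l2norm; under eq_bigr => i _ do rewrite mxE cabsM exprMn.
by rewrite -mulr_sumr sqrtrM ?sqr_ge0 // sqrtr_sqr ger0_norm // cabs_ge0.
Qed.

Lemma l2norm0 n : l2norm (0 : 'cV[C]_n) = 0.
Proof.
have := l2norm_sq_dot (0 : 'cV[C]_n).
rewrite /dot mulmx0 mxE /= => /eqP; rewrite sqrf_eq0 => /eqP //.
Qed.

Lemma l2norm_sum n (I : Type) (r : seq I) (P : pred I) (F : I -> 'cV[C]_n) :
  l2norm (\sum_(i <- r | P i) F i) <= \sum_(i <- r | P i) l2norm (F i).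
Proof.
elim/big_rec2: _ => [|i x y _ h]; first by rewrite l2norm0.
by apply: (le_trans (l2normD _ _)); rewrite lerD2l.
Qed.

Lemma l2norm_le_l1norm n (v : 'cV[C]_n) : l2norm v <= l1norm v.
Proof.
have h : 0 <= l1norm v by apply: sumr_ge0 => i _; exact: cabs_ge0.
rewrite -(@ler_pXn2r _ 2) ?nnegrE ?l2norm_ge0 // l2norm_sq.
rewrite [leRHS]expr2 {1}/l1norm mulr_suml; apply: ler_sum => i _.
rewrite expr2 ler_wpM2l ?cabs_ge0 // /l1norm (bigD1 i) //= lerDl.
by apply: sumr_ge0 => j _; exact: cabs_ge0.
Qed.

End Norms.

(** * Positive semidefinite matrices *)

Section Positivity.
Variable R : realType.
Local Notation C := (R[i]).

Lemma mulmx_exprD n (A : 'M[C]_n) j k : A ^+ j *m A ^+ k = A ^+ (j + k).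
Proof. by rewrite exprD. Qed.

Lemma rtr_psd n p (K : 'M[C]_n) (N : 'M[C]_(n, p)) :
  (forall v : 'cV[C]_n, 0 <= complex.Re (dot v (K *m v))) ->
  0 <= rtr (adjmx N *m K *m N).
Proof.
move=> h; rewrite /rtr /mxtrace cRe_sum; apply: sumr_ge0 => i _.
suff -> : (adjmx N *m K *m N) i i = dot (col i N) (K *m col i N) by exact: h.
rewrite dotE -mulmxA mxE; apply: eq_bigr => j _; rewrite adjmxE [col i N j 0]mxE.
by congr (_ * _); rewrite !mxE; apply: eq_bigr => k _; rewrite mxE.
Qed.

(** Z^(2k) is the square of the Hermitian matrix Z^k, so the trace is that of Z^k K Z^k. *)
Lemma rtr_psd_even n (K Z : 'M[C]_n) k : adjmx Z = Z ->
  (forall v : 'cV[C]_n, 0 <= complex.Re (dot v (K *m v))) ->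
  0 <= rtr (K *m Z ^+ k.*2).
Proof.
move=> hZ hK; have := rtr_psd (Z ^+ k) hK.
rewrite (hermX k hZ) rtrC mulmxA rtrC => h; apply: le_trans h _.
by rewrite le_eqVlt (congr1 (fun X => rtr (K *m X)) (mulmx_exprD Z k k)) addnn eqxx.
Qed.

(* For h = b^* b this says 0 <= h <= r in the Loewner order. *)
Definition psd_le n (h : 'M[C]_n) (r : R) : Prop :=
  adjmx h = h /\
  forall v : 'cV[C]_n, l2norm (h *m v) ^+ 2 <= r * complex.Re (dot v (h *m v)).

(** With y = b v and z = adj(b) y, |z|^2 = <b z, y> is at most |y| |b z|, and |b z|^2 <= r |z|^2.
    Everything is squared before |z|^2 is cancelled, so the case z = 0 is separate. *)
Lemma psd_le_gram a n (b : 'M[C]_(a, n)) (r : R) : 0 <= r ->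
  opnorm_le (adjmx b *m b) r -> psd_le (adjmx b *m b) r.
Proof.
move=> r0 hb; split; first by rewrite adjmxM adjmxK.
have hbv (v : 'cV[C]_n) : l2norm (b *m v) ^+ 2 <= r * l2norm v ^+ 2.
  rewrite l2norm_sq_dot dot_adj mulmxA Re_dotC.
  apply: (le_trans (Re_dot_cs _ _)); rewrite [_ ^+ 2]expr2 mulrA.

  rewrite [leRHS]mulrC; apply: ler_wpM2l; rewrite ?l2norm_ge0 //; exact: hb.
move=> v; rewrite -mulmxA [in leRHS]dot_adj adjmxK -l2norm_sq_dot.
set y := b *m v; set z := adjmx b *m y.
have h1 : l2norm z ^+ 2 <= l2norm y * l2norm (b *m z).
  have e : dot z z = dot (b *m z) y.
    by rewrite -[X in dot (X *m _) _]adjmxK -dot_adj.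
  rewrite l2norm_sq_dot e mulrC; exact: Re_dot_cs.
have h2 := hbv z.
case: (leP (l2norm z) 0) => hz.
  have -> : l2norm z = 0 by apply/eqP; rewrite eq_le hz l2norm_ge0.
  by rewrite expr0n mulr_ge0 ?sqr_ge0.
have h3 : (l2norm z ^+ 2) ^+ 2 <= l2norm y ^+ 2 * (r * l2norm z ^+ 2).
  apply: (@le_trans _ _ ((l2norm y * l2norm (b *m z)) ^+ 2)).
    by apply: lerXn2r; rewrite ?nnegrE ?sqr_ge0 // mulr_ge0 ?l2norm_ge0.
  by rewrite exprMn ler_wpM2l ?sqr_ge0.
have hz2 : 0 < l2norm z ^+ 2 by rewrite exprn_gt0.
by rewrite -(ler_pM2r hz2) -expr2 (le_trans h3) // mulrCA mulrA.
Qed.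

(** In the Loewner order (h - h')^2 <= 2 h^2 + 2 h'^2 <= 2 r (h + h'), the first step by the
    parallelogram identity. *)
Lemma rtr_sqB_psd n (h h' Z : 'M[C]_n) r k : adjmx Z = Z ->
  psd_le h r -> psd_le h' r ->
  rtr ((h - h') *m (h - h') *m Z ^+ k.*2) <= 2 * r * rtr ((h + h') *m Z ^+ k.*2).
Proof.
move=> hZ [ah Hh] [ah' Hh'].
rewrite -subr_ge0 -rtrZ -rtrB scalemxAl -mulmxBl.
apply: rtr_psd_even => // v.
rewrite mulmxBl dotBr cReB -scalemxAl dotZr cReZ mulmxDl dotDr cReD.
have -> : dot v ((h - h') *m (h - h') *m v) = dot (h *m v - h' *m v) (h *m v - h' *m v).
  by rewrite -mulmxA dot_adj adjmxB ah ah' mulmxBl.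
rewrite -l2norm_sq_dot.
have := Hh v; have := Hh' v; have := l2norm_parallelogram (h *m v) (h' *m v).
have := sqr_ge0 (l2norm (h *m v + h' *m v)).
move: (h *m v) (h' *m v) => y z.
move: (l2norm (y + z) ^+ 2) (l2norm (y - z) ^+ 2) (l2norm y ^+ 2) (l2norm z ^+ 2) => a1 a2 a3 a4.
move: (complex.Re (dot v y)) (complex.Re (dot v z)) => a5 a6.
lra.
Qed.

(** The trace of an even power dominates that power of each single eigenvalue, and p > 0 allows the
    root to be taken. *)
Lemma opnorm_le_trace n (E : 'M[C]_n) p (dl : R) : adjmx E = E -> 0 <= dl ->
  (0 < p)%N -> rtr (E ^+ p.*2) <= dl ^+ p.*2 -> opnorm_le E dl.
Proof.
move=> hE dl0 p0 ht v.
have [U [a [UU UU' hU]]] := herm_diag hE.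
have ha i : a i ^+ 2 <= dl ^+ 2.
  have : a i ^+ p.*2 <= dl ^+ p.*2.
    apply: le_trans ht; rewrite hU -mulmxA rtrC -mulmxA UU' mulmx1.
    rewrite /rtr mxtrace_diag cRe_sum (bigD1 i) //= mxE /= lerDl.
    apply: sumr_ge0 => j _; rewrite mxE /= -mul2n exprM.
    by rewrite exprn_ge0 // sqr_ge0.
  by rewrite -mul2n !exprM ler_pXn2r // nnegrE sqr_ge0.
have nU (w : 'cV[C]_n) : l2norm (U *m w) ^+ 2 = l2norm w ^+ 2.
  by rewrite !l2norm_sq_dot dot_adj mulmxA UU mul1mx.
rewrite -(@ler_pXn2r _ 2) ?nnegrE ?mulr_ge0 ?l2norm_ge0 //.
rewrite exprMn -(nU v) -(nU (E *m v)).
have -> : U *m (E *m v) = diag_mx (\row_i (a i ^+ 1)%:C%C) *m (U *m v).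
  by rewrite -{1}[E]expr1 hU !mulmxA UU' mul1mx.
rewrite !l2norm_sq mulr_sumr; apply: ler_sum => i _.
rewrite mul_diag_mx mxE cabsM exprMn.
apply: ler_wpM2r; first exact: sqr_ge0.
by rewrite [X in cabs X]mxE cabsR real_normK ?num_real // expr1.
Qed.

End Positivity.

(** * Local isometries and the dual certificate *)

Section Certificate.
Variable R : realType.
Local Notation C := (R[i]).

Lemma le_mulB1 (a b c : R) : a <= b -> b <= c * (1 + a) -> a * (1 - c) <= c.
Proof. lra. Qed.

(** (1 - t) c <= (1 - t) a b <= ((1 - t)^2 a^2 + b^2) / 2, and (1 - t) a^2 <= c lets the first term
    be absorbed. *)
Lemma le_energy (a b c s t : R) : t < 1 -> c <= a * b -> - (t * a ^+ 2) <= c - a ^+ 2 ->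
  b ^+ 2 <= s -> (1 - t) * c <= s.
Proof.
move=> t1 h2 h1 bs; have t0 : 0 < 1 - t by lra.
have q2 : (1 - t) * c <= ((1 - t) ^+ 2 * a ^+ 2 + b ^+ 2) / 2.
  have := sqr_ge0 ((1 - t) * a - b); have := ler_wpM2l (ltW t0) h2.
  by rewrite sqrrB exprMn; lra.
have := ler_wpM2l (ltW t0) h1; move: q2 bs; rewrite [(1 - t) ^+ 2]expr2; lra.
Qed.

Lemma l2norm_sq_le n (u v : 'cV[C]_n) :
  (forall i, cabs (u i 0) <= cabs (v i 0)) -> l2norm u ^+ 2 <= l2norm v ^+ 2.
Proof.
by move=> h; rewrite !l2norm_sq; apply: ler_sum => i _; rewrite lerXn2r ?nnegrE ?cabs_ge0.
Qed.

Definition projmx n (T : {set 'I_n}) : 'M[C]_n :=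
  diag_mx (\row_i (i \in T)%:R).

Lemma projmxE n (T : {set 'I_n}) (v : 'cV[C]_n) i :
  (projmx T *m v) i 0 = if i \in T then v i 0 else 0.
Proof. by rewrite mul_diag_mx !mxE; case: ifP; rewrite ?mul1r ?mul0r. Qed.

Lemma adj_projmx n (T : {set 'I_n}) : adjmx (projmx T) = projmx T.
Proof.
apply/matrixP => i j; rewrite adjmxE !mxE eq_sym.
by case: eqP => [->|_]; rewrite ?mulr0n ?conjc0 // mulr1n conjc_nat.
Qed.

Lemma projmx_id n (T : {set 'I_n}) (v : 'cV[C]_n) :
  (forall i, i \notin T -> v i 0 = 0) -> projmx T *m v = v.
Proof.
move=> h; apply/colP => i; rewrite projmxE; case: ifP => // /negbT iT.
by rewrite h.
Qed.

Lemma l2norm_delta n (j : 'I_n) : l2norm (delta_mx j 0 : 'cV[C]_n) = 1.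
Proof.
rewrite /l2norm (bigD1 j) //= big1 ?addr0 => [|i ij]; rewrite mxE ?eqxx ?(negbTE ij) /=.
  by rewrite (_ : cabs 1 = 1) ?expr1n ?sqrtr1 // (cabsR 1) normr1.
by rewrite cabs0 expr0n.
Qed.

(** This bounds the norm of the T-block of M minus the identity. It is phrased on vectors of full
    length so that all the sets T share one space. *)
Definition local_isometry n (M : 'M[C]_n) (T : {set 'I_n}) (dl : R) : Prop :=
  forall v : 'cV[C]_n, (forall i, i \notin T -> v i 0 = 0) ->
    l2norm (projmx T *m (M *m v - v)) <= dl * l2norm v.

(* Padding by the identity off S makes the Gram matrix of the columns in S a square matrix of full size. *)
Definition padded_gram n (M : 'M[C]_n) (S : {set 'I_n}) : 'M[C]_n :=
  projmx S *m M *m projmx S + (1%:M - projmx S).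

Lemma local_isometry_sub n (M : 'M[C]_n) (S T : {set 'I_n}) dl :
  S \subset T -> local_isometry M T dl -> local_isometry M S dl.
Proof.
move=> /fintype.subsetP ST h v vS; apply: (@le_trans _ _ (l2norm (projmx T *m (M *m v - v)))).
  apply: ler_wsqrtr; apply: ler_sum => i _; rewrite !projmxE.
  case: ifP => [/ST ->//|_]; rewrite cabs0 expr0n; exact: sqr_ge0.
by apply: h => i iT; apply: vS; apply: contra iT; exact: ST.
Qed.

Lemma local_isometry_dot n (M : 'M[C]_n) (T : {set 'I_n}) dl (v : 'cV[C]_n) :
  local_isometry M T dl -> (forall i, i \notin T -> v i 0 = 0) ->
  `|complex.Re (dot v (M *m v)) - l2norm v ^+ 2| <= dl * l2norm v ^+ 2.
Proof.
move=> h vT; have hv := h v vT.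
have -> : complex.Re (dot v (M *m v)) - l2norm v ^+ 2 =
    complex.Re (dot v (projmx T *m (M *m v - v))).
  by rewrite [in RHS]dot_adj adj_projmx projmx_id // dotBr cReB -l2norm_sq_dot.
have b (w : 'cV[C]_n) : l2norm w <= dl * l2norm v ->
    complex.Re (dot v w) <= dl * l2norm v ^+ 2.
  move=> hw; apply: (le_trans (Re_dot_cs _ _)).
  by rewrite expr2 mulrA [leRHS]mulrC; apply: ler_wpM2l; rewrite ?l2norm_ge0.
rewrite ler_norml; apply/andP; split; last exact: b.
by rewrite lerNl -cReN -dotNr; apply: b; rewrite l2normN.
Qed.

Section FixedSupport.
Variables (n : nat) (M : 'M[C]_n) (S : {set 'I_n}) (dl : R).
Hypothesis hM : adjmx M = M.
Hypothesis dl0 : 0 <= dl.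
Hypothesis dl1 : dl < 1.
Hypothesis iso : forall j, j \notin S -> local_isometry M (S :|: [set j]) dl.
Hypothesis Sn : (#|S| < n)%N.

Lemma isoS : local_isometry M S dl.
Proof.
have [j jS] : exists j, j \notin S.
  apply/existsP; rewrite -negb_forall; apply: contraL Sn => /forallP h.
  rewrite -leqNgt -[n in (n <= _)%N]card_ord; apply: subset_leq_card.
  by apply/fintype.subsetP => i _; exact: h.
by apply: local_isometry_sub (iso jS); rewrite finset.subsetUl.
Qed.

Local Notation G := (padded_gram M S).
Local Notation P := (projmx S).

Lemma padded_gram_herm : adjmx G = G.
Proof.
by rewrite /padded_gram adjmxD adjmxB adjmx1 !adjmxM adj_projmx hM mulmxA.
Qed.

Lemma padded_gram_supp (v : 'cV[C]_n) : (forall i, i \notin S -> v i 0 = 0) ->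
  G *m v = P *m (M *m v).
Proof.
by move=> vS; rewrite /padded_gram mulmxDl mulmxBl mul1mx -!mulmxA (projmx_id vS) subrr addr0.
Qed.

Lemma padded_gram_off (v : 'cV[C]_n) i : i \notin S -> (G *m v) i 0 = v i 0.
Proof.
move=> iS; rewrite /padded_gram mulmxDl mulmxBl mul1mx -!mulmxA mxE projmxE (negbTE iS).
by rewrite add0r mxE [X in _ + X]mxE projmxE (negbTE iS) subr0.
Qed.

(** Off S the matrix acts as the identity, so a kernel vector is supported on S; there it satisfies
    |v| <= dl |v| with dl < 1. *)
Lemma padded_gram_inj (v : 'cV[C]_n) : G *m v = 0 -> v = 0.
Proof.
move=> Gv; have vS i : i \notin S -> v i 0 = 0.
  by move=> iS; rewrite -(padded_gram_off v iS) Gv mxE.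
have := isoS vS.
rewrite mulmxBr -padded_gram_supp // Gv projmx_id // sub0r l2normN => h.
apply: l2norm_eq0; apply/eqP; rewrite eq_le l2norm_ge0 andbT.
by have : 0 < 1 - dl; [rewrite subr_gt0; exact: dl1|move=> d; rewrite -(pmulr_rle0 _ d) mulrBl mul1r subr_le0].
Qed.

Lemma padded_gram_unit : G \in unitmx.
Proof.
rewrite -row_free_unit; apply: inj_row_free => u uG.
rewrite -[u]adjmxK (@padded_gram_inj (adjmx u)) ?adjmx0 //.
by rewrite -{1}padded_gram_herm -adjmxM uG adjmx0.
Qed.

(** For M = adj(A) A this is the pseudo-inverse of A_S applied to column j, extended by zero. *)
Definition coef_vec (j : 'I_n) : 'cV[C]_n := invmx G *m (P *m (M *m delta_mx j 0)).

Lemma coef_vec_eq j : G *m coef_vec j = P *m (M *m delta_mx j 0).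
Proof. exact: (mulKVmx padded_gram_unit). Qed.

Lemma coef_vec_supp j i : i \notin S -> coef_vec j i 0 = 0.
Proof.
by move=> iS; rewrite -(padded_gram_off _ iS) coef_vec_eq projmxE (negbTE iS).
Qed.

(* With w := e_j - u, the vector M w vanishes on S, so M - 1 maps w to u plus a multiple of e_j; this gives |u|^2 <= dl^2 (1 + |u|^2). *)
Lemma coef_vec_norm j : j \notin S ->
  l2norm (coef_vec j) ^+ 2 * (1 - dl ^+ 2) <= dl ^+ 2.
Proof.
move=> jS; set u := coef_vec j.
set e : 'cV[C]_n := delta_mx j 0.
have uS i : i \notin S -> u i 0 = 0 by exact: coef_vec_supp.
have uj := uS j jS.
have dot_ue : dot u e = 0.
  rewrite dotE (bigD1 j) //= uj conjc0 mul0r add0r big1 // => i ij.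
  by rewrite [e i 0]mxE (negbTE ij) mulr0.
have wT i : i \notin S :|: [set j] -> (e - u) i 0 = 0.
  rewrite !inE negb_or => /andP[iS /negbTE ij]; rewrite mxE [e i 0]mxE [(- u) i 0]mxE ij /= sub0r.
  by rewrite (uS i iS) oppr0.
have hw := iso jS wT.
have w2 : l2norm (e - u) ^+ 2 = 1 + l2norm u ^+ 2.
  by rewrite l2norm_sqB l2norm_delta Re_dotC dot_ue /= mulr0 subr0 expr1n.
set z := projmx _ *m _ in hw.
have z2 : l2norm u ^+ 2 <= l2norm z ^+ 2.
  apply: l2norm_sq_le => i.
  case: (boolP (i \in S)) => iS; last first.
    by rewrite (uS i iS) cabs0 cabs_ge0.
  suff -> : z i 0 = u i 0 by [].
  rewrite projmxE inE iS /= mulmxBr.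
  have h : (M *m e - M *m u) i 0 = 0.
    have e1 : (P *m (M *m e - M *m u)) i 0 = (M *m e - M *m u) i 0 by rewrite projmxE iS.
    rewrite -e1 mulmxBr -(padded_gram_supp uS).
    by rewrite coef_vec_eq subrr mxE.
  rewrite mxE h add0r mxE [(e - u) i 0]mxE [e i 0]mxE [(- u) i 0]mxE.
  have -> : (i == j) = false by apply/negP => /eqP ij; rewrite -ij iS in jS.
  by rewrite sub0r opprK.
have h : l2norm z ^+ 2 <= dl ^+ 2 * (1 + l2norm u ^+ 2).
  rewrite -w2 -exprMn; apply: lerXn2r => //; rewrite nnegrE ?l2norm_ge0 //.
  by rewrite mulr_ge0 ?l2norm_ge0.
exact: le_mulB1 z2 h.
Qed.

(* The Cramer form of coef_vec, polynomial in the entries of M. *)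
Definition cramer_vec (j : 'I_n) : 'cV[C]_n := \adj G *m (P *m (M *m delta_mx j 0)).

Lemma cramer_vecE j : cramer_vec j = \det G *: coef_vec j.
Proof.
rewrite /cramer_vec /coef_vec /invmx padded_gram_unit -scalemxAl scalerA mulrV ?scale1r //.
by rewrite -unitmxE padded_gram_unit.
Qed.

Lemma cramer_vec_norm j : j \notin S ->
  l2norm (cramer_vec j) ^+ 2 * (1 - dl ^+ 2) <= dl ^+ 2 * cabs (\det G) ^+ 2.
Proof.
move=> jS; rewrite cramer_vecE l2normZ exprMn -mulrA mulrC.
by apply: ler_wpM2r; [exact: sqr_ge0|exact: coef_vec_norm].
Qed.

Lemma det_padded_gram_gt0 : 0 < cabs (\det G).
Proof.
rewrite lt_neqAle cabs_ge0 andbT eq_sym; apply/negP => /eqP /cabs_eq0 h.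
by have := padded_gram_unit; rewrite unitmxE h unitr0.
Qed.

Variable sg : 'cV[C]_n.
Hypothesis sgS : forall i, i \notin S -> sg i 0 = 0.
Hypothesis sg1 : forall i, cabs (sg i 0) <= 1.

(** M times this vector is the dual certificate: it equals [sg] on S, and for M = adj(A) A it lies
    in the range of adj(A). *)
Definition dual_vec : 'cV[C]_n := invmx G *m sg.

Lemma dual_vec_eq : G *m dual_vec = sg.
Proof. exact: (mulKVmx padded_gram_unit). Qed.

Lemma dual_vec_supp i : i \notin S -> dual_vec i 0 = 0.
Proof. by move=> iS; rewrite -(padded_gram_off _ iS) dual_vec_eq sgS. Qed.

Lemma dual_on i : i \in S -> (M *m dual_vec) i 0 = sg i 0.
Proof.
move=> iS; rewrite -[in RHS]dual_vec_eq padded_gram_supp; last exact: dual_vec_supp.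
by rewrite projmxE iS.
Qed.

(** The inverse Gram matrix is self-adjoint and can be moved from [sg] to column j. The off-support
    value thereby becomes a linear form in the signs whose coefficients depend on M alone, which is
    what Khintchine's inequality needs. *)
Lemma dual_off j : (M *m dual_vec) j 0 = dot (coef_vec j) sg.
Proof.
rewrite -[in RHS]dual_vec_eq dot_adj padded_gram_herm coef_vec_eq.
rewrite -[in RHS](adj_projmx S) -dot_adj projmx_id; last exact: dual_vec_supp.
rewrite -{2}hM -dot_adj dotE (bigD1 j) //= big1 ?addr0 => [|i ij].
  by rewrite [delta_mx j 0 j 0]mxE !eqxx conjc1 mul1r.
by rewrite [delta_mx j 0 i 0]mxE (negbTE ij) conjc0 mul0r.
Qed.

Lemma sg_norm : l2norm sg ^+ 2 <= #|S|%:R.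
Proof.
rewrite l2norm_sq (bigID (mem S)) /= [X in _ + X]big1 ?addr0 => [|i iS]; last first.
  by rewrite sgS // cabs0 expr0n.
rewrite -sum1_card natr_sum; apply: ler_sum => i _.
by rewrite expr_le1 ?cabs_ge0.
Qed.

(** For M = adj(A) A the pairing is |A g|^2, which equals <g, sg>. The resulting bound s / (1 - dl)
    is the source of sqrt s in the noisy estimate. *)
Lemma dual_energy : (1 - dl) * complex.Re (dot dual_vec (M *m dual_vec)) <= #|S|%:R.
Proof.
set g := dual_vec; set q := complex.Re _.
have gS i : i \notin S -> g i 0 = 0 by exact: dual_vec_supp.
have h1 := local_isometry_dot isoS gS.
have h2 : q <= l2norm g * l2norm sg.
  rewrite /q -[X in dot X _](projmx_id gS) -adj_projmx -dot_adj -padded_gram_supp //.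
  by rewrite dual_vec_eq Re_dot_cs.
by move: h1; rewrite ler_norml => /andP[h1 _]; exact: (le_energy dl1 h2 h1 sg_norm).
Qed.

End FixedSupport.
End Certificate.

(** * Deterministic recovery from a dual certificate *)

Section Recovery.
Variable R : realType.
Local Notation C := (R[i]).

Definition sgvec n (x : 'cV[C]_n) : 'cV[C]_n := \col_i csign (x i 0).

Lemma conjcM (z w : C) : conjc (z * w) = conjc z * conjc w.
Proof. exact: rmorphM. Qed.

Lemma csign_mul (z : C) : conjc (csign z) * z = (cabs z)%:C%C.
Proof.
have [->|z0] := eqVneq z 0; first by rewrite mulr0 cabs0.
have c0 : (cabs z)%:C%C != 0.
  by apply: contra z0 => /eqP h; apply/eqP/cabs_eq0/complexI.
rewrite /csign conjcM conjc_inv conjc_real mulrAC conjc_mul_self expr2 [(_ * _)%:C%C]rmorphM.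
by rewrite -mulrA mulfV // mulr1.
Qed.

(** Only an inequality, because [csign 0] is 0 by the convention that 0 has inverse 0. *)
Lemma cabs_csign_le1 (z : C) : cabs (csign z) <= 1.
Proof.
have [->|z0] := eqVneq z 0; first by rewrite /csign mul0r cabs0.
have c0 : cabs z != 0 by apply: contra z0 => /eqP h; apply/eqP/cabs_eq0.
have e : csign z * (cabs z)%:C%C = z.
  rewrite /csign mulrVK // unitfE; apply: contra c0 => /eqP h; apply/eqP.
  exact: complexI.
have := congr1 (@cabs R) e; rewrite cabsM cabsR ger0_norm ?cabs_ge0 // => h.
by rewrite -(@ler_pM2r _ (cabs z)) ?mul1r ?h // lt_neqAle eq_sym c0 cabs_ge0.
Qed.

(** The subgradient inequality for the modulus at x. At x = 0 the subgradient [csign 0] is 0. *)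
Lemma cabs_tangent (x v : C) :
  cabs x + complex.Re (conjc (csign x) * v) <= cabs (x + v).
Proof.
have -> : cabs x = complex.Re (conjc (csign x) * x) by rewrite csign_mul.
rewrite -cReD -mulrDr; apply: (le_trans (Re_le_cabs _)).
by rewrite cabsM cabsJ ler_piMl ?cabs_ge0 // cabs_csign_le1.
Qed.

(** The subgradient inequality is summed over S only. Off S the vector x vanishes, so there the full
    modulus of z - x is kept. *)
Lemma l1norm_tangent n (S : {set 'I_n}) (x z : 'cV[C]_n) :
  (forall i, i \notin S -> x i 0 = 0) -> l1norm z <= l1norm x ->
  \sum_(j | j \notin S) cabs ((z - x) j 0) <= - complex.Re (dot (sgvec x) (z - x)).
Proof.
move=> xS; set v := z - x; have -> : z = x + v by rewrite addrC subrK.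
rewrite /l1norm dotE cRe_sum !(bigID (mem S) predT) /=.
have -> : \sum_(i | i \notin S) cabs ((x + v) i 0) = \sum_(i | i \notin S) cabs (v i 0).
  by apply: eq_bigr => i iS; rewrite mxE xS // add0r.
have -> : \sum_(i | i \notin S) cabs (x i 0) = 0.
  by apply: big1 => i iS; rewrite xS // cabs0.
have -> : \sum_(i | i \notin S) complex.Re (conjc (sgvec x i 0) * v i 0) = 0.
  by apply: big1 => i iS; rewrite mxE xS // /csign mul0r conjc0 mul0r.
have : \sum_(i in S) cabs (x i 0) + \sum_(i in S) complex.Re (conjc (sgvec x i 0) * v i 0)
    <= \sum_(i in S) cabs ((x + v) i 0).
  rewrite -big_split; apply: ler_sum => i _ /=.
  by rewrite [sgvec x i 0]mxE [(x + v) i 0]mxE; exact: cabs_tangent.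
by rewrite !addr0; lra.
Qed.

Lemma le_mul4 (t a s : R) : 0 <= a -> t <= 1 / 2 -> (1 - t) * a <= s -> a <= 2 ^+ 2 * s.
Proof.
move=> a0 t2 h; have := ler_wpM2r a0 t2; have := ler_wpM2r a0 t2; lra.
Qed.

Lemma le_half4 (t a b : R) : 0 <= a -> t <= 1 / 2 -> a - b <= t * a -> a <= 2 ^+ 2 * b.
Proof. by move=> a0 t2 h; have := ler_wpM2r a0 t2; lra. Qed.

Lemma le_half_absorb (v w u s e : R) : v <= u + w -> w <= 1 / 2 * v ->
  u <= (2 * s) * (2 * e) -> v <= 8 * s * e.
Proof. by move=> h1 h2 h3; lra. Qed.

Lemma le_of_norm_sub1 (a t : R) : a - 1 <= t -> t <= 1 / 2 -> a <= 2 ^+ 2.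
Proof. by move=> h1 h2; lra. Qed.

(** The origin of 4 and 40: w <= 4 e + 32 s e, and b adds 8 s e. *)
Lemma le_recovery_constants (v w a b s e : R) : v <= w + b -> w <= 2 * a ->
  a <= 2 * e + 2 * (8 * s * e) -> b <= 8 * s * e -> v <= (4 + 40 * s) * e.
Proof. by move=> h1 h2 h3 h4; lra. Qed.

Section Deterministic.
Variables (k n : nat) (A : 'M[C]_(k, n)) (S : {set 'I_n}) (x : 'cV[C]_n).
Variables (dl rho : R).
Local Notation M := (adjmx A *m A).
Hypothesis dl0 : 0 <= dl.
Hypothesis dl1 : dl < 1.
Hypothesis iso : forall j, j \notin S -> local_isometry M (S :|: [set j]) dl.
Hypothesis Sn : (#|S| < n)%N.
Hypothesis xS : forall i, i \notin S -> x i 0 = 0.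
Hypothesis cert : forall j, j \notin S ->
  cabs (dot (cramer_vec M S j) (sgvec x)) < rho * cabs (\det (padded_gram M S)).

Let hM : adjmx M = M. Proof. by rewrite adjmxM adjmxK. Qed.

Local Notation g := (dual_vec M S (sgvec x)).

Let sg1 i : cabs (sgvec x i 0) <= 1.
Proof. by rewrite mxE; exact: cabs_csign_le1. Qed.

Let sgS i : i \notin S -> sgvec x i 0 = 0.
Proof. by move=> iS; rewrite mxE xS // /csign mul0r. Qed.

Lemma dual_off_lt j : j \notin S -> cabs ((M *m g) j 0) < rho.
Proof.
move=> jS; rewrite (dual_off hM dl1 iso Sn sgS).
have d0 := det_padded_gram_gt0 hM dl1 iso Sn.
rewrite -(ltr_pM2r d0); apply: le_lt_trans (cert jS).
rewrite (cramer_vecE hM dl1 iso Sn) [dot (_ *: _) _]dotC dotZr conjcM -dotC cabsM cabsJ.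
by rewrite mulrC.
Qed.

(** As M g agrees with the signs of x on S, <sgn x, v> is <A g, A v> minus the pairing of M g with v
    off S; insert this in [l1norm_tangent]. *)
Lemma off_support_bound (z : 'cV[C]_n) : l1norm z <= l1norm x ->
  \sum_(j | j \notin S) cabs ((z - x) j 0) <=
    l2norm (A *m g) * l2norm (A *m (z - x)) +
    \sum_(j | j \notin S) cabs ((M *m g) j 0) * cabs ((z - x) j 0).
Proof.
move=> zx; apply: (le_trans (l1norm_tangent xS zx)).
set v := z - x.
have e : dot (A *m g) (A *m v) = dot (sgvec x) v +
    \sum_(j | j \notin S) conjc ((M *m g) j 0) * v j 0.
  rewrite dot_adj mulmxA !dotE (bigID (mem S)) /=; congr (_ + _).
  rewrite [in RHS](bigID (mem S)) /= [X in _ = _ + X]big1 ?addr0; last first.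
    by move=> i iS; rewrite sgS // conjc0 mul0r.
  by apply: eq_bigr => i iS; rewrite (dual_on hM dl1 iso Sn sgS iS).
have -> : dot (sgvec x) v = dot (A *m g) (A *m v) -
    \sum_(j | j \notin S) conjc ((M *m g) j 0) * v j 0 by rewrite e addrK.
rewrite -cReN opprB addrC; apply: (le_trans (Re_le_cabs _)).
apply: (le_trans (cabsD _ _)); rewrite cabsN; apply: lerD; first exact: dot_cs.
apply: (le_trans (cabs_sum _ _ _)); apply: ler_sum => j _.
by rewrite cabsM cabsJ.
Qed.

(** For A v = 0 the sum of (1 - |(M g)_j|) |v_j| off S is at most 0 while every factor 1 - |(M g)_j|
    is positive, so v lives on S, where the Gram matrix is injective. *)
Lemma BP_recovery : rho = 1 -> BP_unique_minimizer A (A *m x) x.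
Proof.
move=> rho1.
have uniq z : A *m z = A *m x -> l1norm z <= l1norm x -> z = x.
  move=> Az zx; have := off_support_bound zx.
  rewrite mulmxBr Az subrr l2norm0 mulr0 add0r => h.
  have zS j : j \notin S -> cabs ((z - x) j 0) = 0.
    have nn i : i \notin S -> 0 <= (1 - cabs ((M *m g) i 0)) * cabs ((z - x) i 0).
      by move=> iS; rewrite mulr_ge0 ?cabs_ge0 // subr_ge0 ltW // -rho1 dual_off_lt.
    have h0 : \sum_(j | j \notin S) (1 - cabs ((M *m g) j 0)) * cabs ((z - x) j 0) = 0.
      apply/eqP; rewrite eq_le (sumr_ge0 _ nn) andbT.
      under eq_bigr => i _ do rewrite mulrBl mul1r.
      by rewrite sumrB subr_le0.
    move=> jS; have /eqP := psumr_eq0P nn h0 jS.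
    rewrite mulf_eq0 => /orP[|/eqP//]; rewrite subr_eq0 => /eqP e1.
    by have := dual_off_lt jS; rewrite -e1 rho1 ltxx.
  have vS j : j \notin S -> (z - x) j 0 = 0 by move=> jS; exact/cabs_eq0/zS.
  apply/eqP; rewrite -subr_eq0; apply/eqP.
  apply: (padded_gram_inj dl1 iso Sn).
  by rewrite (padded_gram_supp _ vS) -mulmxA mulmxBr Az subrr !mulmx0.
split; last by move=> w [Aw hw]; apply: uniq => //; exact: hw.
split=> // w Aw; rewrite leNgt; apply/negP => hw.
by have := uniq w Aw (ltW hw) => wx; rewrite wx ltxx in hw.
Qed.

Lemma qBP_stability (eta : R) (e : 'cV[C]_k) (z : 'cV[C]_n) : rho = 1 / 2 -> dl <= 1 / 2 ->
  l2norm e <= eta -> qBP_minimizer A (A *m x + e) eta z ->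
  l2norm (x - z) <= (4 + 40 * Num.sqrt (#|S|%:R)) * eta.
Proof.
move=> rho2 dl2 he [hz hmin].
have zx : l1norm z <= l1norm x by apply: hmin; rewrite addrC addKr.
have eta0 : 0 <= eta by apply: le_trans he; exact: l2norm_ge0.
set v : 'cV[C]_n := z - x.
have Av : l2norm (A *m v) <= 2 * eta.
  have -> : A *m v = e - (A *m x + e - A *m z) by rewrite mulmxBr opprB addrCA opprD [e + _]addrCA subrr addr0.
  apply: (le_trans (l2normD _ _)); rewrite l2normN.
  by rewrite mulr_natl mulr2n lerD.
have Ag : l2norm (A *m g) <= 2 * Num.sqrt (#|S|%:R).
  have := dual_energy hM dl1 iso Sn sgS sg1.
  rewrite -mulmxA dot_adj adjmxK -l2norm_sq_dot => h.
  rewrite -(@ler_pXn2r _ 2) ?nnegrE ?l2norm_ge0 ?mulr_ge0 ?sqrtr_ge0 //.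
  rewrite exprMn (sqr_sqrtr (ler0n R #|S|)).
  by apply: (le_mul4 _ _ h); [exact: sqr_ge0|].
(* As |(M g)_j| < 1/2, half of the off-support mass is absorbed on the left; twice (2 sqrt s) (2
   eta) remains. *)
have V : \sum_(j | j \notin S) cabs (v j 0) <= 8 * Num.sqrt (#|S|%:R) * eta.
  apply: (le_half_absorb (off_support_bound zx)); last first.
    by apply: ler_pM; rewrite ?l2norm_ge0.
  rewrite mulr_sumr; apply: ler_sum => j jS; apply: ler_wpM2r; first exact: cabs_ge0.
  by rewrite -rho2 ltW // dual_off_lt.
rewrite -l2normN opprB -/v; clearbody v.
pose vS := projmx R S *m v.
have vSS i : i \notin S -> vS i 0 = 0 by move=> iS; rewrite projmxE (negbTE iS).
have ev : v = vS + \sum_(j | j \notin S) v j 0 *: delta_mx j 0.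
  apply/colP => i; rewrite [RHS]mxE projmxE summxE; case: ifP => iS.
    rewrite big1 ?addr0 // => j jS; rewrite mxE [delta_mx _ _ _ _]mxE.
    by case: eqP => [ij|_]; rewrite ?mulr0 // -ij iS in jS *.
  rewrite (bigD1 i) ?iS //= big1 => [|j /andP[_ ji]]; rewrite mxE [delta_mx _ _ _ _]mxE.
    by rewrite !eqxx mulr1 addr0 add0r.
  by rewrite eq_sym (negbTE ji) mulr0.
(* The upper half of the isometry on S + {j}, tested on the j-th unit vector. *)
have col_le j : j \notin S -> l2norm (A *m delta_mx j 0) <= 2.
  move=> jS; have dT i : i \notin S :|: [set j] -> (delta_mx j 0 : 'cV[C]_n) i 0 = 0.
    by rewrite !inE negb_or => /andP[_ /negbTE ij]; rewrite mxE ij.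
  have := local_isometry_dot (iso jS) dT.
  rewrite -mulmxA dot_adj adjmxK -l2norm_sq_dot l2norm_delta expr1n mulr1.
  move/ler_normlW => h; rewrite -(@ler_pXn2r _ 2) ?nnegrE ?l2norm_ge0 //.
  exact: le_of_norm_sub1 h dl2.
have AvS : l2norm (A *m vS) <= 2 * eta + 2 * (8 * Num.sqrt (#|S|%:R) * eta).
  have -> : A *m vS = A *m v - \sum_(j | j \notin S) v j 0 *: (A *m delta_mx j 0).
    rewrite {1}ev mulmxDr mulmx_sumr; under [X in _ + X - _]eq_bigr do rewrite -scalemxAr.
    by rewrite addrK.
  apply: (le_trans (l2normD _ _)); apply: lerD => //; rewrite l2normN.
  apply: (le_trans (l2norm_sum _ _ _)); apply: (@le_trans _ _ (2 * \sum_(j | j \notin S) cabs (v j 0))).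
    rewrite mulr_sumr; apply: ler_sum => j jS; rewrite l2normZ mulrC.
    by apply: ler_wpM2r; [exact: cabs_ge0|exact: col_le].
  exact: ler_wpM2l.
(* The lower half of the isometry on S; dl <= 1/2 enters here. *)
have vSn : l2norm vS <= 2 * l2norm (A *m vS).
  have := local_isometry_dot (isoS iso Sn) vSS.
  rewrite -mulmxA dot_adj adjmxK -l2norm_sq_dot distrC => /ler_normlW h.
  rewrite -(@ler_pXn2r _ 2) ?nnegrE ?l2norm_ge0 ?mulr_ge0 ?l2norm_ge0 //.
  rewrite exprMn; by apply: (le_half4 _ _ h); [exact: sqr_ge0|].
have nv : l2norm v <= l2norm vS + \sum_(j | j \notin S) cabs (v j 0).
  rewrite {1}ev; apply: (le_trans (l2normD _ _)); rewrite lerD2l.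
  apply: (le_trans (l2norm_sum _ _ _)); apply: ler_sum => j _.
  by rewrite l2normZ l2norm_delta mulr1.
exact: le_recovery_constants nv vSn AvS V.
Qed.
End Deterministic.
End Recovery.

(** * Independence of sigma-algebras *)

Section Independence.
Context {d : measure_display} {T : measurableType d} {R : realType}.
Variable P : probability T R.
Local Open Scope ereal_scope.

Definition pi_system (G : set (set T)) : Prop :=
  [/\ G `<=` measurable, setI_closed G & G setT].

Lemma pi_system_sigma G A : pi_system G -> <<s G >> A -> measurable A.
Proof. by move=> [Gm _ _]; apply: smallest_sub => //; exact: sigma_algebra_measurable. Qed.

(** The finite measures sending A to P (A [&] B) and to P A * P B agree on a pi-system that contains
    the whole space. *)
Lemma indep_sigma1 (G : set (set T)) (B : set T) : pi_system G -> measurable B ->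
  (forall A, G A -> P (A `&` B) = P A * P B) ->
  forall A, <<s G >> A -> P (A `&` B) = P A * P B.
Proof.
move=> [Gm GI GT] mB H.
pose k : {nonneg R} := NngNum (fine_ge0 (measure_ge0 P B)).
have kE A : mscale k P A = P A * P B.
  by rewrite /mscale /= fineK ?fin_num_measure // muleC.
move=> A sA; rewrite -kE.
apply: (g_sigma_algebra_measure_unique G Gm (fun=> setT) (fun=> GT) _
  (mrestr P mB) (mscale k P) GI) => //.
- by rewrite bigcup_const //; exists 0%N.
- by move=> E GE; apply: etrans (H E GE) _; rewrite -kE.
- by move=> _; apply: le_lt_trans (probability_le1 P (measurableI _ _ measurableT mB)) (ltry 1).
Qed.

Lemma indep_sigma (G1 G2 : set (set T)) : pi_system G1 -> pi_system G2 ->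
  (forall A B, G1 A -> G2 B -> P (A `&` B) = P A * P B) ->
  forall A B, <<s G1 >> A -> <<s G2 >> B -> P (A `&` B) = P A * P B.
Proof.
move=> p1 p2 H A B sA sB.
have mA := pi_system_sigma p1 sA.
rewrite setIC muleC; apply: (indep_sigma1 p2 mA) => // B' GB'.
rewrite setIC muleC; apply: (indep_sigma1 p1) => //; last by move=> A' GA'; exact: H.
by case: p2 => + _ _; apply.
Qed.

Section Product.
Variables (G1 G2 : set (set T)).
Hypotheses (p1 : pi_system G1) (p2 : pi_system G2).
Hypothesis indep : forall A B, G1 A -> G2 B -> P (A `&` B) = P A * P B.

Local Notation T1 := (g_sigma_algebraType G1).
Local Notation T2 := (g_sigma_algebraType G2).

Let m1 : measurable_fun setT (fun w : T => w : T1).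
Proof. by move=> _ Y mY; rewrite setTI; exact: pi_system_sigma p1 mY. Qed.
Let m2 : measurable_fun setT (fun w : T => w : T2).
Proof. by move=> _ Y mY; rewrite setTI; exact: pi_system_sigma p2 mY. Qed.
Let m12 : measurable_fun setT (fun w : T => ((w : T1), (w : T2))).
Proof. exact: measurable_fun_pair. Qed.

Let X1 : {mfun T >-> T1} := HB.pack (fun w : T => w : T1) (isMeasurableFun.Build _ _ _ _ _ m1).
Let X2 : {mfun T >-> T2} := HB.pack (fun w : T => w : T2) (isMeasurableFun.Build _ _ _ _ _ m2).
Let X12 : {mfun T >-> (T1 * T2)%type} :=
  HB.pack (fun w : T => ((w : T1), (w : T2))) (isMeasurableFun.Build _ _ _ _ _ m12).

Let P1 := distribution P X1.
Let P2 := distribution P X2.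
Let P12 := distribution P X12.

(** [P12] is the law of w -> (w, w), each coordinate seen through its own sigma-algebra.
    Independence says exactly that this law is the product measure, which makes Fubini available. *)
Lemma diag_law (A : set (T1 * T2)) : measurable A -> (P1 \x P2) A = P12 A.
Proof.
apply: product_measure_unique => A1 A2 mA1 mA2.
rewrite /P12 /distribution /pushforward /=.
exact: (indep_sigma p1 p2 indep).
Qed.

(** Conditioning by Fubini with w1 frozen. In the application w1 carries the matrix A and w2 the
    signs. *)
Lemma indep_prob_le (A : set (T1 * T2)) (t : R) : measurable A ->
  (forall w1, P [set w2 | A (w1, w2)] <= t%:E) -> P [set w | A (w, w)] <= t%:E.
Proof.
move=> mA h; have -> : P [set w | A (w, w)] = P12 A by [].
rewrite -diag_law // /product_measure1.
apply: (@le_trans _ _ (\int[P1]_x cst t%:E x)).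
  apply: ge0_le_integral => //.
    exact: measurable_fun_xsection.
  by move=> w1 _; apply: le_trans (h w1); rewrite /= xsectionE.
rewrite integral_cst // [X in _ * X](_ : _ = 1); last exact: (probability_setT P).
by rewrite mule1.
Qed.

(** Here w2 is frozen: it carries all summands but one, and w1 carries the remaining summand. *)
Lemma indep_integral_ge0 (f : T -> T -> R) :
  measurable_fun [set: T1 * T2] (fun x => f x.1 x.2) ->
  P.-integrable setT (fun w => (f w w)%:E) ->
  (forall w2, 0 <= \int[P]_w1 (f w1 w2)%:E) ->
  0 <= \int[P]_w (f w w)%:E.
Proof.
move=> mf If h.
have mF : measurable_fun [set: T1 * T2] (fun x => (f x.1 x.2)%:E) by exact/measurable_EFinP.
have e1 : \int[P]_w (f w w)%:E = \int[P12]_x (f x.1 x.2)%:E.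
  by rewrite integral_pushforward.
have IF : (P1 \x P2).-integrable setT (fun x => (f x.1 x.2)%:E).
  apply/integrableP; split=> //.
  rewrite (eq_measure_integral P12); last by move=> A mA _; exact: diag_law.
  have /integrableP[_] : P12.-integrable setT (fun x => (f x.1 x.2)%:E) by exact: integrable_pushforward.
  by [].
rewrite e1 (eq_measure_integral (P1 \x P2)); last first.
  by move=> A mA _; apply/esym; exact: diag_law.
rewrite -integral21_prod_meas1 //; apply: integral_ge0 => w2 _.
rewrite /fubini_G /=; have -> : \int[P1]_x (f x w2)%:E = \int[P]_x (f x w2)%:E.
  have mf2 : measurable_fun [set: T1] (fun x => (f x w2)%:E).
    exact: (measurable_fun_pair1 w2 mF).
  rewrite [LHS]integralE [RHS]integralE; congr (_ - _).
    apply: etrans (ge0_integral_pushforward m1 P measurableT _ _) _ => //.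
    exact: measurable_funepos.
  apply: etrans (ge0_integral_pushforward m1 P measurableT _ _) _ => //.
  exact: measurable_funeneg.
exact: h.
Qed.

End Product.
End Independence.

(** * Expectations of essentially bounded functions *)

Section FunctionAlgebra.
Variables (T : Type) (R : realType) (Q : (T -> R) -> Prop).
Local Notation C := (R[i]).

(** Abstract in [Q], so that closure under matrix polynomials is proved once for measurability, for
    measurability with respect to a sub-sigma-algebra, and for essential boundedness. *)
Definition fun_algebra : Prop :=
  [/\ forall c, Q (fun=> c), forall f g, Q f -> Q g -> Q (fun w => f w + g w) &
      forall f g, Q f -> Q g -> Q (fun w => f w * g w)].

Definition cfunQ (f : T -> C) : Prop := forall b, Q (fun w => reim b (f w)).
Definition mxfunQ a b (M : T -> 'M[C]_(a, b)) : Prop :=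
  forall i j, cfunQ (fun w => M w i j).

Hypothesis HQ : fun_algebra.
Let Qc c : Q (fun=> c). Proof. by case: HQ. Qed.
Let QD f g : Q f -> Q g -> Q (fun w => f w + g w). Proof. by case: HQ => _ + _; apply. Qed.
Let QM f g : Q f -> Q g -> Q (fun w => f w * g w). Proof. by case: HQ => _ _; apply. Qed.

Lemma funQ_eq (f g : T -> R) : f =1 g -> Q f -> Q g.
Proof. by move=> /funext ->. Qed.

Lemma funQ_mul_cst c f : Q f -> Q (fun w => c * f w).
Proof. by move=> hf; exact: QM (Qc c) hf. Qed.

Lemma funQ_opp f : Q f -> Q (fun w => - f w).
Proof. by move=> hf; apply: (funQ_eq _ (QM (Qc (-1)) hf)) => w; rewrite mulN1r. Qed.

Lemma funQ_sub f g : Q f -> Q g -> Q (fun w => f w - g w).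
Proof. by move=> hf hg; exact: QD hf (funQ_opp hg). Qed.

Lemma funQ_sum (I : Type) (r : seq I) (p : pred I) (F : I -> T -> R) :
  (forall i, p i -> Q (F i)) -> Q (fun w => \sum_(i <- r | p i) F i w).
Proof.
move=> h; elim: r => [|i r IH].
  by apply: (funQ_eq _ (Qc 0)) => w; rewrite big_nil.
case pi : (p i); last by apply: (funQ_eq _ IH) => w; rewrite big_cons pi.
by apply: (funQ_eq _ (QD (h i pi) IH)) => w; rewrite big_cons pi.
Qed.

Lemma funQ_exp f k : Q f -> Q (fun w => f w ^+ k).
Proof.
move=> hf; elim: k => [|k IH]; first by apply: (funQ_eq _ (Qc 1)) => w; rewrite expr0.
by apply: (funQ_eq _ (QM hf IH)) => w; rewrite exprS.
Qed.

Lemma cfunQ_cst (z : C) : cfunQ (fun=> z).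
Proof. by move=> b; exact: Qc. Qed.

Lemma cfunQ_add f g : cfunQ f -> cfunQ g -> cfunQ (fun w => f w + g w).
Proof.
move=> hf hg b; apply: (funQ_eq _ (QD (hf b) (hg b))) => w.
by case: b; rewrite /reim ?cReD ?cImD.
Qed.

Lemma cfunQ_mul f g : cfunQ f -> cfunQ g -> cfunQ (fun w => f w * g w).
Proof.
move=> hf hg [].
  apply: (funQ_eq _ (funQ_sub (QM (hf true) (hg true)) (QM (hf false) (hg false)))) => w.
  by rewrite /reim cReM.
apply: (funQ_eq _ (QD (QM (hf true) (hg false)) (QM (hf false) (hg true)))) => w.
by rewrite /reim cImM.
Qed.

Lemma cfunQ_conj f : cfunQ f -> cfunQ (fun w => conjc (f w)).
Proof.
move=> hf [].
  by apply: (funQ_eq _ (hf true)) => w /=; case: (f w).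
by apply: (funQ_eq _ (funQ_opp (hf false))) => w /=; case: (f w).
Qed.

Lemma cfunQ_sum (I : Type) (r : seq I) (p : pred I) (F : I -> T -> C) :
  (forall i, p i -> cfunQ (F i)) -> cfunQ (fun w => \sum_(i <- r | p i) F i w).
Proof.
move=> h b; apply: (funQ_eq _ (funQ_sum r (fun i pi => h i pi b))) => w.
by case: b; rewrite /reim ?cRe_sum ?cIm_sum.
Qed.

Lemma cfunQ_eq (f g : T -> C) : f =1 g -> cfunQ f -> cfunQ g.
Proof. by move=> /funext ->. Qed.

Lemma cfunQ_prod (I : Type) (r : seq I) (p : pred I) (F : I -> T -> C) :
  (forall i, p i -> cfunQ (F i)) -> cfunQ (fun w => \prod_(i <- r | p i) F i w).
Proof.
move=> h; elim: r => [|i r IH].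
  by apply: (cfunQ_eq _ (cfunQ_cst 1)) => w; rewrite big_nil.
case pi : (p i); last by apply: (cfunQ_eq _ IH) => w; rewrite big_cons pi.
by apply: (cfunQ_eq _ (cfunQ_mul (h i pi) IH)) => w; rewrite big_cons pi.
Qed.

Lemma funQ_cabs_sq f : cfunQ f -> Q (fun w => cabs (f w) ^+ 2).
Proof.
move=> hf; apply: (funQ_eq _ (QD (funQ_exp 2 (hf true)) (funQ_exp 2 (hf false)))) => w.
by rewrite cabs_sq.
Qed.

Lemma mxfunQ_eq a b (M N : T -> 'M[C]_(a, b)) : M =1 N -> mxfunQ M -> mxfunQ N.
Proof. by move=> /funext ->. Qed.

Lemma mxfunQ_cst a b (M : 'M[C]_(a, b)) : mxfunQ (fun=> M).
Proof. by move=> i j; exact: cfunQ_cst. Qed.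

Lemma mxfunQ_add a b (M N : T -> 'M[C]_(a, b)) :
  mxfunQ M -> mxfunQ N -> mxfunQ (fun w => M w + N w).
Proof.
move=> hM hN i j; apply: (cfunQ_eq _ (cfunQ_add (hM i j) (hN i j))) => w.
by rewrite mxE.
Qed.

Lemma mxfunQ_scale a b (f : T -> C) (M : T -> 'M[C]_(a, b)) :
  cfunQ f -> mxfunQ M -> mxfunQ (fun w => f w *: M w).
Proof.
move=> hf hM i j; apply: (cfunQ_eq _ (cfunQ_mul hf (hM i j))) => w.
by rewrite mxE.
Qed.

Lemma mxfunQ_opp a b (M : T -> 'M[C]_(a, b)) : mxfunQ M -> mxfunQ (fun w => - M w).
Proof.
move=> hM; apply: (mxfunQ_eq _ (mxfunQ_scale (cfunQ_cst (-1)) hM)) => w.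
by rewrite scaleN1r.
Qed.

Lemma mxfunQ_sub a b (M N : T -> 'M[C]_(a, b)) :
  mxfunQ M -> mxfunQ N -> mxfunQ (fun w => M w - N w).
Proof. by move=> hM hN; exact: mxfunQ_add hM (mxfunQ_opp hN). Qed.

Lemma mxfunQ_mul a b c (M : T -> 'M[C]_(a, b)) (N : T -> 'M[C]_(b, c)) :
  mxfunQ M -> mxfunQ N -> mxfunQ (fun w => M w *m N w).
Proof.
move=> hM hN i j.
have h k : xpredT k -> cfunQ (fun w => M w i k * N w k j) by move=> _; exact: cfunQ_mul.
by apply: (cfunQ_eq _ (cfunQ_sum _ h)) => w; rewrite mxE.
Qed.

Lemma mxfunQ_adj a b (M : T -> 'M[C]_(a, b)) : mxfunQ M -> mxfunQ (fun w => adjmx (M w)).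
Proof.
by move=> hM i j; apply: (cfunQ_eq _ (cfunQ_conj (hM j i))) => w; rewrite adjmxE.
Qed.

Lemma mxfunQ_sum a b (I : Type) (r : seq I) (p : pred I) (F : I -> T -> 'M[C]_(a, b)) :
  (forall i, p i -> mxfunQ (F i)) -> mxfunQ (fun w => \sum_(i <- r | p i) F i w).
Proof.
move=> h i j; apply: (cfunQ_eq _ (cfunQ_sum r (fun k pk => h k pk i j))) => w.
by rewrite summxE.
Qed.

Lemma mxfunQ_exp a (M : T -> 'M[C]_a) k : mxfunQ M -> mxfunQ (fun w => M w ^+ k).
Proof.
move=> hM; elim: k => [|k IH]; first exact: mxfunQ_cst.
by apply: (mxfunQ_eq _ (mxfunQ_mul hM IH)) => w; exact: mulmx_exprS.
Qed.

Lemma funQ_rtr a (M : T -> 'M[C]_a) : mxfunQ M -> Q (fun w => rtr (M w)).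
Proof. by move=> hM; exact: (cfunQ_sum _ (fun i _ => hM i i) true). Qed.

Lemma cfunQ_det a (M : T -> 'M[C]_a) : mxfunQ M -> cfunQ (fun w => \det (M w)).
Proof.
move=> hM; apply: cfunQ_sum => s _; apply: cfunQ_mul; first exact: cfunQ_cst.
by apply: cfunQ_prod => i _; exact: hM.
Qed.

Lemma mxfunQ_adjugate a (M : T -> 'M[C]_a) : mxfunQ M -> mxfunQ (fun w => \adj (M w)).
Proof.
move=> hM i j; apply: (cfunQ_eq (f := fun w => cofactor (M w) j i)).
  by move=> w; rewrite mxE.
apply: cfunQ_mul; first exact: cfunQ_cst.
apply: cfunQ_det => k l; apply: (cfunQ_eq _ (hM (lift j k) (lift i l))) => w.
by rewrite !mxE.
Qed.

End FunctionAlgebra.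

Section Expectation.
Context {d : measure_display} {T : measurableType d} {R : realType}.
Variable P : probability T R.
Local Notation C := (R[i]).

Lemma meas_fun_algebra : fun_algebra (fun f : T -> R => measurable_fun setT f).
Proof. split=> [c|f g|f g]; [exact: measurable_cst|exact: measurable_funD|exact: measurable_funM]. Qed.

(** Bounds hold only almost everywhere because [Lambda_bound] gives no more; products stay in the
    class, so all moments exist. *)
Definition ebd (f : T -> R) : Prop :=
  measurable_fun setT f /\ exists M : R, {ae P, forall w, `|f w| <= M}.

Lemma ebd_fun_algebra : fun_algebra ebd.
Proof.
split=> [c|f g [mf [M hM]] [mg [N hN]]|f g [mf [M hM]] [mg [N hN]]].
- by split; [exact: measurable_cst|exists `|c|; apply: aeW].
- split; first exact: measurable_funD.
  exists (M + N); apply: filterS2 hM hN => w h1 h2.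
  by apply: (le_trans (ler_normD _ _)); exact: lerD.
- split; first exact: measurable_funM.
  exists (M * N); apply: filterS2 hM hN => w h1 h2.
  by rewrite normrM ler_pM.
Qed.

Lemma ebd_integrable f : ebd f -> P.-integrable setT (EFin \o f).
Proof.
move=> [mf [M hM]]; apply/integrableP; split; first exact/measurable_EFinP.
apply: (@le_lt_trans _ _ ((`|M|)%:E * P setT)%E); last first.
  by rewrite probability_setT mule1 ltry.
apply: integral_le_bound => //; first exact/measurable_EFinP.
by apply: filterS hM => w h _; rewrite lee_fin (le_trans h) // ler_norm.
Qed.

Definition Ex (f : T -> R) : R := fine (\int[P]_w (f w)%:E).

Lemma Ex_cst (c : R) : Ex (fun=> c) = c.
Proof.
have e : fine (P setT) = 1 by rewrite probability_setT.
apply: etrans (Rintegral_cst P measurableT c) _.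
by apply: etrans (congr1 (fun t => c * t) e) _; rewrite mulr1.
Qed.

Lemma ExD f g : ebd f -> ebd g -> Ex (fun w => f w + g w) = Ex f + Ex g.
Proof. by move=> /ebd_integrable hf /ebd_integrable hg; exact: RintegralD. Qed.

Lemma ExZ c f : ebd f -> Ex (fun w => c * f w) = c * Ex f.
Proof. by move=> /ebd_integrable hf; exact: RintegralZl. Qed.

Lemma eq_Ex f g : f =1 g -> Ex f = Ex g.
Proof. by move=> /funext ->. Qed.

Lemma ExN f : ebd f -> Ex (fun w => - f w) = - Ex f.
Proof.
by move=> hf; rewrite -mulN1r -ExZ //; apply: eq_Ex => w; rewrite mulN1r.
Qed.

Lemma ExB f g : ebd f -> ebd g -> Ex (fun w => f w - g w) = Ex f - Ex g.
Proof.
move=> hf hg; rewrite -ExN // -ExD //; exact: funQ_opp ebd_fun_algebra _ hg.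
Qed.

Lemma Ex_sum (I : Type) (r : seq I) (p : pred I) (F : I -> T -> R) :
  (forall i, p i -> ebd (F i)) ->
  Ex (fun w => \sum_(i <- r | p i) F i w) = \sum_(i <- r | p i) Ex (F i).
Proof.
move=> h; elim: r => [|i r IH].
  by rewrite big_nil -[RHS]Ex_cst; apply: eq_Ex => w; rewrite big_nil.
rewrite big_cons; case: ifP => pi; last first.
  by rewrite -IH; apply: eq_Ex => w; rewrite big_cons pi.
rewrite -IH -ExD; [|exact: h|exact: funQ_sum ebd_fun_algebra _ _ _ _ h].
by apply: eq_Ex => w; rewrite big_cons pi.
Qed.

Lemma Ex_ge0 f : ebd f -> {ae P, forall w, 0 <= f w} -> 0 <= Ex f.
Proof.
move=> hf h; rewrite /Ex.
rewrite (ae_eq_integral (fun w => (Num.max (f w) 0)%:E)) //.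
- by apply: fine_ge0; apply: integral_ge0 => w _; rewrite lee_fin le_max lexx orbT.
- by have /integrableP[] := ebd_integrable hf.
- apply/measurable_EFinP; apply: measurable_maxr; first by case: hf.
  exact: measurable_cst.
- by apply: filterS h => w h0 _ /=; congr (_%:E); apply/esym/max_idPl.
Qed.

Lemma Ex_le f g : ebd f -> ebd g -> {ae P, forall w, f w <= g w} -> Ex f <= Ex g.
Proof.
move=> hf hg h; rewrite -subr_ge0 -ExB //.
apply: Ex_ge0; first exact: funQ_sub ebd_fun_algebra _ _ hg hf.
by apply: filterS h => w; rewrite subr_ge0.
Qed.

Lemma ebd_indic A : measurable A -> ebd (\1_A : T -> R).
Proof.
move=> mA; split; first exact: measurable_indic.
exists 1; apply: aeW => w; rewrite indicE; case: (w \in A); by rewrite ?normr1 ?normr0.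
Qed.

Lemma Ex_indic A : measurable A -> (Ex (\1_A : T -> R))%:E = P A.
Proof.
by move=> mA; rewrite /Ex integral_indic // setIT fineK // fin_num_measure.
Qed.

Lemma Ex_markov f (t : R) : ebd f -> {ae P, forall w, 0 <= f w} -> 0 < t ->
  (P [set w | (t <= f w)%R] <= (Ex f / t)%:E)%E.
Proof.
move=> hf f0 t0; set A := [set w | t <= f w].
have mA : measurable A.
  have -> : A = setT `&` f @^-1` [set x | t <= x] by rewrite classical_sets.setTI.
  case: hf => mf _; apply: mf => //.
  by rewrite (_ : [set x | t <= x] = `[t, +oo[%classic) // set_itvE.
rewrite -Ex_indic // lee_fin ler_pdivlMr // mulrC -ExZ; last exact: ebd_indic.
apply: Ex_le => //; first exact: (funQ_mul_cst ebd_fun_algebra) (ebd_indic mA).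
apply: filterS f0 => w fw; rewrite indicE.
case: (boolP (w \in A)); first by rewrite inE mulr1.
by rewrite mulr0.
Qed.

End Expectation.

(** * Exchangeable pairs and the matrix moment recursion *)

Section ExchangeAlgebra.
Variable R : realType.
Local Notation C := (R[i]).

Lemma alt_sum4 (x y z t x' y' z' t' : R) : x = x' -> y = y' -> z = z' -> t = t' ->
  x - y - z + t = x' - y' - z' + t'.
Proof. by move=> -> -> -> ->. Qed.

Lemma alt_sum4_rev (x y z t x' y' z' t' : R) : x = x' -> y = y' -> z = z' -> t = t' ->
  x - y - z + t = t' - z' - y' + x'.
Proof. by move=> -> -> -> ->; ring. Qed.

(** Each term is a function of w times a function of w', padded with the identity where necessary:
    the shape that [iterated_rtr] integrates. *)
Lemma rtr_exchange_lin n (h h' x x' : 'M[C]_n) : rtr ((h - h') *m (x - x')) =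
  rtr (h *m x *m 1%:M) - rtr (h *m x') - rtr (x *m h') + rtr (1%:M *m (h' *m x')).
Proof. by rewrite rtr_mulBB mulmx1 mul1mx [rtr (h' *m x)]rtrC. Qed.

Lemma rtr_exchange_quad n (h h' W W' : 'M[C]_n) :
  rtr ((h - h') *m (h - h') *m (W + W')) =
  (rtr (h *m h *m W *m 1%:M) - rtr (W *m h *m h') - rtr (h *m W *m h')
     + rtr (W *m (h' *m h'))) +
  (rtr (1%:M *m (h' *m h' *m W')) - rtr (h *m (W' *m h')) - rtr (h *m (h' *m W'))
     + rtr (h *m h *m W')).
Proof.
rewrite mulmxDr rtrD !rtr_sqB mulmx1 mul1mx.
have a1 : rtr (h *m h *m W) = rtr (h *m (h *m W)) by rewrite mulmxA.
have a2 : rtr (h *m (h' *m W)) = rtr (W *m h *m h') := rtr_rot _ _ _.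
have a3 : rtr (h' *m (h *m W)) = rtr (h *m W *m h') := rtrC _ _.
have a4 : rtr (h' *m (h' *m W)) = rtr (W *m (h' *m h')).
  by rewrite (rtr_rot h' h' W) mulmxA.
have a5 : rtr (h' *m h' *m W') = rtr (h' *m (h' *m W')) by rewrite mulmxA.
have a6 : rtr (h' *m (h *m W')) = rtr (h *m (W' *m h')).
  by rewrite (rtrC h') mulmxA.
have a7 : rtr (h *m h *m W') = rtr (h *m (h *m W')) by rewrite mulmxA.
apply: f_equal2.
  exact: (alt_sum4 (esym a1) a2 a3 a4).
exact: (alt_sum4_rev (esym a7) erefl a6 (esym a5)).
Qed.

Lemma le_etrans (a b c e f g : R) : a = b -> b = c -> c <= e -> e = f -> f = g -> a <= g.
Proof. by move=> -> -> h <- <-. Qed.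

Lemma le_double (a b q x y z t : R) :
  a - b - b + a <= q * (x - y - z + t + (x - y - z + t)) ->
  a - b <= q * (x - y - z + t).
Proof. by move=> h; lra. Qed.
End ExchangeAlgebra.

Section Moments.
Context {d : measure_display} {T : measurableType d} {R : realType}.
Variable P : probability T R.
Local Notation C := (R[i]).
Local Notation EX := (Ex P).
Local Notation ebd := (ebd P).
Local Notation mbd := (mxfunQ ebd).
Local Notation mE := (mexpect P).
Local Notation HQ := (ebd_fun_algebra P).

Lemma Re_mexpect a b (M : T -> 'M[C]_(a, b)) i j :
  complex.Re (mE M i j) = EX (fun w => complex.Re (M w i j)).
Proof. by rewrite mxE /= unlock. Qed.

Lemma Im_mexpect a b (M : T -> 'M[C]_(a, b)) i j :
  complex.Im (mE M i j) = EX (fun w => complex.Im (M w i j)).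
Proof. by rewrite mxE /= unlock. Qed.

Lemma mexpect_eqP a b (X : 'M[C]_(a, b)) (M : T -> 'M[C]_(a, b)) :
  (forall i j, complex.Re (X i j) = EX (fun w => complex.Re (M w i j))) ->
  (forall i j, complex.Im (X i j) = EX (fun w => complex.Im (M w i j))) -> X = mE M.
Proof.
move=> hr hi; apply/matrixP => i j; apply/eqP.
by rewrite eq_complex Re_mexpect Im_mexpect hr hi !eqxx.
Qed.

Lemma mexpect_cst a b (X : 'M[C]_(a, b)) : mE (fun=> X) = X.
Proof. by apply/esym/mexpect_eqP => i j; rewrite Ex_cst. Qed.

Lemma adj_mexpect a b (M : T -> 'M[C]_(a, b)) : mbd M ->
  adjmx (mE M) = mE (fun w => adjmx (M w)).
Proof.
have cRe (z : C) : complex.Re (conjc z) = complex.Re z by case: z.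
have cIm (z : C) : complex.Im (conjc z) = - complex.Im z by case: z.
move=> hM; apply/mexpect_eqP => i j; rewrite adjmxE.
  by rewrite cRe Re_mexpect; apply: eq_Ex => w; rewrite adjmxE cRe.
rewrite cIm Im_mexpect -ExN; last exact: hM j i false.
by apply: eq_Ex => w; rewrite adjmxE cIm.
Qed.

Lemma herm_mexpect n (M : T -> 'M[C]_n) : mbd M -> (forall w, adjmx (M w) = M w) ->
  adjmx (mE M) = mE M.
Proof.
by move=> hM h; rewrite adj_mexpect //; congr mexpect; apply/funext => w; exact: h.
Qed.

Lemma rtr_mulE a b (X : 'M[C]_(a, b)) (Y : 'M[C]_(b, a)) : rtr (X *m Y) =
  \sum_i \sum_j (complex.Re (X i j) * complex.Re (Y j i)
    - complex.Im (X i j) * complex.Im (Y j i)).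
Proof.
rewrite /rtr /mxtrace cRe_sum; apply: eq_bigr => i _.
by rewrite mxE cRe_sum; apply: eq_bigr => j _; rewrite cReM.
Qed.

Lemma Ex_rtr_mull a b (X : 'M[C]_(a, b)) (Y : T -> 'M[C]_(b, a)) : mbd Y ->
  EX (fun w => rtr (X *m Y w)) = rtr (X *m mE Y).
Proof.
move=> hY; rewrite rtr_mulE.
have e w : rtr (X *m Y w) = \sum_i \sum_j (complex.Re (X i j) * complex.Re (Y w j i)
    - complex.Im (X i j) * complex.Im (Y w j i)) by exact: rtr_mulE.
have hr i j : ebd (fun w => complex.Re (X i j) * complex.Re (Y w j i)).
  exact: (funQ_mul_cst HQ _ (hY j i true)).
have hi i j : ebd (fun w => complex.Im (X i j) * complex.Im (Y w j i)).
  exact: (funQ_mul_cst HQ _ (hY j i false)).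
have hs i j := funQ_sub HQ (hr i j) (hi i j).
rewrite (eq_Ex _ e) Ex_sum; last by move=> i _; apply: (funQ_sum HQ) => j _; exact: hs.
apply: eq_bigr => i _; rewrite Ex_sum; last by move=> j _; exact: hs.
apply: eq_bigr => j _; rewrite ExB // Re_mexpect Im_mexpect.
rewrite ExZ; last exact: hY j i true.
by rewrite ExZ //; exact: hY j i false.
Qed.

Lemma Ex_rtr_mulr a b (X : T -> 'M[C]_(a, b)) (Y : 'M[C]_(b, a)) : mbd X ->
  EX (fun w => rtr (X w *m Y)) = rtr (mE X *m Y).
Proof.
by move=> hX; rewrite rtrC -Ex_rtr_mull //; apply: eq_Ex => w; rewrite rtrC.
Qed.

Lemma Ex_rtr n (X : T -> 'M[C]_n) : mbd X -> EX (fun w => rtr (X w)) = rtr (mE X).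
Proof.
move=> hX; rewrite -[mE X]mul1mx -Ex_rtr_mull //.
by apply: eq_Ex => w; rewrite mul1mx.
Qed.

(** The independent copy is realised as a second integration over the same [P]. Integrability and
    the value travel together. *)
Definition iterated (F : T -> T -> R) (e : R) : Prop :=
  [/\ forall w, ebd (F w), ebd (fun w => EX (F w)) & EX (fun w => EX (F w)) = e].

Lemma iterated_rtr a b (X : T -> 'M[C]_(a, b)) (Y : T -> 'M[C]_(b, a)) :
  mbd X -> mbd Y -> iterated (fun w w' => rtr (X w *m Y w')) (rtr (mE X *m mE Y)).
Proof.
move=> hX hY.
have e w : EX (fun w' => rtr (X w *m Y w')) = rtr (X w *m mE Y) by exact: Ex_rtr_mull.
have hXY : mbd (fun w => X w *m mE Y) := mxfunQ_mul HQ hX (mxfunQ_cst HQ (mE Y)).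
split.
- by move=> w; exact: (funQ_rtr HQ (mxfunQ_mul HQ (mxfunQ_cst HQ (X w)) hY)).
- exact: (funQ_eq (fun w => esym (e w)) (funQ_rtr HQ hXY)).
- by rewrite (eq_Ex _ e) Ex_rtr_mulr.
Qed.

Lemma iteratedD F G e f : iterated F e -> iterated G f ->
  iterated (fun w w' => F w w' + G w w') (e + f).
Proof.
move=> [F1 F2 F3] [G1 G2 G3]; case: (HQ) => _ QD _.
have h w : EX (fun w' => F w w' + G w w') = EX (F w) + EX (G w) by rewrite ExD.
split; first by move=> w; exact: QD.
  exact: (funQ_eq (fun w => esym (h w)) (QD _ _ F2 G2)).
by rewrite (eq_Ex _ h) ExD // F3 G3.
Qed.

Lemma iteratedZ F e c : iterated F e -> iterated (fun w w' => c * F w w') (c * e).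
Proof.
move=> [F1 F2 F3].
have h w : EX (fun w' => c * F w w') = c * EX (F w) by rewrite ExZ.
split; first by move=> w; exact: (funQ_mul_cst HQ).
  exact: (funQ_eq (fun w => esym (h w)) (funQ_mul_cst HQ c F2)).
by rewrite (eq_Ex _ h) ExZ // F3.
Qed.

Lemma iteratedB F G e f : iterated F e -> iterated G f ->
  iterated (fun w w' => F w w' - G w w') (e - f).
Proof.
move=> hF hG; have := iteratedD hF (iteratedZ (-1) hG); rewrite mulN1r.
by congr iterated; apply/funext => w; apply/funext => w'; rewrite mulN1r.
Qed.

Lemma iterated_le F G e f : iterated F e -> iterated G f ->
  (forall w w', F w w' <= G w w') -> e <= f.
Proof.
move=> [F1 F2 <-] [G1 G2 <-] h; apply: Ex_le => //; apply: aeW => w.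
by apply: Ex_le => //; apply: aeW => w'; exact: h.
Qed.

(** The expansion of E' (h - H')^2, that is, twice the conditional variance in the exchange
    argument. *)
Definition variance_form n (H : T -> 'M[C]_n) (h : 'M[C]_n) : 'M[C]_n :=
  h *m h - h *m mE H - mE H *m h + mE (fun w => H w *m H w).

(** With A = v + H and q = 2k + 1, the left side is half of E E' tr ((H - H') (A^q - A'^q)).
    [mean_value_trace] bounds the integrand, and the powers of A and of A' contribute equally. The
    shift [v] stands for the other summands, held fixed. *)
Lemma exchangeable_ineq n (H : T -> 'M[C]_n) (v : 'M[C]_n) k :
  mbd H -> (forall w, adjmx (H w) = H w) -> adjmx v = v ->
  EX (fun w => rtr ((H w - mE H) *m (v + H w) ^+ k.*2.+1)) <=
  (k.*2.+1%:R / 2) * EX (fun w => rtr (variance_form H (H w) *m (v + H w) ^+ k.*2)).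
Proof.
move=> bH hH hv; set q := k.*2.+1; set N := k.*2.
pose A w := v + H w.
have bA : mbd A := mxfunQ_add HQ (mxfunQ_cst HQ v) bH.
have hA w : adjmx (A w) = A w by rewrite adjmxD hv hH.
pose I (w : T) : 'M[C]_n := 1%:M.
have bI : mbd I := mxfunQ_cst HQ 1%:M.
pose X w := A w ^+ q; pose W w := A w ^+ N.
have bX : mbd X := mxfunQ_exp HQ q bA.
have bW : mbd W := mxfunQ_exp HQ N bA.
have bM (F G : T -> 'M[C]_n) : mbd F -> mbd G -> mbd (fun w => F w *m G w).
  by move=> hF hG; exact: (mxfunQ_mul HQ hF hG).
have E1 : mE I = 1%:M := mexpect_cst 1%:M.
have L := iteratedD (iteratedB (iteratedB (iterated_rtr (bM _ _ bH bX) bI)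
  (iterated_rtr bH bX)) (iterated_rtr bX bH)) (iterated_rtr bI (bM _ _ bH bX)).
have bHH := bM _ _ bH bH.
have R1 := iteratedD (iteratedB (iteratedB (iterated_rtr (bM _ _ bHH bW) bI)
  (iterated_rtr (bM _ _ bW bH) bH)) (iterated_rtr (bM _ _ bH bW) bH))
  (iterated_rtr bW bHH).
have R2 := iteratedD (iteratedB (iteratedB (iterated_rtr bI (bM _ _ bHH bW))
  (iterated_rtr bH (bM _ _ bW bH))) (iterated_rtr bH (bM _ _ bH bW)))
  (iterated_rtr bHH bW).
have RR := iteratedZ (q%:R / 2) (iteratedD R1 R2).
have pw (w w' : T) := mean_value_trace k (hA w) (hA w').
have eA (w w' : T) : A w - A w' = H w - H w' by rewrite /A opprD addrACA subrr add0r.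
have := iterated_le L RR.
have cmp w w' := le_etrans (esym (rtr_exchange_lin (H w) (H w') (X w) (X w')))
  (congr1 (fun D => rtr (D *m (X w - X w'))) (esym (eA w w'))) (pw w w')
  (congr1 (fun D => q%:R / 2 * rtr (D *m D *m (W w + W w'))) (eA w w'))
  (congr1 (fun t => q%:R / 2 * t) (rtr_exchange_quad (H w) (H w') (W w) (W w'))).
move=> /(_ cmp).
rewrite E1 !mulmx1 !mul1mx => key.
have hX : EX (fun w => rtr ((H w - mE H) *m X w)) =
    rtr (mE (fun w => H w *m X w)) - rtr (mE H *m mE X).
  have b1 := funQ_rtr HQ (bM _ _ bH bX).
  have b2 := funQ_rtr HQ (mxfunQ_mul HQ (mxfunQ_cst HQ (mE H)) bX).
  have e1 := Ex_rtr (bM _ _ bH bX); have e2 := Ex_rtr_mull (mE H) bX.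
  apply: etrans (f_equal2 (fun s t => s - t) e1 e2); rewrite -(ExB b1 b2).
  by apply: eq_Ex => w; rewrite mulmxBl rtrB.
have hW : EX (fun w => rtr (variance_form H (H w) *m W w)) =
    rtr (mE (fun w => H w *m H w *m W w)) - rtr (mE (fun w => W w *m H w) *m mE H)
    - rtr (mE H *m mE (fun w => H w *m W w))
    + rtr (mE (fun w => H w *m H w) *m mE W).
  have b1 := funQ_rtr HQ (bM _ _ bHH bW).
  have b2 := funQ_rtr HQ (mxfunQ_mul HQ (bM _ _ bW bH) (mxfunQ_cst HQ (mE H))).
  have b3 := funQ_rtr HQ (mxfunQ_mul HQ (mxfunQ_cst HQ (mE H)) (bM _ _ bH bW)).
  have b4 := funQ_rtr HQ (mxfunQ_mul HQ (mxfunQ_cst HQ (mE (fun w => H w *m H w))) bW).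
  have b12 := funQ_sub HQ b1 b2; have b123 := funQ_sub HQ b12 b3.
  have e1 := Ex_rtr (bM _ _ bHH bW); have e2 := Ex_rtr_mulr (mE H) (bM _ _ bW bH).
  have e3 := Ex_rtr_mull (mE H) (bM _ _ bH bW).
  have e4 := Ex_rtr_mull (mE (fun w => H w *m H w)) bW.
  apply: etrans (alt_sum4 e1 e2 e3 e4).
  rewrite -(ExB b1 b2) -(ExB b12 b3) -(ExD b123 b4).
  apply: eq_Ex => w; rewrite /variance_form mulmxDl !mulmxBl rtrD !rtrB.
  apply: alt_sum4; [exact: erefl| |by rewrite mulmxA|exact: erefl].
  exact: (etrans (congr1 (@rtr R n) (esym (mulmxA _ _ _))) (rtr_rot _ _ _)).
rewrite hX hW; move: key.
(* Cyclicity identifies mirrored terms, so both sides become twice what is claimed. *)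
rewrite [rtr (mE X *m _)]rtrC [rtr (mE (fun w => H w *m W w) *m mE H)]rtrC.
rewrite [rtr (mE H *m mE (fun w => W w *m H w))]rtrC [rtr (mE W *m _)]rtrC.
exact: le_double.
Qed.

End Moments.

(** * Pi-systems generated by blocks of independent families *)

Section Rectangles.
Context {d : measure_display} {T : measurableType d} {R : realType}.
Variable P : probability T R.
Variables (K : finType) (J : K -> finType) (X : forall i, J i -> T -> R).

Definition rect (D : pred K) (E : forall i, J i -> set R) : set T :=
  \bigcap_(i in [set i | D i]) \bigcap_(j in [set: J i]) (X j @^-1` E i j).

Definition rect_system (D : pred K) : set (set T) :=
  [set A | exists2 E : forall i, J i -> set R,
     (forall i j, measurable (E i j)) & A = rect D E].

Hypothesis hX : forall i (j : J i), measurable_fun setT (X j).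

Lemma rect_pi_system D : pi_system (rect_system D).
Proof.
split.
- move=> _ [E mE ->]; apply: fin_bigcap_measurable; first exact: finite_finset.
  move=> i _; apply: fin_bigcap_measurable; first exact: finite_finset.
  by move=> j _; rewrite -[X in measurable X]classical_sets.setTI; exact: hX.
- move=> _ _ [E mE ->] [E' mE' ->]; exists (fun i j => E i j `&` E' i j).
    by move=> i j; exact: measurableI.
  apply/seteqP; split=> [w [h1 h2] i Di j _|w h]; first by split; [exact: h1|exact: h2].
  by split=> i Di j _; have [] := h i Di j I.
- exists (fun _ _ => setT) => //; apply/seteqP; split => // w _ i _ j _ //.
Qed.

Lemma rect_system_measurable (D : pred K) k (j : J k) : D k ->
  measurable_fun [set: g_sigma_algebraType (rect_system D)] (X j).
Proof.
move=> Dk _ E mE; rewrite classical_sets.setTI; apply: sub_sigma_algebra.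
(* The indices [l] and [j] live in different types, so they are compared as tagged pairs. *)
exists (fun i l => if Tagged J l == Tagged J j then E else setT).
  by move=> i l; case: ifP.
apply/seteqP; split=> [w Ew i _ l _|w /(_ k Dk j I)] /=; last by rewrite eqxx.
case: eqP => // e; suff -> : X l = X j by [].
exact: (congr1 (fun t : {i : K & J i} => X (tagged t)) e).
Qed.

Hypothesis ind : indep_families P X.

(** Both rectangles are extended by [setT] to all indices. In the product rule each index then
    carries a real constraint from at most one of them. *)
Lemma rect_indep (D1 D2 : pred K) : (forall i, D1 i -> ~~ D2 i) ->
  forall A B, rect_system D1 A -> rect_system D2 B -> (P (A `&` B) = P A * P B)%E.
Proof.
move=> D12 _ _ [E mE ->] [F mF ->].
pose ext (D : pred K) (E : forall i, J i -> set R) i (j : J i) : set R :=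
  if D i then E i j else setT.
have mext D E' : (forall i j, measurable (E' i j)) -> forall i j, measurable (ext D E' i j).
  by move=> h i j; rewrite /ext; case: ifP.
have eext D E' : rect D E' = rect predT (ext D E').
  apply/seteqP; split => w h i Di j _ /=; first by rewrite /ext; case: ifP => // Di'; exact: h.
  by have := h i erefl j I; rewrite /= /ext; have -> : D i by [].
have eD (D : pred K) (E' : forall i, J i -> set R) : (forall i j, measurable (E' i j)) ->
    P (rect predT E') = \big[*%E/1%E]_(i : K) P (\bigcap_(j in [set: J i]) (X j @^-1` E' i j)).
  move=> mE'; rewrite -ind //; congr (P _).
  by apply/seteqP; split => w h i _ j _; exact: h.
rewrite (eext D1 E) (eext D2 F).
have -> : rect predT (ext D1 E) `&` rect predT (ext D2 F) =
    rect predT (fun i j => ext D1 E i j `&` ext D2 F i j).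
  apply/seteqP; split=> [w [h1 h2] i Di j _|w h]; first by split; [exact: h1|exact: h2].
  by split=> i Di j _; have [] := h i Di j I.
rewrite !eD //; try by [exact: mext|move=> i j; apply: measurableI; exact: mext].
rewrite -big_split /=; apply: eq_bigr => i _.
have full (G : J i -> set R) : (forall j, G j = setT) ->
    P (\bigcap_(j in [set: J i]) (X j @^-1` G j)) = 1%E.
  move=> h; rewrite -(probability_setT P); congr (P _).
  by apply/seteqP; split => // w _ j _; rewrite /= h.
case D1i : (D1 i).
  rewrite [X in (_ * X)%E](full (ext D2 F i)) ?mule1.
    by congr (P _); apply: eq_bigcapr => j _; rewrite /ext (negbTE (D12 i D1i)) setIT.
  by move=> j; rewrite /ext (negbTE (D12 i D1i)).
rewrite [X in (X * _)%E](full (ext D1 E i)) ?mul1e.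
  by congr (P _); apply: eq_bigcapr => j _; rewrite /ext D1i setTI.
by move=> j; rewrite /ext D1i.
Qed.
End Rectangles.

(** * The moment inequality for sums of independent Hermitian matrices *)

Section MomentInequality.
Context {d : measure_display} {T : measurableType d} {R : realType}.
Variable P : probability T R.
Local Notation C := (R[i]).
Local Notation EX := (Ex P).
Local Notation ebd := (ebd P).
Local Notation mbd := (mxfunQ ebd).
Local Notation mE := (mexpect P).
Local Notation HQ := (ebd_fun_algebra P).

Definition gmeas (G : set (set T)) (f : T -> R) : Prop :=
  measurable_fun [set: g_sigma_algebraType G] (f : g_sigma_algebraType G -> R).

Lemma gmeas_fun_algebra G : fun_algebra (gmeas G).
Proof. exact: meas_fun_algebra. Qed.

(** Independence as the exchange argument consumes it: summand k on one pi-system, the others on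
    another. Both the blocks of A and the signs supply it. *)
Definition indep_split (K : finType) n (H : K -> T -> 'M[C]_n) (k : K) : Prop :=
  exists G1 G2 : set (set T), [/\ pi_system G1, pi_system G2,
    forall A B, G1 A -> G2 B -> (P (A `&` B) = P A * P B)%E,
    mxfunQ (gmeas G1) (H k) & forall l, l != k -> mxfunQ (gmeas G2) (H l)].

Variables (K : finType) (n : nat) (H : K -> T -> 'M[C]_n).
Hypothesis bH : forall k, mbd (H k).
Hypothesis hH : forall k w, adjmx (H k w) = H k w.
Hypothesis iH : forall k, indep_split H k.

Definition csum (w : T) : 'M[C]_n := \sum_k (H k w - mE (H k)).

Lemma csum_herm w : adjmx (csum w) = csum w.
Proof.
rewrite adjmx_sum; apply: eq_bigr => k _.
by rewrite adjmxB hH herm_mexpect.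
Qed.

Lemma csum_mbd : mbd csum.
Proof.
by apply: (mxfunQ_sum HQ) => k _; exact: (mxfunQ_sub HQ (bH k) (mxfunQ_cst HQ _)).
Qed.

Lemma variance_form_mxfunQ (T' : Type) (Q : (T' -> R) -> Prop) (F : T -> 'M[C]_n)
    (h : T' -> 'M[C]_n) : fun_algebra Q -> mxfunQ Q h ->
  mxfunQ Q (fun x => variance_form P F (h x)).
Proof.
move=> hQ hh; apply: (mxfunQ_add hQ); last exact: mxfunQ_cst.
apply: (mxfunQ_sub hQ); last exact: (mxfunQ_mul hQ (mxfunQ_cst hQ _) hh).
apply: (mxfunQ_sub hQ); first exact: (mxfunQ_mul hQ hh hh).
exact: (mxfunQ_mul hQ hh (mxfunQ_cst hQ _)).
Qed.

Lemma csum_term_le k (j : nat) :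
  EX (fun w => rtr ((H k w - mE (H k)) *m csum w ^+ j.*2.+1)) <=
  (j.*2.+1%:R / 2) * EX (fun w => rtr (variance_form P (H k) (H k w) *m csum w ^+ j.*2)).
Proof.
have [G1 [G2 [p1 p2 ind m1 m2]]] := iH k.
(* The mean of [H k] is put into [V], so that the centered sum is [V + H k] with [V] independent of
   [H k]. *)
pose V w := \sum_(l | l != k) (H l w - mE (H l)) - mE (H k).
have hV w : adjmx (V w) = V w.
  rewrite adjmxB adjmx_sum herm_mexpect //; congr (_ - _).
  by apply: eq_bigr => l _; rewrite adjmxB hH herm_mexpect.
have eZ w : csum w = V w + H k w.
  by rewrite /csum (bigD1 k) //= /V addrC -addrA [- _ + _]addrC.
pose vf := variance_form P (H k).
pose q : R := j.*2.+1%:R / 2.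
(* The two coordinates decouple [H k] from [V]. For fixed w2 the integral over w1 is nonnegative by
   [exchangeable_ineq], and independence carries this to the diagonal. *)
pose f w1 w2 : R := q * rtr (vf (H k w1) *m (V w2 + H k w1) ^+ j.*2) -
  rtr ((H k w1 - mE (H k)) *m (V w2 + H k w1) ^+ j.*2.+1).
have alg (T' : Type) (Q : (T' -> R) -> Prop) (h v : T' -> 'M[C]_n) : fun_algebra Q ->
    mxfunQ Q h -> mxfunQ Q v ->
    [/\ Q (fun x => rtr (vf (h x) *m (v x + h x) ^+ j.*2)),
     Q (fun x => rtr ((h x - mE (H k)) *m (v x + h x) ^+ j.*2.+1)) &
     Q (fun x => q * rtr (vf (h x) *m (v x + h x) ^+ j.*2)
      - rtr ((h x - mE (H k)) *m (v x + h x) ^+ j.*2.+1))].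
  move=> hQ hh hv; have hpow i := mxfunQ_exp hQ i (mxfunQ_add hQ hv hh).
  have h1 := funQ_rtr hQ (mxfunQ_mul hQ (variance_form_mxfunQ (H k) hQ hh) (hpow j.*2)).
  have h2 := funQ_rtr hQ
    (mxfunQ_mul hQ (mxfunQ_sub hQ hh (mxfunQ_cst hQ (mE (H k)))) (hpow j.*2.+1)).
  by split => //; exact: (funQ_sub hQ (funQ_mul_cst hQ q h1) h2).
have algV (T' : Type) (Q : (T' -> R) -> Prop) (F : K -> T' -> 'M[C]_n) : fun_algebra Q ->
    (forall l, l != k -> mxfunQ Q (F l)) ->
    mxfunQ Q (fun x => \sum_(l | l != k) (F l x - mE (H l)) - mE (H k)).
  move=> hQ hF; apply: (mxfunQ_sub hQ _ (mxfunQ_cst hQ _)).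
  apply: (mxfunQ_sum hQ) => l lk; exact: (mxfunQ_sub hQ (hF l lk) (mxfunQ_cst hQ _)).
have bV : mbd V := algV _ _ H HQ (fun l _ => bH l).
have [b1 b2 b3] := alg _ _ _ _ HQ (bH k) bV.
have int0 : (0 <= \int[P]_w (f w w)%:E)%E.
  apply: (indep_integral_ge0 p1 p2 ind).
  - have mQ := meas_fun_algebra (T := (g_sigma_algebraType G1 * g_sigma_algebraType G2)%type) (R := R).
    have mf1 : mxfunQ (fun g => measurable_fun setT g)
        (fun x : g_sigma_algebraType G1 * g_sigma_algebraType G2 => H k x.1).
      by move=> a b c; exact: (measurableT_comp (m1 a b c) measurable_fst).
    have mf2 : mxfunQ (fun g => measurable_fun setT g)
        (fun x : g_sigma_algebraType G1 * g_sigma_algebraType G2 => V x.2).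
      apply: (algV _ _ (fun l x => H l x.2) mQ) => l lk a b c.
      exact: (measurableT_comp (m2 l lk a b c) measurable_snd).
    by have [] := alg _ _ _ _ mQ mf1 mf2.
  - exact: ebd_integrable b3.
  - move=> w2; have [c1 c2 c3] := alg _ _ _ _ HQ (bH k) (mxfunQ_cst HQ (V w2)).
    have fin := integrable_fin_num measurableT (ebd_integrable c3).
    rewrite /f -[X in (_ <= X)%E]fineK // lee_fin -/(Ex P _).
    rewrite (ExB (funQ_mul_cst HQ q c1) c2) (ExZ _ c1) subr_ge0.
    exact: exchangeable_ineq.
rewrite -subr_ge0 -(eq_Ex P (f := fun w => rtr (vf (H k w) *m (V w + H k w) ^+ j.*2))); last first.
  by move=> w; rewrite eZ.
rewrite -[X in _ - X](eq_Ex P (f := fun w => rtr ((H k w - mE (H k)) *m (V w + H k w) ^+ j.*2.+1))); last first.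
  by move=> w; rewrite eZ.
rewrite -(ExZ _ b1) -(ExB (funQ_mul_cst HQ q b1) b2).
exact: fine_ge0.
Qed.

(** One factor of the power is split into its summands, and each is exchanged separately. *)
Lemma csum_moment_le (j : nat) :
  EX (fun w => rtr (csum w ^+ j.*2.+2)) <=
  (j.*2.+1%:R / 2) *
    EX (fun w => \sum_k rtr (variance_form P (H k) (H k w) *m csum w ^+ j.*2)).
Proof.
have bZ i := mxfunQ_exp HQ i csum_mbd.
have e w : rtr (csum w ^+ j.*2.+2) = \sum_k rtr ((H k w - mE (H k)) *m csum w ^+ j.*2.+1).
  rewrite -rtr_sum -mulmx_suml.
  exact: (congr1 (@rtr R n) (esym (mulmx_exprS (csum w) j.*2.+1))).
rewrite (eq_Ex _ e) !Ex_sum.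
- by rewrite mulr_sumr; apply: ler_sum => k _; exact: csum_term_le.
- by move=> k _; exact: (funQ_rtr HQ (mxfunQ_mul HQ (variance_form_mxfunQ (H k) HQ (bH k)) (bZ _))).
- by move=> k _; exact: (funQ_rtr HQ (mxfunQ_mul HQ (mxfunQ_sub HQ (bH k) (mxfunQ_cst HQ _)) (bZ _))).
Qed.

End MomentInequality.

(** The double factorial (2p-1)!!, the 2p-th moment of a standard Gaussian variable. *)
Definition odd_fact (p : nat) : nat := \prod_(j < p) j.*2.+1.

Lemma odd_factS p : odd_fact p.+1 = (odd_fact p * p.*2.+1)%N.
Proof. by rewrite /odd_fact big_ord_recr. Qed.

(** With t = c r the last hypothesis reads (1 - t) y <= (9/4) t x, and 1 - t >= 18/19 turns 9/4 into
    (9/4) (19/18) = 19/8. *)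
Lemma le_recursion (R : realType) (x y c r : R) : 0 <= x -> 0 <= y -> c * r <= 1 / 19 ->
  y <= c / 2 * (2 * r * (y + 9 / 4 * x)) -> y <= c * (19 / 8 * r) * x.
Proof.
move=> x0 y0 h1 h2; have e : c / 2 * (2 * r * (y + 9 / 4 * x)) = (c * r) * (y + 9 / 4 * x).
  by field.
rewrite e in h2; have -> : c * (19 / 8 * r) * x = (c * r) * (19 / 8 * x) by field.
move: (c * r) h1 h2 => t h1 h2.
have := ler_wpM2r y0 h1; lra.
Qed.

(** * Moments of sums of positive semidefinite matrices with total mean the identity *)

Section Chernoff.
Context {d : measure_display} {T : measurableType d} {R : realType}.
Variable P : probability T R.
Local Notation C := (R[i]).
Local Notation EX := (Ex P).
Local Notation mbd := (mxfunQ (ebd P)).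
Local Notation mE := (mexpect P).
Local Notation HQ := (ebd_fun_algebra P).

Lemma variance_form_rtr n (H : T -> 'M[C]_n) (h W : 'M[C]_n) : mbd H ->
  rtr (variance_form P H h *m W) = EX (fun w => rtr ((h - H w) *m (h - H w) *m W)).
Proof.
move=> bH.
have bHH := mxfunQ_mul HQ bH bH.
have e w : rtr ((h - H w) *m (h - H w) *m W) =
    rtr (h *m (h *m W)) - rtr (W *m h *m H w) - rtr (H w *m (h *m W))
    + rtr (H w *m H w *m W).
  apply: etrans (rtr_sqB _ _ _) _.
  apply: alt_sum4; [exact: erefl|exact: rtr_rot|exact: erefl|by rewrite mulmxA].
rewrite (eq_Ex _ e).
have b1 : ebd P (fun=> rtr (h *m (h *m W))) by case: (HQ) => + _ _; apply.
have b2 := funQ_rtr HQ (mxfunQ_mul HQ (mxfunQ_cst HQ (W *m h)) bH).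
have b3 := funQ_rtr HQ (mxfunQ_mul HQ bH (mxfunQ_cst HQ (h *m W))).
have b4 := funQ_rtr HQ (mxfunQ_mul HQ bHH (mxfunQ_cst HQ W)).
have b12 := funQ_sub HQ b1 b2; have b123 := funQ_sub HQ b12 b3.
rewrite (ExD b123 b4) (ExB b12 b3) (ExB b1 b2) Ex_cst.
rewrite (Ex_rtr_mull _ bH) (Ex_rtr_mulr _ bH) (Ex_rtr_mulr _ bHH).
rewrite /variance_form mulmxDl !mulmxBl rtrD !rtrB.
apply: alt_sum4; [by rewrite mulmxA| |by rewrite mulmxA|exact: erefl].
exact: (etrans (congr1 (@rtr R n) (esym (mulmxA _ _ _))) (rtr_rot _ _ _)).
Qed.

Variables (K : finType) (n : nat) (H : K -> T -> 'M[C]_n) (r : R).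
Hypothesis bH : forall k, mbd (H k).
Hypothesis iH : forall k, indep_split P H k.
Hypothesis hH : forall k w, adjmx (H k w) = H k w.
Hypothesis psdH : {ae P, forall w, forall k, psd_le (H k w) r}.
Hypothesis r0 : 0 <= r.
Hypothesis sumH : \sum_k mE (H k) = 1%:M.

Local Notation Z := (csum P H).
Let M p := EX (fun w => rtr (Z w ^+ p.*2)).

Let bZ i : mbd (fun w => Z w ^+ i).
Proof. exact: (mxfunQ_exp HQ i (csum_mbd bH)). Qed.

Let hZ w : adjmx (Z w) = Z w.
Proof. exact: csum_herm. Qed.

(** Summed over k, the bounds 2 r (H_k + E H_k) give 2 r ((Z + 1) + 1): the sum controls its own
    variance. *)
Lemma variance_form_le j w : (forall k, psd_le (H k w) r) ->
  \sum_k rtr (variance_form P (H k) (H k w) *m Z w ^+ j.*2) <=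
  2 * r * (rtr (Z w ^+ j.*2.+1) + 2 * rtr (Z w ^+ j.*2)).
Proof.
move=> hw; set W := Z w ^+ j.*2.
have step k : rtr (variance_form P (H k) (H k w) *m W) <=
    2 * r * rtr ((H k w + mE (H k)) *m W).
  rewrite variance_form_rtr //.
  have b1 := mxfunQ_sub HQ (mxfunQ_cst HQ (H k w)) (bH k).
  have b2 := funQ_rtr HQ (mxfunQ_mul HQ (mxfunQ_mul HQ b1 b1) (mxfunQ_cst HQ W)).
  have b3 := mxfunQ_mul HQ (mxfunQ_add HQ (mxfunQ_cst HQ (H k w)) (bH k)) (mxfunQ_cst HQ W).
  have b4 := mxfunQ_mul HQ (mxfunQ_cst HQ (H k w)) (mxfunQ_cst HQ W).
  have b5 := mxfunQ_mul HQ (bH k) (mxfunQ_cst HQ W).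
  have -> : rtr ((H k w + mE (H k)) *m W) = EX (fun w' => rtr ((H k w + H k w') *m W)).
    rewrite mulmxDl rtrD -(Ex_rtr_mulr W (bH k)) -[X in X + _ = _](Ex_cst P).
    rewrite -(ExD (funQ_rtr HQ b4) (funQ_rtr HQ b5)).
    by apply: eq_Ex => w'; rewrite mulmxDl rtrD.
  rewrite -(ExZ _ (funQ_rtr HQ b3)).
  apply: (Ex_le b2 (funQ_mul_cst HQ _ (funQ_rtr HQ b3))).
  by apply: filterS psdH => w' hw'; exact: (rtr_sqB_psd _ (hZ w)).
apply: le_trans (ler_sum _ (fun k _ => step k)) _.
rewrite -mulr_sumr ler_wpM2l ?mulr_ge0 //.
rewrite -rtr_sum -mulmx_suml big_split /= sumH.
have -> : \sum_k H k w = Z w + 1%:M.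
  by rewrite /csum sumrB sumH subrK.
rewrite -addrA mulmxDl rtrD.
have -> : rtr (Z w *m W) = rtr (Z w ^+ j.*2.+1).
  exact: (congr1 (@rtr R n) (mulmx_exprS (Z w) j.*2)).
by rewrite mulmxDl mul1mx rtrD lerD2l mulr_natl mulr2n.
Qed.

(** The trace of (Z - 1/2)^2 Z^(2j) is nonnegative. This trades the odd moment produced by the
    variance for even ones and makes 2 into 2 + 1/4 = 9/4. *)
Lemma rtr_odd_le j w :
  rtr (Z w ^+ j.*2.+1) <= rtr (Z w ^+ j.*2.+2) + 1 / 4 * rtr (Z w ^+ j.*2).
Proof.
set z := Z w; pose c : 'M[C]_n := (1 / 2 : R)%:C%C *: 1%:M.
have hc : adjmx (z - c) = z - c by rewrite adjmxB hZ adjmxZr adjmx1.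
have : 0 <= rtr ((z - c) *m (z - c) *m z ^+ j.*2).
  apply: rtr_psd_even; first exact: hZ.
  by move=> v; rewrite -mulmxA dot_adj hc -l2norm_sq_dot sqr_ge0.
rewrite rtr_sqB.
have cM (X : 'M[C]_n) : c *m X = (1 / 2 : R)%:C%C *: X by rewrite -scalemxAl mul1mx.
have Mc (X : 'M[C]_n) : X *m ((1 / 2 : R)%:C%C *: z ^+ j.*2) = (1 / 2 : R)%:C%C *: (X *m z ^+ j.*2).
  by rewrite -scalemxAr.
have e1 : rtr (z *m (z *m z ^+ j.*2)) = rtr (z ^+ j.*2.+2).
  apply: etrans (congr1 (fun X => rtr (z *m X)) (mulmx_exprS z j.*2)) _.
  exact: (congr1 (@rtr R n) (mulmx_exprS z j.*2.+1)).
have e0 : rtr (z *m z ^+ j.*2) = rtr (z ^+ j.*2.+1).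
  exact: (congr1 (@rtr R n) (mulmx_exprS z j.*2)).
have e2 : rtr (z *m (c *m z ^+ j.*2)) = 1 / 2 * rtr (z ^+ j.*2.+1).
  by rewrite cM Mc rtrZ e0.
have e3 : rtr (c *m (z *m z ^+ j.*2)) = 1 / 2 * rtr (z ^+ j.*2.+1).
  by rewrite cM rtrZ e0.
have e4 : rtr (c *m (c *m z ^+ j.*2)) = 1 / 2 * (1 / 2 * rtr (z ^+ j.*2)).
  by rewrite !cM !rtrZ.
rewrite e1 e2 e3 e4.
move: (rtr _) (rtr _) (rtr _) => x y t h; lra.
Qed.

Lemma M_ge0 p : 0 <= M p.
Proof.
apply: Ex_ge0; first exact: (funQ_rtr HQ (bZ _)).
apply: aeW => w; rewrite -[_ ^+ _]mul1mx; apply: rtr_psd_even => // v.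
by rewrite mul1mx -l2norm_sq_dot sqr_ge0.
Qed.

Lemma chernoff_step j : j.*2.+1%:R * r <= 1 / 19 ->
  M j.+1 <= (j.*2.+1%:R * (19 / 8 * r)) * M j.
Proof.
move=> hj; have h1 := csum_moment_le bH hH iH j.
have b i := funQ_rtr HQ (bZ i).
have h2 : EX (fun w => \sum_k rtr (variance_form P (H k) (H k w) *m Z w ^+ j.*2)) <=
    2 * r * (M j.+1 + 9 / 4 * M j).
  have bR := funQ_mul_cst HQ (2 * r)
    (let: And3 _ QD _ := HQ in QD _ _ (b j.+1.*2) (funQ_mul_cst HQ (9 / 4) (b j.*2))).
  rewrite -(ExZ _ (b j.*2)) -(ExD (b _) (funQ_mul_cst HQ (9 / 4) (b j.*2))).
  rewrite -ExZ; last by case: (HQ) => _ QD _; exact: QD (b _) (funQ_mul_cst HQ _ (b _)).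
  apply: (Ex_le _ bR).
    apply: (funQ_sum HQ) => k _.
    exact: (funQ_rtr HQ (mxfunQ_mul HQ (variance_form_mxfunQ P (H k) HQ (bH k)) (bZ _))).
  apply: filterS psdH => w hw; apply: le_trans (variance_form_le j hw) _.
  apply: ler_wpM2l; first by rewrite mulr_ge0.
  have := rtr_odd_le j w; rewrite doubleS.
  move: (rtr _) (rtr _) (rtr _) => x y t h; lra.
have h3 : M j.+1 <= j.*2.+1%:R / 2 * (2 * r * (M j.+1 + 9 / 4 * M j)).
  apply: le_trans h1 _; apply: ler_wpM2l h2.
  by rewrite divr_ge0.
exact: (le_recursion (M_ge0 j) (M_ge0 j.+1) hj h3).
Qed.

Lemma chernoff_moment p : p.*2%:R * r <= 1 / 19 ->
  M p <= (odd_fact p)%:R * (19 / 8 * r) ^+ p * n%:R.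
Proof.
elim: p => [|p IH] hp.
  rewrite /odd_fact big_ord0 expr0 !mul1r /M (@eq_Ex _ _ _ P _ (fun=> n%:R)) ?Ex_cst //.
  by move=> w; rewrite /rtr mxtrace1 /= (_ : (n%:R : C) = (n%:R : R)%:C%C) // rmorph_nat.
have hp' : p.*2.+1%:R * r <= 1 / 19.
  by apply: le_trans hp; rewrite ler_wpM2r // ler_nat doubleS.
apply: le_trans (chernoff_step hp') _.
have hM : M p <= (odd_fact p)%:R * (19 / 8 * r) ^+ p * n%:R.
  by apply: IH; apply: le_trans hp'; rewrite ler_wpM2r // ler_nat.
apply: le_trans (ler_wpM2l _ hM) _.
  by rewrite mulr_ge0 // mulr_ge0.
rewrite odd_factS natrM exprS.
set a := 19 / 8 * r; set b := a ^+ p; set c := (odd_fact p)%:R; set e := _%:R.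
by rewrite le_eqVlt; apply/orP; left; apply/eqP; ring.
Qed.
End Chernoff.

(** * A Khintchine inequality *)

Section Dilation.
Variable R : realType.
Local Notation C := (R[i]).

(** The Hermitian dilation of a complex scalar. Its square is |z|^2 times the identity, so its even
    trace moments are twice those of |z|. *)
Definition dil (z : C) : 'M[C]_2 := \matrix_(i, j)
  if (i == 0) && (j == 1) then z else if (i == 1) && (j == 0) then conjc z else 0.

Lemma mx2P (A B : 'M[C]_2) : A 0 0 = B 0 0 -> A 0 1 = B 0 1 -> A 1 0 = B 1 0 ->
  A 1 1 = B 1 1 -> A = B.
Proof.
move=> h00 h01 h10 h11; apply/matrixP => i j.
have o2 (k : 'I_2) : k = 0 \/ k = 1.
  by case: k => [[|[|//]] hk]; [left|right]; apply: val_inj.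
by case: (o2 i) => ->; case: (o2 j) => ->.
Qed.

Lemma dilD z w : dil (z + w) = dil z + dil w.
Proof. by apply: mx2P; rewrite !mxE /= ?addr0 ?rmorphD. Qed.

Lemma dil0 : dil 0 = 0.
Proof. by apply: mx2P; rewrite !mxE /= ?conjc0 ?conjcK ?oppr0. Qed.

Lemma dil_sum (I : Type) (r : seq I) (p : pred I) (F : I -> C) :
  dil (\sum_(i <- r | p i) F i) = \sum_(i <- r | p i) dil (F i).
Proof. exact: (big_morph _ dilD dil0). Qed.

Lemma adj_dil z : adjmx (dil z) = dil z.
Proof. by apply: mx2P; rewrite !mxE /= ?conjcK ?oppr0. Qed.

Lemma mulmx2E (A B : 'M[C]_2) i j : (A *m B) i j = A i 0 * B 0 j + A i 1 * B 1 j.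
Proof.
rewrite mxE big_ord_recl big_ord1; congr (_ + A i _ * B _ j); exact: val_inj.
Qed.

Lemma dil_sq z : dil z *m dil z = (cabs z ^+ 2)%:C%C *: 1%:M.
Proof.
have [e00 e01 e10 e11] : [/\ dil z 0 0 = 0, dil z 0 1 = z, dil z 1 0 = conjc z & dil z 1 1 = 0].
  by split; rewrite mxE.
have i00 : (1%:M : 'M[C]_2) 0 0 = 1 by rewrite mxE.
have i01 : (1%:M : 'M[C]_2) 0 1 = 0 by rewrite mxE.
have i10 : (1%:M : 'M[C]_2) 1 0 = 0 by rewrite mxE.
have i11 : (1%:M : 'M[C]_2) 1 1 = 1 by rewrite mxE.
apply: mx2P; rewrite mulmx2E ?e00 ?e01 ?e10 ?e11 [RHS]mxE ?i00 ?i01 ?i10 ?i11.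
- by rewrite mul0r add0r mulr1 mulrC conjc_mul_self.
- by rewrite mul0r !mulr0 addr0.
- by rewrite mul0r !mulr0 addr0.
- by rewrite mul0r addr0 mulr1 conjc_mul_self.
Qed.

Lemma dil_even z p : dil z ^+ p.*2 = ((cabs z ^+ 2) ^+ p)%:C%C *: 1%:M.
Proof.
elim: p => [|p IH]; first by rewrite expr0 scale1r.
have e : dil z ^+ p.+1.*2 = dil z *m dil z *m dil z ^+ p.*2.
  rewrite doubleS -(mulmx_exprS (dil z) p.*2.+1) -(mulmx_exprS (dil z) p.*2).
  by rewrite mulmxA.
rewrite e dil_sq IH -scalemxAl mul1mx scalerA -rmorphM.
by move: (cabs z ^+ 2) => t; rewrite exprS.
Qed.

Lemma rtr_scalar (t : R) : rtr (t%:C%C *: 1%:M : 'M[C]_2) = 2 * t.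
Proof. by rewrite rtrZ /rtr mxtrace1 /= mulrC. Qed.

Lemma dil_mxfunQ (T : Type) (Q : (T -> R) -> Prop) (f : T -> C) :
  fun_algebra Q -> cfunQ Q f -> mxfunQ Q (fun w => dil (f w)).
Proof.
move=> hQ hf i j; apply: (cfunQ_eq (f := fun w => if (i == 0) && (j == 1) then f w else
  if (i == 1) && (j == 0) then conjc (f w) else 0)) => [w|]; first by rewrite mxE.
case: (_ && _) => //; case: (_ && _); [exact: (cfunQ_conj hQ)|exact: (cfunQ_cst hQ)].
Qed.
End Dilation.

Section Khintchine.
Context {d : measure_display} {T : measurableType d} {R : realType}.
Variable P : probability T R.
Local Notation C := (R[i]).
Local Notation EX := (Ex P).
Local Notation mbd := (mxfunQ (ebd P)).
Local Notation mE := (mexpect P).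
Local Notation HQ := (ebd_fun_algebra P).

Variables (K : finType) (sig : K -> T -> C) (a : K -> C).
Hypothesis msig : forall k b, measurable_fun setT (fun w => reim b (sig k w)).
Hypothesis sig1 : forall k w, cabs (sig k w) <= 1.
Hypothesis sig0 : forall k b, EX (fun w => reim b (sig k w)) = 0.
Hypothesis isig : indep_families P (J := fun _ : K => bool) (fun k b w => reim b (sig k w)).

Lemma abs_reim_le (z : C) b : `|reim b z| <= cabs z.
Proof.
rewrite -sqrtr_sqr /cabs; apply: ler_wsqrtr.
by case: b; rewrite ?lerDl ?lerDr sqr_ge0.
Qed.

Lemma sig_ebd k : cfunQ (ebd P) (sig k).
Proof.
move=> b; split; first exact: msig.
by exists 1; apply: aeW => w; exact: le_trans (abs_reim_le _ _) (sig1 k w).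
Qed.

Let H k w : 'M[C]_2 := dil (a k * sig k w).
Let S w : C := \sum_k a k * sig k w.

Let bH k : mbd (H k).
Proof. exact: (dil_mxfunQ HQ (cfunQ_mul HQ (cfunQ_cst HQ (a k)) (sig_ebd k))). Qed.

Let mE0 k : mE (H k) = 0.
Proof.
(* Real and imaginary part of every entry of the dilation have this form. *)
have lin (x y : R) : EX (fun w => x * complex.Re (sig k w) + y * complex.Im (sig k w)) = 0.
  rewrite (ExD (funQ_mul_cst HQ x (sig_ebd k true)) (funQ_mul_cst HQ y (sig_ebd k false))).
  rewrite (ExZ x (sig_ebd k true)) (ExZ y (sig_ebd k false)).
  by rewrite (sig0 k true) (sig0 k false) !mulr0 addr0.
apply/esym; apply: mexpect_eqP => i j; rewrite mxE /=.
  rewrite -[LHS](lin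
    (if (i == 0) && (j == 1) then complex.Re (a k) else if (i == 1) && (j == 0) then complex.Re (a k) else 0)
    (if (i == 0) && (j == 1) then - complex.Im (a k) else if (i == 1) && (j == 0) then - complex.Im (a k) else 0)).
  apply: eq_Ex => w; rewrite mxE; case: ifP => _; first by rewrite cReM mulNr.
  case: ifP => _; last by rewrite /= !mul0r addr0.
  have -> (z : C) : complex.Re (conjc z) = complex.Re z by case: z.
  by rewrite cReM mulNr.
rewrite -[LHS](lin
  (if (i == 0) && (j == 1) then complex.Im (a k) else if (i == 1) && (j == 0) then - complex.Im (a k) else 0)
  (if (i == 0) && (j == 1) then complex.Re (a k) else if (i == 1) && (j == 0) then - complex.Re (a k) else 0)).
apply: eq_Ex => w; rewrite mxE; case: ifP => _; first by rewrite cImM addrC.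
case: ifP => _; last by rewrite /= !mul0r addr0.
have -> (z : C) : complex.Im (conjc z) = - complex.Im z by case: z.
by rewrite cImM opprD addrC !mulNr.
Qed.

Let iH k : indep_split P H k.
Proof.
pose X (k : K) (b : bool) w := reim b (sig k w).
have mX k' b : measurable_fun setT (X k' b) by exact: msig.
exists (rect_system (J := fun=> bool) X (pred1 k)), (rect_system (J := fun=> bool) X (predC1 k)).
split.
- exact: rect_pi_system.
- exact: rect_pi_system.
- by apply: rect_indep => // i /eqP ->; rewrite /= eqxx.
- apply: (dil_mxfunQ (gmeas_fun_algebra _)).
  apply: (cfunQ_mul (gmeas_fun_algebra _) (cfunQ_cst (gmeas_fun_algebra _) _)) => b.
  by apply: rect_system_measurable => /=.
- move=> l lk; apply: (dil_mxfunQ (gmeas_fun_algebra _)).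
  apply: (cfunQ_mul (gmeas_fun_algebra _) (cfunQ_cst (gmeas_fun_algebra _) _)) => b.
  by apply: rect_system_measurable => /=.
Qed.

Let ZE w : csum P H w = dil (S w).
Proof.
by rewrite /csum /S dil_sum; apply: eq_bigr => k _; rewrite mE0 subr0.
Qed.

Let A : R := \sum_k cabs (a k) ^+ 2.

Let hH k w : adjmx (H k w) = H k w. Proof. exact: adj_dil. Qed.

(** The even power of the sum is a scalar matrix and the mean vanishes, so the variance is |a_k|^2
    times the sum of |sig|^2 and its mean, at most 2 |a_k|^2. *)
Let vf_le k w j : rtr (variance_form P (H k) (H k w) *m csum P H w ^+ j.*2) <=
  2 * cabs (a k) ^+ 2 * rtr (csum P H w ^+ j.*2).
Proof.
set W := csum P H w ^+ j.*2.
have eW : W = ((cabs (S w) ^+ 2) ^+ j)%:C%C *: 1%:M by rewrite /W ZE dil_even.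
have sq w' : H k w' *m H k w' = (cabs (a k * sig k w') ^+ 2)%:C%C *: 1%:M by exact: dil_sq.
have e : rtr (variance_form P (H k) (H k w) *m W) =
    rtr (H k w *m H k w *m W) + rtr (mE (fun w' => H k w' *m H k w') *m W).
  by rewrite /variance_form mE0 mulmx0 mul0mx !subr0 mulmxDl rtrD.
have bHH := mxfunQ_mul HQ (bH k) (bH k).
have rW : rtr W = 2 * (cabs (S w) ^+ 2) ^+ j by rewrite eW rtr_scalar.
have rW0 : 0 <= rtr W by rewrite rW mulr_ge0 // exprn_ge0 // sqr_ge0.
have le1 w' : rtr (H k w' *m H k w' *m W) <= cabs (a k) ^+ 2 * rtr W.
  rewrite sq -scalemxAl mul1mx rtrZ; apply: ler_wpM2r => //.
  rewrite cabsM exprMn ler_piMr ?sqr_ge0 // expr_le1 ?cabs_ge0 //.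
rewrite e -(Ex_rtr_mulr _ bHH).
apply: le_trans (lerD (le1 w) (_ : _ <= cabs (a k) ^+ 2 * rtr W)) _.
  rewrite -[leRHS](Ex_cst P); apply: Ex_le.
  - exact: (funQ_rtr HQ (mxfunQ_mul HQ bHH (mxfunQ_cst HQ _))).
  - by case: (HQ) => + _ _; apply.
  - by apply: aeW.
by rewrite -mulrA mulr_natl mulr2n.
Qed.

(** The variance is now bounded by a constant, so each step of the recursion costs (2j+1) times the
    sum of |a_k|^2 and nothing is to be absorbed. Mean zero and modulus at most 1 suffice, which
    covers both kinds of signs. The factor 2 is the trace of the identity and cancels. *)
Lemma khintchine p :
  EX (fun w => (cabs (\sum_k a k * sig k w) ^+ 2) ^+ p) <=
  (odd_fact p)%:R * (\sum_k cabs (a k) ^+ 2) ^+ p.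
Proof.
pose M p := EX (fun w => rtr (csum P H w ^+ p.*2)).
have bZ i := funQ_rtr HQ (mxfunQ_exp HQ i (csum_mbd bH)).
have A0 : 0 <= A by apply: sumr_ge0 => k _; exact: sqr_ge0.
have eM q : M q = 2 * EX (fun w => (cabs (S w) ^+ 2) ^+ q).
  rewrite /M -ExZ.
    by apply: eq_Ex => w; rewrite ZE dil_even rtr_scalar.
  apply: (funQ_exp HQ); apply: (funQ_cabs_sq HQ); apply: (cfunQ_sum HQ) => k _.
  exact: (cfunQ_mul HQ (cfunQ_cst HQ (a k)) (sig_ebd k)).
have step j : M j.+1 <= j.*2.+1%:R * A * M j.
  apply: le_trans (csum_moment_le bH hH iH j) _.
  have -> : j.*2.+1%:R * A * M j = j.*2.+1%:R / 2 * (2 * A * M j) by field.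
  apply: ler_wpM2l; first by rewrite divr_ge0.
  rewrite -(ExZ _ (bZ _)); apply: Ex_le.
  - apply: (funQ_sum HQ) => k _.
    exact: (funQ_rtr HQ (mxfunQ_mul HQ (variance_form_mxfunQ P (H k) HQ (bH k))
      (mxfunQ_exp HQ _ (csum_mbd bH)))).
  - exact: (funQ_mul_cst HQ _ (bZ _)).
  - apply: aeW => w; rewrite -mulrA mulrCA /A mulr_suml.
    by apply: ler_sum => k _; apply: le_trans (vf_le k w j) _; rewrite [leRHS]mulrCA mulrA.
suff : M p <= 2 * ((odd_fact p)%:R * A ^+ p) by rewrite eM ler_pM2l.
elim: p => [|p IH].
  rewrite eM /odd_fact big_ord0 expr0 !mul1r (@eq_Ex _ _ _ P _ (fun=> 1)) ?Ex_cst //.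
apply: le_trans (step p) _; apply: le_trans (ler_wpM2l _ IH) _.
  by rewrite mulr_ge0.
rewrite odd_factS natrM exprS; set c := (odd_fact p)%:R; set e := _%:R.
by rewrite le_eqVlt; apply/orP; left; apply/eqP; ring.
Qed.
End Khintchine.

(** * Mean of a random sign *)

Section MeanZero.
Context {d : measure_display} {T : measurableType d} {R : realType}.
Variable P : probability T R.
Local Notation C := (R[i]).
Local Notation EX := (Ex P).
Local Notation ebd := (ebd P).
Local Notation HQ := (ebd_fun_algebra P).

Lemma Ex_eq_ae f g : ebd f -> ebd g -> {ae P, forall w, f w = g w} -> EX f = EX g.
Proof.
move=> hf hg h; apply/eqP; rewrite eq_le.
by apply/andP; split; apply: Ex_le => //; apply: filterS h => w ->.
Qed.

Lemma ae_of_prob1 A : measurable A -> P A = 1%E -> {ae P, forall w, A w}.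
Proof.
move=> mA PA; exists (~` A); split; [exact: measurableC| |by []].
by apply: etrans (probability_setC P mA) _; rewrite PA subee.
Qed.

Lemma measurable_ge (f : T -> R) (t : R) : measurable_fun setT f ->
  measurable [set w | t <= f w].
Proof.
move=> mf; have -> : [set w | t <= f w] = setT `&` f @^-1` `[t, +oo[%classic.
  by rewrite classical_sets.setTI; apply/seteqP; split=> w /=; rewrite in_itv /= andbT.
exact: mf.
Qed.

Lemma measurable_le (f : T -> R) (t : R) : measurable_fun setT f ->
  measurable [set w | f w <= t].
Proof.
move=> mf; have -> : [set w | f w <= t] = [set w | - t <= - f w].
  by apply/seteqP; split=> w /=; rewrite lerN2.
exact/measurable_ge/measurable_funN.
Qed.

Lemma measurable_eq (f : T -> R) (t : R) : measurable_fun setT f ->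
  measurable [set w | f w = t].
Proof.
move=> mf; have -> : [set w | f w = t] = [set w | t <= f w] `&` [set w | f w <= t].
  apply/seteqP; split=> w /=; first by move=> ->.
  by move=> [h1 h2]; apply/eqP; rewrite eq_le h1 h2.
by apply: measurableI; [exact: measurable_ge|exact: measurable_le].
Qed.

(** Half-lines form a pi-system generating the Borel sets, so equal tails force equal laws. *)
Lemma eq_tail_Ex f g : ebd f -> ebd g ->
  (forall t : R, P [set w | t <= f w] = P [set w | t <= g w]) -> EX f = EX g.
Proof.
move=> [mf bf] [mg bg] h.
pose X : {mfun T >-> R} := HB.pack f (isMeasurableFun.Build _ _ _ _ _ mf).
pose Y : {mfun T >-> R} := HB.pack g (isMeasurableFun.Build _ _ _ _ _ mg).
have eG : forall A : set R, measurable A -> distribution P X A = distribution P Y A.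
  move=> A mA.
  apply: (@g_sigma_algebra_measure_unique _ R _ (@RGenCInfty.G R) _
    (fun k => `[- k%:R, +oo[%classic) _ _ (distribution P X) (distribution P Y)).
  - by move=> _ [x ->]; exact: measurable_itv.
  - by move=> k; exists (- k%:R).
  - apply/seteqP; split=> // x _; exists (Num.bound `|x|) => //=.
    rewrite in_itv /= andbT lerNl; apply: le_trans (ler_norm _) _.
    by rewrite normrN ltW // archi_boundP.
  - move=> _ _ [x ->] [y ->]; exists (Num.max x y).
    apply/seteqP; split=> z /=; rewrite !in_itv /= !andbT ge_max.
      by move=> [-> ->].
    by move=> /andP[-> ->].
  - move=> _ [x ->].
    have e (k : T -> R) : k @^-1` `[x, +oo[%classic = [set w | x <= k w].
      by apply/seteqP; split=> w /=; rewrite in_itv /= andbT.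
    exact: (etrans (congr1 P (e f)) (etrans (h x) (congr1 P (esym (e g))))).
  - move=> k; apply: le_lt_trans (ltry 1); exact: probability_le1.
  - exact: (eq_ind _ (fun S : set (set R) => S A) mA _ (RGenCInfty.measurableE R)).
have If := ebd_integrable (conj mf bf); have Ig := ebd_integrable (conj mg bg).
rewrite /Ex; congr fine.
have mid : measurable_fun setT (fun x : R => x%:E) by exact/measurable_EFinP/measurable_id.
transitivity (\int[distribution P X]_x x%:E)%E; first by rewrite integral_pushforward.
transitivity (\int[distribution P Y]_x x%:E)%E; last by rewrite integral_pushforward.
by apply: eq_measure_integral => A mA _; exact: eG.
Qed.

(** Positive and negative part have the same tails; at thresholds t <= 0 both tail events are the
    whole space. *)
Lemma Ex_sym0 f : ebd f ->
  (forall t : R, 0 < t -> P [set w | t <= f w] = P [set w | t <= - f w]) -> EX f = 0.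
Proof.
move=> hf h.
have hmax g : ebd g -> ebd (fun w => Num.max (g w) 0).
  move=> [mg [M hM]]; split; first by apply: measurable_maxr => //; exact: measurable_cst.
  exists M; apply: filterS hM => w hw; apply: le_trans hw.
  rewrite maxEle; case: ifP => _; first by rewrite normr0.
  exact: lexx.
have hN := funQ_opp HQ hf.
have e w : f w = Num.max (f w) 0 - Num.max (- f w) 0.
  case: (leP 0 (f w)) => f0.
    by rewrite (max_idPr _) ?subr0 // oppr_le0.
  by rewrite (max_idPl _) ?sub0r ?opprK // oppr_ge0 ltW.
rewrite (eq_Ex P e) (ExB (hmax _ hf) (hmax _ hN)).
apply/eqP; rewrite subr_eq0; apply/eqP; apply: eq_tail_Ex; [exact: hmax|exact: hmax|].
move=> t; case: (leP t 0) => t0.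
  have full (g : T -> R) : [set w | t <= Num.max (g w) 0] = setT.
    by apply/seteqP; split=> // w _ /=; rewrite le_max t0 orbT.
  by rewrite !full.
have pos (g : T -> R) : [set w | t <= Num.max (g w) 0] = [set w | t <= g w].
  apply/seteqP; split=> w /=; rewrite le_max; last by move=> ->.
  by case/orP => //; rewrite leNgt t0.
by rewrite !pos; exact: h.
Qed.
End MeanZero.

(** * Angles on the unit circle and the Steinhaus case *)

Section Circle.
Variable R : realType.
Implicit Types t x : R.

Lemma cos_geP t x : 0 < t <= 1 -> `|x| <= pi -> (t <= cos x) = (`|x| <= acos t).
Proof.
move=> /andP[t0 t1] xp.
have tI : -1 <= t <= 1 by rewrite t1 andbT (le_trans _ (ltW t0)) // lerN10.
have c0 := acos_ge0 tI; have cp := acos_lepi tI.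
have ct : cos (acos t) = t by apply: acosK; rewrite in_itv.
have -> : cos x = cos `|x| by case: (ger0P x) => // _; rewrite cosN.
rewrite -{1}ct !leNgt ltr_cos // in_itv /= ?c0 ?cp ?normr_ge0 ?xp //.
Qed.

Lemma acos_le_pihalf t : 0 < t <= 1 -> 0 <= acos t <= pi / 2.
Proof.
move=> /andP[t0 t1].
have tI : -1 <= t <= 1 by rewrite t1 andbT (le_trans _ (ltW t0)) // lerN10.
rewrite acos_ge0 //=; have p0 := pi_ge0 R.
have hp : `|pi / 2 : R| <= pi by rewrite ger0_norm; lra.
have t01 : 0 < t <= 1 by rewrite t0.
have := cos_geP t01 hp; rewrite cos_pihalf leNgt t0 /= => h.
apply: ltW; rewrite ltNge; have := esym h; rewrite ger0_norm; last by lra.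
by move=> ->.
Qed.

Lemma unit_upper (a b : R) : a ^+ 2 + b ^+ 2 = 1 -> 0 <= b ->
  [/\ -1 <= a <= 1, cos (acos a) = a & sin (acos a) = b].
Proof.
move=> ab b0.
have a1 : -1 <= a <= 1.
  rewrite -ler_norml -(@ler_pXn2r _ 2) ?nnegrE // expr1n real_normK ?num_real //.
  by have := sqr_ge0 b; lra.
have ca : cos (acos a) = a by apply: acosK; rewrite in_itv.
split=> //; rewrite sin_acos //.
have -> : 1 - a ^+ 2 = b ^+ 2 by lra.
by rewrite sqrtr_sqr ger0_norm.
Qed.

Lemma unit_angle (a b : R) : a ^+ 2 + b ^+ 2 = 1 ->
  exists2 th : R, 0 <= th <= 2 * pi & a = cos th /\ b = sin th.
Proof.
move=> ab; have p0 := pi_ge0 R; case: (leP 0 b) => b0.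
  have [a1 ca sa] := unit_upper ab b0; exists (acos a); last by [].
  by rewrite acos_ge0 //= (le_trans (acos_lepi a1)) //; lra.
have ab' : a ^+ 2 + (- b) ^+ 2 = 1 by rewrite sqrrN.
have [|a1 ca sa] := unit_upper ab' _; first by rewrite oppr_ge0 ltW.
exists (2 * pi - acos a).
  by have := acos_ge0 a1; have := acos_lepi a1; move=> h1 h2; apply/andP; split; lra.
rewrite addrC mulr_natl cosD2pi sinD2pi cosN sinN ca sa opprK //.
Qed.
Lemma cosBpi x : cos (x - pi) = - cos x.
Proof. by rewrite -[in RHS](subrK pi x) cosDpi opprK. Qed.

Lemma sinBpi x : sin (x - pi) = - sin x.
Proof. by rewrite -[in RHS](subrK pi x) sinDpi opprK. Qed.
Lemma one_neqN1 : (1 : R) = -1 -> False.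
Proof. by move=> h; exfalso; lra. Qed.
End Circle.

Section Steinhaus.
Context {d : measure_display} {T : measurableType d} {R : realType}.
Variable P : probability T R.
Local Notation C := (R[i]).
Local Notation EX := (Ex P).
Variable (s : T -> C).
Hypothesis ms : forall b, measurable_fun setT (fun w => reim b (s w)).
Hypothesis s1 : forall w, cabs (s w) <= 1.

Let es b : ebd P (fun w => reim b (s w)).
Proof.
split; first exact: ms.
by exists 1; apply: aeW => w; exact: le_trans (abs_reim_le _ _) (s1 w).
Qed.

(** The two atoms exhaust the mass, so almost surely the real part is a difference of indicators and
    the imaginary part is 0. *)
Lemma rademacher_mean0 b :
  P [set w | s w = 1] = (2^-1)%:E -> P [set w | s w = -1] = (2^-1)%:E ->
  EX (fun w => reim b (s w)) = 0.
Proof.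
move=> h1 h2.
have mz (z : C) : measurable [set w | s w = z].
  have -> : [set w | s w = z] = [set w | reim true (s w) = complex.Re z] `&`
      [set w | reim false (s w) = complex.Im z].
    apply/seteqP; split=> w /=; first by move=> ->.
    by case: (s w) => x y; case: z => x' y' /= [-> ->].
  by apply: measurableI; apply: measurable_eq; exact: ms.
have dis : [set w | s w = 1] `&` [set w | s w = -1] = set0.
  apply/seteqP; split=> // w [/= -> /eqP]; rewrite eq_complex /= => /andP[/eqP /one_neqN1 []].
have U1 : P ([set w | s w = 1] `|` [set w | s w = -1]) = 1%E.
  apply: etrans (measureU P (mz 1) (mz (-1)) dis) _.
  apply: etrans (f_equal2 (fun x y => x + y)%E h1 h2) _.
  by rewrite -EFinD; congr (_%:E); lra.
have ae1 := ae_of_prob1 (measurableU _ _ (mz 1) (mz (-1))) U1.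
have i1 := ebd_indic P (mz 1); have i2 := ebd_indic P (mz (-1)).
have half (A : set T) : measurable A -> P A = (2^-1)%:E -> EX (\1_A) = 2^-1.
  by move=> mA hA; have := Ex_indic P mA; rewrite hA => -[].
have H1 := half _ (mz 1) h1; have H2 := half _ (mz (-1)) h2; clear h1 h2 U1 half.
case: b.
  rewrite (Ex_eq_ae (g := fun w => (\1_[set w | s w = 1] : T -> R) w - (\1_[set w | s w = -1] : T -> R) w)).
  - by rewrite (ExB i1 i2) H1 H2 subrr.
  - exact: es.
  - exact: funQ_sub (ebd_fun_algebra P) _ _ i1 i2.
  - apply: filterS ae1 => w [] /= e; rewrite !indicE /=.
      rewrite (mem_set (e : [set w | s w = 1] w)) memNset ?subr0 ?e //= e.
      by move=> /eqP; rewrite eq_complex /= => /andP[/eqP /one_neqN1 []].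
    rewrite (mem_set (e : [set w | s w = -1] w)) memNset ?sub0r ?e //= e.
    by move=> /eqP; rewrite eq_complex /= => /andP[/eqP /esym /one_neqN1 []].
rewrite (@Ex_eq_ae _ _ _ P _ (fun=> 0)) ?Ex_cst //.
- by case: (ebd_fun_algebra P) => + _ _; apply.
- by apply: filterS ae1 => w [] /= -> //=; rewrite oppr0.
Qed.

Definition arc (a b : R) : set T :=
  [set w | exists2 th : R, a <= th <= b & s w = (cos th +i* sin th)%C].

Hypothesis harc : forall a b : R, 0 <= a -> a <= b -> b <= 2 * pi ->
  P (arc a b) = ((b - a) / (2 * pi))%:E.

Let U := arc 0 (2 * pi).
Let re w := complex.Re (s w).
Let im w := complex.Im (s w).
Let mre : measurable_fun setT re. Proof. exact: (ms true). Qed.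
Let mim : measurable_fun setT im. Proof. exact: (ms false). Qed.

Lemma arc_full : U = [set w | re w ^+ 2 + im w ^+ 2 = 1].
Proof.
apply/seteqP; split=> w /=.
  by move=> [th _ e]; rewrite /re /im e /= cos2Dsin2.
move=> h; have [th hth [h1 h2]] := unit_angle h; exists th => //.
by rewrite -h1 -h2 /re /im; case: (s w).
Qed.

Let mU : measurable U.
Proof.
rewrite arc_full; apply: measurable_eq.
by apply: measurable_funD; apply: measurable_funX.
Qed.

Let PUI A : measurable A -> P A = P (A `&` U).
Proof.
move=> mA; have mAU := measurableI _ _ mA mU.
have p0 : 0 < (pi : R) := pi_gt0 R.
have PU : P U = 1%E.
  rewrite harc ?subr0 ?divff //; first by rewrite mulf_neq0 // gt_eqF.
  by rewrite mulr_ge0 // ltW.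
rewrite -!Ex_indic //; congr (_%:E).
apply: Ex_eq_ae; [exact: ebd_indic|exact: ebd_indic|].
apply: filterS (ae_of_prob1 mU PU) => w Uw; rewrite !indicE; congr (_%:R).
congr (nat_of_bool _); apply/idP/idP; rewrite !inE; first by move=> Aw; split.
by case.
Qed.

Let sE w (th : R) : s w = (cos th +i* sin th)%C -> re w = cos th /\ im w = sin th.
Proof. by rewrite /re /im => ->. Qed.

(** For f = cos (th - e), the event t <= f is the arc of half-width acos t around e. The conditions
    on e and c keep this arc inside [0, 2 pi], where its probability is given. *)
Let arc_sym (t c e : R) (f : T -> R) : 0 < t <= 1 -> 0 <= e -> c = acos t ->
  measurable_fun setT f -> c <= e -> e + c <= 2 * pi ->
  (forall w th, s w = (cos th +i* sin th)%C -> f w = cos (th - e)) ->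
  (forall w th, 0 <= th <= 2 * pi -> s w = (cos th +i* sin th)%C -> t <= f w ->
     `|th - e| <= pi) ->
  P [set w | t <= f w] = (2 * c / (2 * pi))%:E.
Proof.
move=> t01 e0 ce mf ce' ec hf hp.
have ccp := acos_le_pihalf t01; rewrite -ce in ccp; have p0 := pi_ge0 R.
rewrite PUI; last exact: measurable_ge.
have -> : 2 * c = (e + c) - (e - c) by lra.
rewrite -harc; [|lra|by case/andP: ccp => c0 _; lra|by []].
congr (P _); apply/seteqP; split=> w /=.
  move=> [tf [th hth sw]]; have := hp w th hth sw tf => hpi.
  exists th => //; move: tf; rewrite (hf w th sw) (cos_geP t01 hpi) -ce ler_norml.
  by move=> /andP[h1 h2]; apply/andP; split; lra.
move=> [th hth sw]; split; last first.
  by exists th => //; case/andP: hth => h1 h2; apply/andP; split; lra.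
have hc : `|th - e| <= c.
  by rewrite ler_norml; case/andP: hth => h1 h2; apply/andP; split; lra.
rewrite (hf w th sw) cos_geP // -?ce //.
by apply: le_trans hc _; case/andP: ccp => _ h; lra.
Qed.

Let cosB2pi (x : R) : cos (x - 2 * pi) = cos x.
Proof. by rewrite -[in RHS](subrK (2 * pi) x) mulr_natl cosD2pi. Qed.

(** sin th and - sin th are cosines centred at pi/2 and 3 pi/2, so both tails are arcs of equal
    length. *)
Lemma steinhaus_im : EX im = 0.
Proof.
have p0 := pi_ge0 R.
apply: Ex_sym0 => [|t t0]; first exact: (es false).
case: (leP t 1) => t1; last first.
  have emp (f : T -> R) : (forall w, f w <= 1) -> [set w | t <= f w] = set0.
    by move=> h; apply/seteqP; split=> // w /= tf; have := h w; rewrite leNgt (lt_le_trans t1 tf).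
  have a w := le_trans (abs_reim_le (s w) false) (s1 w).
  rewrite !emp // => w; have := a w; rewrite ler_norml /= -/(im w) => /andP[h1 h2] //; lra.
have t01 : 0 < t <= 1 by rewrite t0.
have := acos_le_pihalf t01 => /andP[c0 c1].
rewrite (@arc_sym t (acos t) (pi / 2) im) //; [|lra|lra| |].
- rewrite (@arc_sym t (acos t) (3 * (pi / 2)) (fun w => - im w)) //; [lra|exact: measurable_funN|lra|lra| |].
    move=> w th /sE[_ ->].
    by rewrite (_ : th - 3 * (pi / 2) = th - pi / 2 - pi) ?cosBpi; [rewrite cosBpihalf|lra].
  move=> w th /andP[h1 h2] /sE[_ ->] h3.
  have : pi <= th.
    rewrite leNgt; apply/negP => h4; have : 0 <= sin th by apply: sin_ge0_pi; rewrite h1 ltW.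
    by lra.
  by move=> h4; rewrite ler_norml; apply/andP; split; lra.
- by move=> w th /sE[_ ->]; rewrite cosBpihalf.
- move=> w th /andP[h1 h2] /sE[_ ->] h3.
  have : th <= pi.
    rewrite leNgt; apply/negP => h4.
    have : 0 <= sin (th - pi) by apply: sin_ge0_pi; apply/andP; split; lra.
    rewrite sinBpi; lra.
  by move=> h4; rewrite ler_norml; apply/andP; split; lra.
Qed.

(** The tail of - cos is an arc around pi, but that of cos wraps around the endpoint 0 = 2 pi. It is
    cut into [0, c] and [2 pi - c, 2 pi], which overlap in the null event s = 1. *)
Lemma steinhaus_re : EX re = 0.
Proof.
have p0 := pi_ge0 R.
apply: Ex_sym0 => [|t t0]; first exact: (es true).
case: (leP t 1) => t1; last first.
  have emp (f : T -> R) : (forall w, f w <= 1) -> [set w | t <= f w] = set0.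
    by move=> h; apply/seteqP; split=> // w /= tf; have := h w; rewrite leNgt (lt_le_trans t1 tf).
  have a w := le_trans (abs_reim_le (s w) true) (s1 w).
  rewrite !emp // => w; have := a w; rewrite ler_norml /= -/(re w) => /andP[h1 h2] //; lra.
have t01 : 0 < t <= 1 by rewrite t0.
set c := acos t; have := acos_le_pihalf t01; rewrite -/c => /andP[c0 c1].
rewrite [RHS](@arc_sym t c pi (fun w => - re w)) //; [|exact: measurable_funN|lra|lra| |]; last 2 first.
- by move=> w th /sE[-> _]; rewrite cosBpi.
- by move=> w th /andP[h1 h2] _ _; rewrite ler_norml; apply/andP; split; lra.
pose X := [set w | t <= re w] `&` [set w | 0 <= im w] `&` U.
pose Y := [set w | t <= re w] `&` [set w | im w <= 0] `&` U.
have mt := measurable_ge t mre.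
have mX : measurable X by apply: measurableI => //; apply: measurableI => //; exact: measurable_ge.
have mY : measurable Y by apply: measurableI => //; apply: measurableI => //; exact: measurable_le.
have eXY : [set w | t <= re w] `&` U = X `|` Y.
  apply/seteqP; split=> w; rewrite /X /Y /=; last by case=> -[[? _] ?]; split.
  move=> [h1 h2]; case: (leP 0 (im w)) => h3; first by left; do 2?split.
  by right; do 2?split=> //; exact: ltW.
have Uw w th : s w = (cos th +i* sin th)%C -> U w.
  by move=> sw; rewrite arc_full /=; have [-> ->] := sE sw; rewrite cos2Dsin2.
have eX : X = arc 0 c.
  apply/seteqP; split=> w; rewrite /X /arc /=.
    move=> [[h1 h2]]; rewrite arc_full => h3.
    have [a1 ca sa] := unit_upper h3 h2; exists (acos (re w)).
      rewrite acos_ge0 //=; have ap : `|acos (re w)| <= pi by rewrite ger0_norm ?acos_ge0 ?acos_lepi.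
      have := cos_geP t01 ap; rewrite ca h1 => /esym.
      by rewrite ger0_norm ?acos_ge0.
    by rewrite ca sa /re /im; case: (s w).
  move=> [th /andP[h1 h2] sw]; have [-> ->] := sE sw; split; last exact: (Uw _ _ sw).
  split.
    rewrite cos_geP // ger0_norm //; lra.
  by apply: sin_ge0_pi; apply/andP; split; lra.
have eY : Y = arc (2 * pi - c) (2 * pi).
  apply/seteqP; split=> w; rewrite /Y /arc /=.
    move=> [[h1 h2]]; rewrite arc_full => h3.
    have h2' : 0 <= - im w by rewrite oppr_ge0.
    have h3' : re w ^+ 2 + (- im w) ^+ 2 = 1 by rewrite sqrrN.
    have [a1 ca sa] := unit_upper h3' h2'; exists (2 * pi - acos (re w)).
      have ap : `|acos (re w)| <= pi by rewrite ger0_norm ?acos_ge0 ?acos_lepi.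
      have := cos_geP t01 ap; rewrite ca h1 => /esym.
      rewrite ger0_norm ?acos_ge0 // -/c => h; have := acos_ge0 a1 => h'; apply/andP; split; lra.
    rewrite addrC mulr_natl cosD2pi sinD2pi cosN sinN ca sa opprK /re /im; by case: (s w).
  move=> [th /andP[h1 h2] sw]; have [-> ->] := sE sw; split; last exact: (Uw _ _ sw).
  rewrite -cosB2pi; split.
    have e : `|th - 2 * pi| = 2 * pi - th by rewrite ler0_norm ?opprB //; lra.
    have ep : `|th - 2 * pi| <= pi by rewrite e; lra.
    by rewrite (cos_geP t01 ep) e -/c; lra.
  rewrite -(subrK (2 * pi) th) mulr_natl sinD2pi -mulr_natl -oppr_ge0 -sinN.
  by apply: sin_ge0_pi; apply/andP; split; lra.
have eXYI : X `&` Y = arc 0 0.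
  apply/seteqP; split=> w; rewrite /X /Y /=.
    move=> [[[h1 h2] h3] [[_ h4] _]]; exists 0; first by rewrite lexx.
    have im0 : im w = 0 by apply/eqP; rewrite eq_le h2 h4.
    move: h3; rewrite arc_full /= im0 => h3.
    have re1 : re w = 1.
      have : (re w - 1) * (re w + 1) = 0.
        by transitivity (re w ^+ 2 + 0 ^+ 2 - 1); [ring|rewrite h3 subrr].
      by move/eqP; rewrite mulf_eq0 => /orP[] /eqP; lra.
    by rewrite cos0 sin0 -re1 -im0 /re /im; case: (s w).
  move=> [th /andP[h1 h2] sw]; have th0 : th = 0 by apply/eqP; rewrite eq_le h1 h2.
  by have := Uw _ _ sw; have [-> ->] := sE sw; rewrite th0 cos0 sin0 lexx t1.
rewrite PUI // eXY.
have fX : (P X < +oo)%E by apply: le_lt_trans (ltry 1); exact: probability_le1.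
apply: etrans (measureUfinl mX mY fX) _.
have PX : P X = (c / (2 * pi))%:E by rewrite eX harc ?subr0 //; lra.
have PY : P Y = (c / (2 * pi))%:E.
  by rewrite eY harc; [congr ((_ / _)%:E); lra|lra|lra|].
have PXY : P (X `&` Y) = 0%:E by rewrite eXYI harc ?subrr ?mul0r //; lra.
apply: etrans (f_equal2 (fun x y => x - y)%E (f_equal2 (fun x y => x + y)%E PX PY) PXY) _.
by rewrite sube0 -EFinD -mulrDl; congr ((_ / _)%:E); lra.
Qed.
End Steinhaus.

(** * Numerical bounds and tail probabilities *)

Section Numerics.
Import numFieldNormedType.Exports.
Variable R : realType.
Implicit Types (y a b : R).

(** The difference of the two sides vanishes at 0 and has derivative 1 - exp (2 z) (1 - 2 z),
    nonnegative since exp (-2 z) >= 1 - 2 z. *)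
Lemma exp2M_le y : 0 <= y -> expR (2 * y) * (1 - y) <= 1 + y.
Proof.
move=> y0; pose g : R -> R := (cst 1 + id) - expR * expR * (cst 1 - id).
pose dg (z : R) : R := 1 - expR z * expR z * (1 - 2 * z).
have dgP (z : R) : is_derive z 1 g (dg z).
  by apply: is_derive_eq; rewrite /dg /GRing.scale /= !fctE; ring.
have cg : continuous g.
  by move=> z; apply: differentiable_continuous; apply/derivable1_diffP; exact: (@ex_derive _ _ _ _ _ _ _ (dgP z)).
have [z zI] := MVT_segment y0 (fun x _ => dgP x) (continuous_subspaceT cg).
have -> : g 0 = 0 by rewrite /g !fctE expR0; ring.
have -> : g y = 1 + y - expR (2 * y) * (1 - y).
  by rewrite /g !fctE mulr_natl mulr2n expRD.
rewrite !subr0 -[_ <= _]subr_ge0 => ->; apply: mulr_ge0 => //.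
rewrite /dg subr_ge0 -(ler_pM2l (expR_gt0 (- z - z))) mulr1 mulrA.
have -> : expR (- z - z) * (expR z * expR z) = 1 by rewrite -!expRD -[RHS]expR0; congr expR; ring.
by apply: le_trans (expR_ge1Dx _); rewrite mul1r; lra.
Qed.

Lemma expR1_le3 : expR 1 <= 3 :> R.
Proof.
have h0 : 0 <= 1 / 2 :> R by lra.
have := exp2M_le h0; rewrite (_ : 2 * (1 / 2) = 1 :> R); last by field.
by move=> h; lra.
Qed.

(** With q = 2p + 1 the induction needs e q^(p+1) <= (q+2)^(p+1). This is [exp2M_le] at y = 1 /
    (q+1), which says exp (2 / (q+1)) <= (q+2) / q, raised to the power p + 1 = (q+1) / 2. *)
Lemma odd_fact_le p : (odd_fact p)%:R <= (expR (-1) * (p.*2.+1)%:R) ^+ p :> R.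
Proof.
elim: p => [|p IH]; first by rewrite /odd_fact big_ord0 expr0.
rewrite odd_factS natrM.
have e1 : expR (-1) * expR 1 = 1 :> R by rewrite -expRD addNr expR0.
set q := (p.*2.+1)%:R : R.
have q1 : 1 <= q by rewrite ler1n.
have qp : q + 1 = 2 * p.+1%:R by rewrite natr1 -[2]/(2%:R) -natrM mul2n doubleS.
have -> : (p.+1.*2.+1)%:R = q + 2 :> R by rewrite doubleS -[2]/(2%:R) -natrD addn2.
have h : expR (2 * (q + 1)^-1) * q <= q + 2.
  have y0 : 0 <= (q + 1)^-1 by rewrite invr_ge0; lra.
  have := exp2M_le y0; rewrite -(ler_pM2r (_ : 0 < q + 1)); last by lra.
  have q1' : q + 1 != 0 by rewrite gt_eqF //; lra.
  have e2 : (1 - (q + 1)^-1) * (q + 1) = q by field.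
  have e3 : (1 + (q + 1)^-1) * (q + 1) = q + 2 by field.
  by rewrite -mulrA e2 e3.
apply: le_trans (ler_wpM2r _ IH) _; first by lra.
rewrite !exprMn exprS -/q.
set u := expR (-1); set v := u ^+ p.
have u0 : 0 < u by exact: expR_gt0.
have v0 : 0 <= v by apply: exprn_ge0; exact: ltW.
have H : q ^+ p.+1 <= u * (q + 2) ^+ p.+1.
  rewrite -(ler_pM2l (expR_gt0 1)) mulrA [expR 1 * u]mulrC e1 mul1r.
  have -> : expR 1 = expR (2 * (q + 1)^-1) ^+ p.+1.
    by rewrite -expRM_natr; congr expR; rewrite qp invfM mulrA divff // mul1r mulVf // pnatr_eq0.
  by rewrite -exprMn; apply: lerXn2r => //; rewrite nnegrE; [apply: mulr_ge0; [exact: expR_ge0|lra]|lra].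
have -> : v * q ^+ p * q = v * q ^+ p.+1 by rewrite exprSr mulrA.
apply: le_trans (ler_wpM2l v0 H) _.
by rewrite mulrCA mulrA.
Qed.

(** Divided by the Markov threshold b^p, the moment bound leaves exp (-p). *)
Lemma odd_fact_tail p a b : 0 <= a -> (p.*2.+1)%:R * a <= b ->
  (odd_fact p)%:R * a ^+ p <= expR (-1) ^+ p * b ^+ p.
Proof.
move=> a0 h; apply: le_trans (ler_wpM2r (exprn_ge0 p a0) (odd_fact_le p)) _.
rewrite -!exprMn -mulrA; apply: lerXn2r; rewrite ?nnegrE.
- by apply: mulr_ge0; [exact: expR_ge0|apply: mulr_ge0].
- by apply: mulr_ge0; [exact: expR_ge0|apply: le_trans h; apply: mulr_ge0].
- by apply: ler_wpM2l h; exact: expR_ge0.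
Qed.

(** Rounding the exponent down costs at most a factor e <= 3; this 3 is half of the 6 inside the
    logarithms. *)
Lemma expRN_truncn (L : R) : expR (-1) ^+ Num.truncn L <= 3 * expR (- L).
Proof.
rewrite -expRM_natr; apply: (@le_trans _ _ (expR 1 * expR (- L))).
  rewrite -expRD ler_expR; have := truncnS_gt L; rewrite -natr1.
  by move: (_%:R) => t; lra.
by apply: ler_wpM2r; [exact: expR_ge0|exact: expR1_le3].
Qed.

Lemma expRN_ln (K e : R) : 0 < K -> 0 < e -> expR (- ln (K / e)) = e / K.
Proof. by move=> K0 e0; rewrite expRN lnK ?invf_div // posrE divr_gt0. Qed.

Lemma ln_ge2 (K : R) : 12 <= K -> 2 <= ln K.
Proof.
move=> K12; rewrite -ler_expR lnK ?posrE; last by lra.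
apply: le_trans (_ : 9 <= _); last by lra.
have -> : 2 = 1 + 1 :> R by [].
have e0 := expR_ge0 (1 : R); have := expR1_le3; rewrite expRD => h.
have -> : 9 = 3 * 3 :> R by ring.
exact: ler_pM.
Qed.
End Numerics.

Lemma half_exp_le (R : realType) (n : nat) (m a x t : R) : 0 < t ->
  m <= a * n%:R -> a <= x * t -> m / t <= n%:R * x.
Proof.
move=> t0 h1 h2; rewrite ler_pdivrMr //; apply: le_trans h1 _.
by rewrite mulrC -mulrA; apply: ler_wpM2l.
Qed.

Section Tails.
Context {d : measure_display} {T : measurableType d} {R : realType}.
Variable P : probability T R.
Local Notation C := (R[i]).
Local Notation mbd := (mxfunQ (ebd P)).

Lemma csum_tail (K : finType) (n : nat) (H : K -> T -> 'M[C]_n) (r dl L : R) :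
  (forall k, mbd (H k)) -> (forall k, indep_split P H k) ->
  (forall k w, adjmx (H k w) = H k w) -> {ae P, forall w, forall k, psd_le (H k w) r} ->
  0 <= r -> \sum_k mexpect P (H k) = 1%:M -> 1 <= L -> 0 < dl ->
  2 * L * r <= 1 / 19 -> (2 * L + 1) * (19 / 8 * r) <= dl ^+ 2 ->
  exists2 Bad : set T, measurable Bad /\ (P Bad <= (n%:R * (3 * expR (- L)))%:E)%E &
    forall w, ~ Bad w -> opnorm_le (csum P H w) dl.
Proof.
move=> bH iH hH psdH r0 sumH L1 dl0 Lr Ld.
set p := Num.truncn L.
have L0 : 0 <= L by apply: le_trans L1.
have pL : p%:R <= L by rewrite truncn_le.
have p0 : (0 < p)%N by rewrite truncn_gt0.
pose f w := rtr (csum P H w ^+ p.*2).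
have bf : ebd P f by exact: (funQ_rtr (ebd_fun_algebra P) (mxfunQ_exp (ebd_fun_algebra P) _ (csum_mbd bH))).
have f0 w : 0 <= f w.
  rewrite /f; rewrite -[X in rtr X]mul1mx; apply: rtr_psd_even (csum_herm bH hH w) _ => v.
  by rewrite mul1mx -l2norm_sq_dot sqr_ge0.
have t0 : 0 < dl ^+ p.*2 by exact: exprn_gt0.
have r19 : 0 <= 19 / 8 * r by apply: mulr_ge0.
(* A level set of the trace moment, hence measurable; outside it [opnorm_le_trace] bounds the
   operator norm. *)
exists [set w | dl ^+ p.*2 <= f w].
  split; first by apply: measurable_ge; case: bf.
  apply: le_trans (Ex_markov bf (aeW _ f0) t0) _; rewrite lee_fin.
  have hp : p.*2%:R * r <= 1 / 19.
    by apply: le_trans Lr; apply: ler_wpM2r => //; rewrite -mul2n natrM; apply: ler_wpM2l.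
  apply: half_exp_le t0 (chernoff_moment bH iH hH psdH r0 sumH hp) _.
  have hq : (p.*2.+1)%:R * (19 / 8 * r) <= dl ^+ 2.
    apply: le_trans Ld; apply: ler_wpM2r => //.
    by rewrite -natr1 -mul2n natrM lerD2r; apply: ler_wpM2l.
  apply: le_trans (odd_fact_tail r19 hq) _.
  rewrite -mul2n exprM; apply: ler_wpM2r; last exact: expRN_truncn.
  by apply: exprn_ge0; exact: sqr_ge0.
move=> w /negP; rewrite -ltNge => /ltW h.
exact: opnorm_le_trace (csum_herm bH hH w) (ltW dl0) p0 h.
Qed.

(** [D] stands for |det G|: coefficients in Cramer's form and threshold scale alike with it, so
    nothing is divided by the determinant. *)
Lemma sign_tail (K : finType) (sig : K -> T -> C) (a : K -> C) (D dl rho L : R) :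
  (forall k b, measurable_fun setT (fun w => reim b (sig k w))) ->
  (forall k w, cabs (sig k w) <= 1) ->
  (forall k b, Ex P (fun w => reim b (sig k w)) = 0) ->
  indep_families P (J := fun _ : K => bool) (fun k b w => reim b (sig k w)) ->
  1 <= L -> 0 < D -> 0 < rho -> dl ^+ 2 < 1 ->
  (\sum_k cabs (a k) ^+ 2) * (1 - dl ^+ 2) <= dl ^+ 2 * D ^+ 2 ->
  (2 * L + 1) * dl ^+ 2 <= rho ^+ 2 * (1 - dl ^+ 2) ->
  (P [set w | ((rho * D) ^+ 2 <= cabs (\sum_k a k * sig k w) ^+ 2)%R] <= (3 * expR (- L))%:E)%E.
Proof.
move=> msig sig1 sig0 isig L1 D0 rho0 dl1 hA hL.
set p := Num.truncn L; set A := \sum_k _ in hA.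
have L0 : 0 <= L by apply: le_trans L1.
have pL : p%:R <= L by rewrite truncn_le.
pose f w := (cabs (\sum_k a k * sig k w) ^+ 2) ^+ p.
have HQ := ebd_fun_algebra P.
have bf : ebd P f.
  apply: (funQ_exp HQ); apply: (funQ_cabs_sq HQ); apply: (cfunQ_sum HQ) => k _.
  exact: (cfunQ_mul HQ (cfunQ_cst HQ (a k)) (sig_ebd P msig sig1 k)).
have rD : 0 < rho * D by exact: mulr_gt0.
have t0 : 0 < ((rho * D) ^+ 2) ^+ p by apply: exprn_gt0; exact: exprn_gt0.
have f0 w : 0 <= f w by apply: exprn_ge0; exact: sqr_ge0.
have p0 : (0 < p)%N by rewrite truncn_gt0.
have A0 : 0 <= A by apply: sumr_ge0 => k _; exact: sqr_ge0.
have -> : [set w | (rho * D) ^+ 2 <= cabs (\sum_k a k * sig k w) ^+ 2] =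
    [set w | ((rho * D) ^+ 2) ^+ p <= f w].
  by apply/seteqP; split=> w /=; rewrite /f (ler_pXn2r p0) ?nnegrE ?sqr_ge0.
apply: le_trans (Ex_markov bf (aeW _ f0) t0) _; rewrite lee_fin.
have kh := khintchine a msig sig1 sig0 isig p; rewrite -/A in kh.
rewrite -[3 * _]mul1r; apply: (@half_exp_le _ 1%N _ ((odd_fact p)%:R * A ^+ p) _ _ t0).
  by rewrite mulr1; exact: kh.
apply: le_trans (odd_fact_tail A0 _) _; last first.
  by apply: ler_wpM2r (expRN_truncn L); apply: exprn_ge0; exact: sqr_ge0.
have d1 : 0 < 1 - dl ^+ 2 by rewrite subr_gt0.
rewrite -(ler_pM2r d1) -mulrA.
apply: (@le_trans _ _ ((2 * L + 1) * (dl ^+ 2 * D ^+ 2))).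
  apply: ler_pM => //; first by apply: mulr_ge0 => //; exact: ltW.
  by rewrite -natr1 -mul2n natrM lerD2r; apply: ler_wpM2l.
have -> : (rho * D) ^+ 2 * (1 - dl ^+ 2) = rho ^+ 2 * (1 - dl ^+ 2) * D ^+ 2 by ring.
by rewrite mulrA; apply: ler_wpM2r => //; exact: sqr_ge0.
Qed.
End Tails.

(** * The sensing matrix *)

Section Restriction.
Variable R : realType.
Local Notation C := (R[i]).

Lemma restr_mulE n (T : {set 'I_n}) (u : 'cV[C]_#|T|) i :
  (restr_mx T *m u) i 0 = \sum_k (i == enum_val k)%:R * u k 0.
Proof. by rewrite mxE; apply: eq_bigr => k _; rewrite mxE. Qed.

Lemma adj_restr_mulE n m (T : {set 'I_n}) (M : 'M[C]_(n, m)) k j :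
  (adjmx (restr_mx T) *m M) k j = M (enum_val k) j.
Proof.
rewrite mxE (bigD1 (enum_val k)) //= big1 ?addr0 => [|i ik].
  by rewrite adjmxE mxE eqxx conjc_nat mul1r.
by rewrite adjmxE mxE (negbTE ik) conjc_nat mul0r.
Qed.

Lemma mul_restrE n m (T : {set 'I_n}) (M : 'M[C]_(m, n)) i k :
  (M *m restr_mx T) i k = M i (enum_val k).
Proof.
rewrite mxE (bigD1 (enum_val k)) //= big1 ?addr0 => [|j jk].
  by rewrite mxE eqxx mulr1.
by rewrite mxE (negbTE jk) mulr0.
Qed.

Lemma adj_restr_restr n (T : {set 'I_n}) : adjmx (restr_mx T) *m restr_mx T = 1%:M :> 'M[C]_#|T|.
Proof.
apply/matrixP => a b; rewrite adj_restr_mulE !mxE; congr (_%:R); congr (nat_of_bool _).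
by apply/eqP/eqP => [/enum_val_inj|->].
Qed.

Lemma restr_adj_restr n (T : {set 'I_n}) (v : 'cV[C]_n) :
  restr_mx T *m (adjmx (restr_mx T) *m v) = projmx R T *m v.
Proof.
apply/colP => i; rewrite projmxE restr_mulE; case: ifP => iT; last first.
  rewrite big1 // => k _; case: eqP => [e|]; last by rewrite mul0r.
  by move: iT; rewrite e enum_valP.
rewrite (bigD1 (enum_rank_in iT i)) //= enum_rankK_in // eqxx mul1r adj_restr_mulE enum_rankK_in //.
rewrite big1 ?addr0 // => k kn; case: eqP => [e|]; last by rewrite mul0r.
by case/eqP: kn; apply: enum_val_inj; rewrite enum_rankK_in // -e.
Qed.

Lemma l2norm_restr n (T : {set 'I_n}) (u : 'cV[C]_#|T|) : l2norm (restr_mx T *m u) = l2norm u.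
Proof.
apply/eqP; rewrite -(@eqrXn2 _ 2) ?l2norm_ge0 // !l2norm_sq_dot dot_adj.
by rewrite mulmxA adj_restr_restr mul1mx.
Qed.

Lemma local_isometry_restr n (M : 'M[C]_n) (T : {set 'I_n}) dl :
  opnorm_le (adjmx (restr_mx T) *m M *m restr_mx T - 1%:M) dl -> local_isometry M T dl.
Proof.
move=> h v vT; have Rv : restr_mx T *m (adjmx (restr_mx T) *m v) = v.
  by rewrite restr_adj_restr projmx_id.
have e : (adjmx (restr_mx T) *m M *m restr_mx T - 1%:M) *m (adjmx (restr_mx T) *m v) =
    adjmx (restr_mx T) *m (M *m v - v).
  by rewrite mulmxBl mul1mx -!mulmxA Rv mulmxBr.
have := h (adjmx (restr_mx T) *m v).
by rewrite e -l2norm_restr restr_adj_restr -[X in _ <= _ * X]l2norm_restr Rv.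
Qed.

Lemma entry_le_opnorm a b (G : 'M[C]_(a, b)) L i j : opnorm_le G L -> cabs (G i j) <= L.
Proof.
move=> h; have := h (delta_mx j 0); rewrite l2norm_delta mulr1; apply: le_trans.
have -> : G i j = (G *m (delta_mx j 0 : 'cV[C]_b)) i 0.
  rewrite mxE (bigD1 j) //= big1 ?addr0 => [|k kj]; first by rewrite mxE !eqxx mulr1.
  by rewrite mxE (negbTE kj) mulr0.
rewrite -(@ler_pXn2r _ 2) ?nnegrE ?cabs_ge0 ?l2norm_ge0 // l2norm_sq (bigD1 i) //= lerDl.
by apply: sumr_ge0 => k _; exact: sqr_ge0.
Qed.

Lemma opnorm_le_trans a b (G : 'M[C]_(a, b)) L L' : L <= L' -> opnorm_le G L -> opnorm_le G L'.
Proof. by move=> LL h v; apply: le_trans (h v) _; apply: ler_wpM2r => //; exact: l2norm_ge0. Qed.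

Lemma opnorm_le_scale a b (G : 'M[C]_(a, b)) (c L : R) : 0 <= c -> opnorm_le G L ->
  opnorm_le (c%:C%C *: G) (c * L).
Proof.
move=> c0 h v; rewrite -scalemxAl l2normZ cabsR ger0_norm // -mulrA.
exact: ler_wpM2l.
Qed.

Lemma adj_mxcol_mul n m (p : 'I_m -> nat) (B : forall l : 'I_m, 'M[C]_(p l, n)) :
  adjmx (\mxcol_l B l) *m \mxcol_l B l = \sum_l adjmx (B l) *m B l.
Proof.
rewrite -mul_mxrow_mxcol; congr (_ *m _).
by rewrite /adjmx tr_mxcol; apply/matrixP => i j; rewrite !mxE.
Qed.
End Restriction.

Section MeasurableSign.
Context {d : measure_display} {T : measurableType d} {R : realType}.
Local Notation C := (R[i]).
Local Notation meas := (fun f : T -> R => measurable_fun setT f).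
Local Notation HM := (meas_fun_algebra (T := T) (R := R)).

Lemma measurable_cabs (z : T -> C) : cfunQ meas z -> meas (fun w => cabs (z w)).
Proof.
move=> mz; apply: (@funQ_eq _ _ meas (fun w => powR (cabs (z w) ^+ 2) 2^-1)).
  by move=> w; rewrite powR12_sqrt ?sqr_ge0 // sqrtr_sqr ger0_norm ?cabs_ge0.
exact: (measurableT_comp (measurable_powR 2^-1) (funQ_cabs_sq HM mz)).
Qed.

Lemma measurable_csign (z : T -> C) : cfunQ meas z -> cfunQ meas (fun w => csign (z w)).
Proof.
move=> mz; have mi : meas (fun w => (cabs (z w))^-1).
  apply: (@funQ_eq _ _ meas (fun w => powR (cabs (z w)) (-1))).
    by move=> w; rewrite powR_inv1 ?cabs_ge0.
  exact: (measurableT_comp (measurable_powR (-1)) (measurable_cabs mz)).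
apply: (@cfunQ_eq _ _ meas (fun w => z w * ((cabs (z w))^-1)%:C%C)).
  by move=> w; rewrite /csign fmorphV.
apply: (cfunQ_mul HM mz) => -[] //=; exact: measurable_cst.
Qed.
End MeasurableSign.

(** * Near isometry of the random Gram matrix *)

Section MatrixEvent.
Context {d : measure_display} {T : measurableType d} {R : realType}.
Variable P : probability T R.
Local Notation C := (R[i]).
Local Notation meas := (fun f : T -> R => measurable_fun setT f).
Local Notation HM := (meas_fun_algebra (T := T) (R := R)).
Local Notation mbd := (mxfunQ (ebd P)).

Lemma mexpectZr a b (k : R) (M : T -> 'M[C]_(a, b)) : mbd M ->
  mexpect P (fun w => k%:C%C *: M w) = k%:C%C *: mexpect P M.
Proof.
move=> bM; apply/esym/mexpect_eqP => i j.
  rewrite [in LHS]mxE cReZ Re_mexpect -ExZ; last exact: (bM i j true).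
  by apply: eq_Ex => w; rewrite [in RHS]mxE cReZ.
rewrite [in LHS]mxE cImZ Im_mexpect -ExZ; last exact: (bM i j false).
by apply: eq_Ex => w; rewrite [in RHS]mxE cImZ.
Qed.

Variables (n m : nat) (p : 'I_m -> nat) (B : forall l : 'I_m, T -> 'M[C]_(p l, n)).
Hypothesis HB : sensing_setting P B.
Variables (U : {set 'I_n}) (La : R).
Hypothesis HL : {ae P, forall w, forall l : 'I_m,
  opnorm_le (adjmx (B l w *m restr_mx U) *m (B l w *m restr_mx U)) La}.
Hypothesis La0 : 0 <= La.

Let gram l w : 'M[C]_#|U| := adjmx (B l w *m restr_mx U) *m (B l w *m restr_mx U).
Let col l w := (Num.sqrt (m%:R : R))^-1%:C%C *: (B l w *m restr_mx U).
Let H l w := adjmx (col l w) *m col l w.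

Lemma sensing_mxfunQ l : mxfunQ meas (B l).
Proof. by move=> i j b; case: HB => -[_ _ _]. Qed.

Let HE l w : H l w = (m%:R^-1)%:C%C *: gram l w.
Proof.
rewrite /H /col adjmxZr -scalemxAl -scalemxAr scalerA -rmorphM -expr2 exprVn sqr_sqrtr //.
Qed.

Lemma sensing_gram w : adjmx (sensing B w) *m sensing B w =
  (m%:R^-1)%:C%C *: \sum_l adjmx (B l w) *m B l w.
Proof.
rewrite /sensing adjmxZr -scalemxAl -scalemxAr scalerA adj_mxcol_mul -rmorphM -expr2 exprVn.
by rewrite sqr_sqrtr ?ler0n.
Qed.

Let sum_H w : \sum_l H l w =
  adjmx (restr_mx U) *m (adjmx (sensing B w) *m sensing B w) *m restr_mx U.
Proof.
rewrite sensing_gram -scalemxAr -scalemxAl mulmx_sumr mulmx_suml scaler_sumr.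
by apply: eq_bigr => l _; rewrite HE /gram adjmxM !mulmxA.
Qed.

Let gram_mbd l : mbd (gram l).
Proof.
move=> i j b; split.
  have mBR := mxfunQ_mul HM (sensing_mxfunQ (l := l)) (mxfunQ_cst HM (restr_mx U)).
  exact: (mxfunQ_mul HM (mxfunQ_adj HM mBR) mBR i j b).
exists La; apply: filterS HL => w /(_ l) h.
exact: le_trans (abs_reim_le _ _) (entry_le_opnorm i j h).
Qed.

Let H_mbd l : mbd (H l).
Proof.
apply: (mxfunQ_eq (fun w => esym (HE l w))).
exact: (mxfunQ_scale (ebd_fun_algebra P) (cfunQ_cst (ebd_fun_algebra P) _) (gram_mbd l)).
Qed.

Let sum_mexpect : \sum_l mexpect P (H l) = 1%:M.
Proof.
case: HB => _ [_ [_ iso]]; apply/matrixP => a b.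
transitivity ((1%:M : 'M[C]_n) (enum_val a) (enum_val b)); last first.
  by rewrite !mxE (inj_eq enum_val_inj).
rewrite -iso [in RHS]mxE !summxE mulr_sumr; apply: eq_bigr => l _.
rewrite (_ : H l = fun w => (m%:R^-1)%:C%C *: gram l w); last by apply/funext => w; exact: HE.
rewrite mexpectZr; last exact: gram_mbd.
rewrite [in LHS]mxE; congr (_ * _); rewrite [LHS]mxE [RHS]mxE; congr (cexpect P _).
by apply/funext => w; rewrite /gram adjmxM mulmxA mul_restrE -mulmxA adj_restr_mulE.
Qed.

Let H_herm l w : adjmx (H l w) = H l w.
Proof. by rewrite /H adjmxM adjmxK. Qed.

Let H_psd : {ae P, forall w, forall l, psd_le (H l w) (La / m%:R)}.
Proof.
apply: filterS HL => w h l; apply: psd_le_gram; first by rewrite divr_ge0.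
by rewrite -/(H l w) HE mulrC; apply: opnorm_le_scale (h l); rewrite invr_ge0.
Qed.

Let X (l : 'I_m) (rcb : 'I_(p l) * 'I_n * bool) w := reim rcb.2 (B l w rcb.1.1 rcb.1.2).

Let H_split l : indep_split P H l.
Proof.
case: HB => -[_ _ _ mB] [iB _].
have mX (k : 'I_m) (q : 'I_(p k) * 'I_n * bool) : measurable_fun setT (X q).
  exact: mB.
have gB (D : pred 'I_m) k : D k -> mxfunQ (gmeas (rect_system X D)) (H k).
  move=> Dk; have HG := meas_fun_algebra (T := g_sigma_algebraType (rect_system X D)) (R := R).
  have hB : mxfunQ (gmeas (rect_system X D)) (B k).
    by move=> r c b; exact: (@rect_system_measurable _ _ _ _ _ X D k (r, c, b) Dk).
  have hc : mxfunQ (gmeas (rect_system X D)) (col k).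
    have h1 := mxfunQ_mul HG hB (mxfunQ_cst HG (restr_mx U)).
    exact: (mxfunQ_scale HG (cfunQ_cst HG ((Num.sqrt (m%:R : R))^-1)%:C%C) h1).
  exact: (mxfunQ_mul HG (mxfunQ_adj HG hc) hc).
exists (rect_system X (pred1 l)), (rect_system X (predC1 l)); split.
- exact: rect_pi_system.
- exact: rect_pi_system.
- by apply: (rect_indep iB) => i /= ->.
- by apply: gB => /=.
- by move=> k kl; apply: gB.
Qed.

(** [csum_tail] applied to the m Gram blocks on U divided by m: they lie between 0 and La / m, and
    isotropy makes their means sum to the identity. *)
Lemma isometry_tail (dl L : R) : 1 <= L -> 0 < dl ->
  2 * L * (La / m%:R) <= 1 / 19 -> (2 * L + 1) * (19 / 8 * (La / m%:R)) <= dl ^+ 2 ->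
  exists2 Bad : set T, measurable Bad /\ (P Bad <= (#|U|%:R * (3 * expR (- L)))%:E)%E &
    forall w, ~ Bad w -> local_isometry (adjmx (sensing B w) *m sensing B w) U dl.
Proof.
move=> L1 dl0 h1 h2.
have r0 : 0 <= La / m%:R by rewrite divr_ge0.
have [Bad hBad hw] := csum_tail H_mbd H_split H_herm H_psd r0 sum_mexpect L1 dl0 h1 h2.
exists Bad => // w /hw h; apply: local_isometry_restr.
rewrite -sum_H -sum_mexpect -sumrB; exact: h.
Qed.
End MatrixEvent.

(** * Failure of the certificate as a measurable event *)

Section FailureSet.
Variable R : realType.
Local Notation C := (R[i]).
Variables (k n : nat) (S : {set 'I_n}) (j : 'I_n) (dl rho : R).
Local Notation K := ({i : 'I_n | i \in S}).

Let coef (M : 'M[C]_n) (i : K) : C := conjc (cramer_vec M S j (val i) 0).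
Let energy (M : 'M[C]_n) : R := \sum_i cabs (coef M i) ^+ 2.
Let detsq (M : 'M[C]_n) : R := cabs (\det (padded_gram M S)) ^+ 2.

(* The first two conditions hold as soon as M is nearly isometric; they are kept in the set because they are polynomial in M, hence measurable. *)
Definition cert_failure (M : 'M[C]_n) (s : K -> C) : Prop :=
  [/\ energy M * (1 - dl ^+ 2) <= dl ^+ 2 * detsq M, 0 < detsq M &
      rho ^+ 2 * detsq M <= cabs (\sum_i coef M i * s i) ^+ 2].

Lemma measurable_cert_failure d (T : measurableType d) (M : T -> 'M[C]_n) (s : K -> T -> C) :
  mxfunQ (fun f : T -> R => measurable_fun setT f) M ->
  (forall i, cfunQ (fun f : T -> R => measurable_fun setT f) (s i)) ->
  measurable [set w | cert_failure (M w) (s^~ w)].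
Proof.
move=> mM ms; have HM := meas_fun_algebra (T := T) (R := R).
have mP := mxfunQ_cst HM (projmx R S).
have mG : mxfunQ (fun f : T -> R => measurable_fun setT f) (fun w => padded_gram (M w) S).
  exact: (mxfunQ_add HM (mxfunQ_mul HM (mxfunQ_mul HM mP mM) mP) (mxfunQ_cst HM _)).
have mN : mxfunQ (fun f : T -> R => measurable_fun setT f) (fun w => cramer_vec (M w) S j).
  exact: (mxfunQ_mul HM (mxfunQ_adjugate HM mG)
    (mxfunQ_mul HM mP (mxfunQ_mul HM mM (mxfunQ_cst HM _)))).
have mc i : cfunQ (fun f : T -> R => measurable_fun setT f) (fun w => coef (M w) i).
  exact: (cfunQ_conj HM (mN (val i) 0)).
have me : measurable_fun setT (fun w => energy (M w)).
  by apply: (funQ_sum HM) => i _; exact: (funQ_cabs_sq HM (mc i)).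
have mD : measurable_fun setT (fun w => detsq (M w)).
  exact: (funQ_cabs_sq HM (cfunQ_det HM mG)).
have mF : measurable_fun setT (fun w => cabs (\sum_i coef (M w) i * s i w) ^+ 2).
  apply: (funQ_cabs_sq HM); apply: (cfunQ_sum HM) => i _.
  exact: (cfunQ_mul HM (mc i) (ms i)).
have lef (f g : T -> R) : measurable_fun setT f -> measurable_fun setT g ->
    measurable [set w | f w <= g w].
  move=> mf mg; rewrite (_ : [set w | _] = [set w | 0 <= g w - f w]).
    exact: (measurable_ge 0 (measurable_funB mg mf)).
  by apply/seteqP; split=> w /=; rewrite subr_ge0.
have m1 := lef _ _ (measurable_funM me (measurable_cst (1 - dl ^+ 2)))
  (measurable_funM (measurable_cst (dl ^+ 2)) mD).
have m2 := measurableC (measurable_le 0 mD).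
have m3 := lef _ _ (measurable_funM (measurable_cst (rho ^+ 2)) mD) mF.
rewrite (_ : [set w | _] = [set w | energy (M w) * (1 - dl ^+ 2) <= dl ^+ 2 * detsq (M w)] `&`
  ~` [set w | detsq (M w) <= 0] `&`
  [set w | rho ^+ 2 * detsq (M w) <= cabs (\sum_i coef (M w) i * s i w) ^+ 2]).
  by apply: measurableI; [apply: measurableI; [exact: m1|exact: m2]|exact: m3].
apply/seteqP; split=> w /=; first by move=> [h1 h2 h3]; split=> //; split=> //; apply/negP; rewrite -ltNge.
by move=> [[h1 /negP]]; rewrite -ltNge.
Qed.

(** M is fixed here. If one of the two conditions on M alone fails, the event is empty; otherwise
    they are the hypotheses of [sign_tail]. *)
Lemma cert_failure_prob d (T : measurableType d) (P : probability T R) (L : R)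
    (sig : K -> T -> C) (M : 'M[C]_n) :
  (forall i b, measurable_fun setT (fun w => reim b (sig i w))) ->
  (forall i w, cabs (sig i w) <= 1) ->
  (forall i b, Ex P (fun w => reim b (sig i w)) = 0) ->
  indep_families P (J := fun _ : K => bool) (fun i b w => reim b (sig i w)) ->
  1 <= L -> 0 < rho -> dl ^+ 2 < 1 ->
  (2 * L + 1) * dl ^+ 2 <= rho ^+ 2 * (1 - dl ^+ 2) ->
  (P [set w | cert_failure M (sig^~ w)] <= (3 * expR (- L))%:E)%E.
Proof.
move=> msig sig1 sig0 isig L1 rho0 dl1 hL.
have t0 : 0 <= 3 * expR (- L) by rewrite mulr_ge0 ?expR_ge0.
case: (boolP ((energy M * (1 - dl ^+ 2) <= dl ^+ 2 * detsq M) && (0 < detsq M))) => h; last first.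
  rewrite (_ : [set w | _] = set0) ?measure0 ?lee_fin //.
  by apply/seteqP; split=> // w /= [h1 h2 _]; case/andP: h.
case/andP: h => h1 h2.
have D0 : 0 < cabs (\det (padded_gram M S)).
  by rewrite lt_neqAle cabs_ge0 andbT; apply: contraTneq h2 => e; rewrite /detsq -e expr0n ltxx.
rewrite (_ : [set w | _] = [set w | (rho * cabs (\det (padded_gram M S))) ^+ 2 <=
    cabs (\sum_i coef M i * sig i w) ^+ 2]).
  exact: (sign_tail msig sig1 sig0 isig L1 D0 rho0 dl1 h1 hL).
by apply/seteqP; split=> w /=; rewrite exprMn; [case|split].
Qed.

(** Under isometry the two conditions on M hold by [cramer_vec_norm] and invertibility, so avoiding
    the failure set means that the third one fails. *)
Lemma certificate (M : 'M[C]_n) (x : 'cV[C]_n) : adjmx M = M -> 0 <= dl -> dl < 1 -> 0 < rho ->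
  (forall i, i \notin S -> local_isometry M (S :|: [set i]) dl) -> (#|S| < n)%N -> j \notin S ->
  (forall i, i \notin S -> x i 0 = 0) ->
  ~ cert_failure M (fun i => csign (x (val i) 0)) ->
  cabs (dot (cramer_vec M S j) (sgvec x)) < rho * cabs (\det (padded_gram M S)).
Proof.
move=> hM dl0 dl1 rho0 iso Sn jS xS nf.
have e : dot (cramer_vec M S j) (sgvec x) = \sum_i coef M i * csign (x (val i) 0).
  rewrite dotE (bigID (mem S)) /= [X in _ + X]big1 => [|i iS]; last first.
    by rewrite [sgvec x _ _]mxE xS // /csign mul0r mulr0.
  rewrite addr0 (big_sub (mem S) (fun i => conjc (cramer_vec M S j i 0) * sgvec x i 0)).
  by apply: eq_bigr => i _; rewrite [sgvec x _ _]mxE.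
have D0 := det_padded_gram_gt0 hM dl1 iso Sn.
have d1 : 0 <= 1 - dl ^+ 2 by rewrite subr_ge0 expr_le1 // ltW.
rewrite ltNge; apply/negP => h; apply: nf; split.
- apply: le_trans (cramer_vec_norm hM dl0 dl1 iso Sn jS); apply: ler_wpM2r => //.
  rewrite l2norm_sq (bigID (mem S)) /= (big_sub (mem S) (fun i => cabs (cramer_vec M S j i 0) ^+ 2)).
  rewrite /energy -[X in X <= _]addr0; apply: lerD; last by apply: sumr_ge0 => i _; exact: sqr_ge0.
  by apply: ler_sum => i _; rewrite cabsJ.
- exact: exprn_gt0.
- rewrite -e -exprMn; apply: lerXn2r h; rewrite nnegrE; last exact: cabs_ge0.
  by apply: mulr_ge0; [exact: ltW|exact: cabs_ge0].
Qed.
End FailureSet.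

Section SignEvent.
Context {d : measure_display} {T : measurableType d} {R : realType}.
Variable P : probability T R.
Local Notation C := (R[i]).
Variables (k n : nat) (A : T -> 'M[C]_(k, n)) (x : T -> 'cV[C]_n) (S : {set 'I_n}).
Hypothesis mA : mxfunQ (fun f : T -> R => measurable_fun setT f) A.
Hypothesis hx : random_sign_assumption P A x S.
Local Notation K := ({i : 'I_n | i \in S}).
Let sig (i : K) w := csign (x w (val i) 0).

Let msig i b : measurable_fun setT (fun w => reim b (sig i w)).
Proof. by apply: measurable_csign => b'; case: hx => _ + _ _; apply. Qed.

Let sig1 i w : cabs (sig i w) <= 1. Proof. exact: cabs_csign_le1. Qed.

Let isig : indep_families P (J := fun _ : K => bool) (fun i b w => reim b (sig i w)).
Proof. by case: hx => _ _ [[_ []]|[]]. Qed.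

Let sig0 i b : Ex P (fun w => reim b (sig i w)) = 0.
Proof.
case: hx => _ _ [[_ [_ h]]|[_ h]] _.
  by have [h1 h2] := h i; exact: (rademacher_mean0 (msig i) (sig1 i) b h1 h2).
by case: b; [exact: (steinhaus_re (msig i) (sig1 i) (h i))|exact: (steinhaus_im (msig i) (sig1 i) (h i))].
Qed.

(** A one-element index type makes all entries of A a single block for [rect_system]; likewise the
    signs below. *)
Let XA (_ : unit) (q : 'I_k * 'I_n * bool) w := reim q.2 (A w q.1.1 q.1.2).
Let XS (_ : unit) (q : K * bool) w := reim q.2 (sig q.1 w).
Let GA := rect_system XA predT.
Let GS := rect_system XS predT.

Let indAS B D : GA B -> GS D -> (P (B `&` D) = P B * P D)%E.
Proof.
move=> [E mE ->] [F mF ->].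
have rU (J : finType) (X : unit -> J -> T -> R) (E' : unit -> J -> set R) :
    rect (J := fun=> J) X predT E' = \bigcap_(q in [set: J]) (X tt q @^-1` E' tt q).
  apply/seteqP; split=> w h; first by move=> q _; exact: (h tt isT q I).
  by move=> [] _ q _; exact: h.
by rewrite !rU; case: hx => _ _ _; apply.
Qed.

Lemma certificate_tail (j : 'I_n) (dl rho L : R) : 1 <= L -> 0 <= dl -> dl < 1 -> 0 < rho ->
  (2 * L + 1) * dl ^+ 2 <= rho ^+ 2 * (1 - dl ^+ 2) ->
  (#|S| < n)%N -> j \notin S ->
  exists2 Bad : set T, measurable Bad /\ (P Bad <= (3 * expR (- L))%:E)%E &
    forall w, ~ Bad w -> let M := adjmx (A w) *m A w in
      (forall i, i \notin S -> local_isometry M (S :|: [set i]) dl) ->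
      cabs (dot (cramer_vec M S j) (sgvec (x w))) < rho * cabs (\det (padded_gram M S)).
Proof.
move=> L1 dl0 dl1 rho0 hL Sn jS.
have dl2 : dl ^+ 2 < 1 by rewrite expr_lt1.
pose gr (X : 'M[C]_(k, n)) := adjmx X *m X.
pose Bad := [set w | cert_failure j dl rho (gr (A w)) (sig^~ w)].
(* [Bad] is the diagonal of [Bad2], in which A sees only the first coordinate and the signs only the
   second. *)
pose Bad2 : set (g_sigma_algebraType GA * g_sigma_algebraType GS) :=
  [set u | cert_failure j dl rho (gr (A u.1)) (sig^~ u.2)].
have mXA q : measurable_fun setT (XA tt q) by exact: mA.
have mXS q : measurable_fun setT (XS tt q) by exact: msig.
have pA : pi_system GA by apply: rect_pi_system => -[].
have pS : pi_system GS by apply: rect_pi_system => -[].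
have mB : measurable Bad.
  apply: (@measurable_cert_failure R n S j dl rho d T (fun w => gr (A w)) sig) => [|i b]; last exact: msig.
  exact: (mxfunQ_mul (meas_fun_algebra (T := T) (R := R)) (mxfunQ_adj (meas_fun_algebra (T := T) (R := R)) mA) mA).
have mB2 : measurable Bad2.
  set T12 := (g_sigma_algebraType GA * g_sigma_algebraType GS)%type.
  have HM := meas_fun_algebra (T := T12) (R := R).
  have m1 : mxfunQ (fun f : T12 -> R => measurable_fun setT f) (fun u : T12 => A u.1).
    move=> r c b; apply: (measurableT_comp (f := XA tt (r, c, b) : g_sigma_algebraType GA -> R)).
      exact: (@rect_system_measurable _ _ _ _ _ XA predT tt (r, c, b) isT).
    exact: measurable_fst.
  apply: (measurable_cert_failure j dl rho (M := fun u : T12 => gr (A u.1)) (s := fun i (u : T12) => sig i u.2)).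
    exact: (mxfunQ_mul HM (mxfunQ_adj HM m1) m1).
  move=> i b; apply: (measurableT_comp (f := XS tt (i, b) : g_sigma_algebraType GS -> R)).
    exact: (@rect_system_measurable _ _ _ _ _ XS predT tt (i, b) isT).
  exact: measurable_snd.
exists Bad.
  split=> //; apply: (indep_prob_le pA pS indAS mB2) => w1.
  exact: (cert_failure_prob j (gr (A w1)) msig sig1 sig0 isig L1 rho0 dl2 hL).
move=> w nB M iso; apply: (certificate _ dl0 dl1 rho0 iso Sn jS _ nB).
  by rewrite adjmxM adjmxK.
by case: hx => + _ _ _; apply.
Qed.
End SignEvent.

(** * Union bound and choice of constants *)

Section Constants.
Variable R : realType.

(** The isometry terms add up to exactly eps / 2 and the sign terms to (n - s) / n times eps / 2,
    thanks to 6 = 2 * 3. *)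
Lemma failure_budget (n s : nat) (eps : R) : (0 < s)%N -> (s < n)%N -> 0 < eps ->
  (n - s)%:R * (s.+1%:R * (3 * expR (- ln ((6 * s.+1 * (n - s))%:R / eps))) +
    3 * expR (- ln ((6 * n)%:R / eps))) <= eps.
Proof.
move=> s0 sn e0; have k0 : (0 < n - s)%N by rewrite subn_gt0.
have n0 : (0 < n)%N by apply: leq_ltn_trans sn.
have kn : (n - s)%:R <= n%:R :> R by rewrite ler_nat leq_subr.
rewrite !expRN_ln // ?ltr0n ?muln_gt0 ?k0 //.
move: k0 n0 kn; rewrite !natrM -[(0 < n - s)%N](ltr0n R) -[(0 < n)%N](ltr0n R).
have : 0 < s.+1%:R :> R by rewrite ltr0n.
move: (n%:R) (s.+1%:R) ((n - s)%:R) => a t k t0 k0 a0 ka.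
have -> : k * (t * (3 * (eps / (6 * t * k))) + 3 * (eps / (6 * a))) =
    (1 + k / a) * (eps / 2) by field; rewrite !gt_eqF.
have : k / a <= 1 by rewrite ler_pdivrMr // mul1r.
move: (k / a) => q q1; have h : 0 <= eps / 2 by lra.
have := ler_wpM2r h q1; lra.
Qed.

(** A nonempty proper support forces n >= 2, so 6 n / eps >= 12 > e^2; and n = s + (n - s) is at
    most (s + 1) (n - s). *)
Lemma log_factors (n s : nat) (eps : R) : (0 < s)%N -> (s < n)%N -> 0 < eps < 1 ->
  2 <= ln ((6 * n)%:R / eps) <= ln ((6 * s.+1 * (n - s))%:R / eps).
Proof.
move=> s0 sn /andP[e0 e1].
have n2 : (1 < n)%N by apply: leq_ltn_trans sn.
have h : (6 * n)%:R <= (6 * s.+1 * (n - s))%:R :> R.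
  rewrite ler_nat -mulnA leq_mul2l /= mulSn -{1}(subnK (ltnW sn)) leq_add2l.
  by rewrite leq_pmulr // subn_gt0.
have ie : 0 <= eps^-1 by rewrite invr_ge0 ltW.
have h6 : 0 < (6 * n)%:R :> R by rewrite ltr0n muln_gt0 /= ltnW.
apply/andP; split.
  apply: ln_ge2; rewrite ler_pdivlMr //; apply: (@le_trans _ _ 12).
    by rewrite ger_pMr // ltW.
  by rewrite (_ : 12 = (6 * 2)%:R) ?ler_nat ?leq_mul2l // natrM; ring.
rewrite ler_ln ?posrE ?divr_gt0 //; first exact: ler_wpM2r.
exact: lt_le_trans h.
Qed.

Lemma sparsity_products (q L1 L2 : R) : 2 <= L2 -> L2 <= L1 -> 0 <= q -> q * L1 * L2 <= 1 ->
  [/\ q * L1 <= 1 / 2, q * L2 <= 1 / 2 & q <= 1 / 4].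
Proof.
move=> h2 h1 q0 h.
have L10 : 0 <= L1 by lra.
have a := ler_wpM2l (mulr_ge0 q0 L10) h2.
have b : q * L2 <= q * L1 by apply: ler_wpM2l.
have c := ler_wpM2l q0 h2.
by split; lra.
Qed.

(* Both choices of dl make (2 L2 + 1) dl^2 = rho^2 (1 - dl^2), with rho = 1 and rho = 1/2 respectively. *)
Lemma noiseless_constants (r L1 L2 : R) : 2 <= L2 -> L2 <= L1 -> 0 <= r ->
  19 * r * L1 * L2 <= 1 ->
  [/\ 2 * L1 * r <= 1 / 19, (2 * L1 + 1) * (19 / 8 * r) <= (2 * L2 + 2)^-1 &
      (2 * L2 + 1) * (2 * L2 + 2)^-1 <= 1 ^+ 2 * (1 - (2 * L2 + 2)^-1)].
Proof.
move=> h2 h1 r0 h; have q0 : 0 <= 19 * r by lra.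
have [a b c] := sparsity_products h2 h1 q0 h.
have d0 : 0 < 2 * L2 + 2 by lra.
(* With q = 19 r, the second bound multiplied by 2 L2 + 2 reads q (4 L1 L2 + 4 L1 + 2 L2 + 2) / 8 <=
   1, and its left side is at most 1/2 + 1/4 + 1/8 + 1/16. *)
split; first by lra.
  by rewrite -[X in _ <= X]mul1r ler_pdivlMr //; lra.
rewrite expr1n mul1r -(ler_pM2r d0) mulrBl mulVf ?gt_eqF // -mulrA mulVf ?gt_eqF //; lra.
Qed.

(** The second bound, cleared of its denominator, has left side at most (19/800) (16 + 5 + 4 + 5/4),
    which is below 5/8. *)
Lemma noisy_constants (r L1 L2 : R) : 2 <= L2 -> L2 <= L1 -> 0 <= r ->
  100 * r * L1 * L2 <= 1 ->
  [/\ 2 * L1 * r <= 1 / 19, (2 * L1 + 1) * (19 / 8 * r) <= (8 * L2 + 5)^-1 &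
      (2 * L2 + 1) * (8 * L2 + 5)^-1 <= (1 / 2) ^+ 2 * (1 - (8 * L2 + 5)^-1)].
Proof.
move=> h2 h1 r0 h; have q0 : 0 <= 100 * r by lra.
have [a b c] := sparsity_products h2 h1 q0 h.
have d0 : 0 < 8 * L2 + 5 by lra.
split; first by lra.
  by rewrite -[X in _ <= X]mul1r ler_pdivlMr //; lra.
rewrite -(ler_pM2r d0) -[X in _ <= X]mulrA mulrBl mulVf ?gt_eqF // -mulrA mulVf ?gt_eqF //; lra.
Qed.
End Constants.

Section UnionBound.
Context {d : measure_display} {T : measurableType d} {R : realType}.
Variable P : probability T R.

Lemma prob_union_le (I : finType) (D : pred I) (F : I -> set T) (b : R) :
  (forall i, D i -> measurable (F i) /\ (P (F i) <= b%:E)%E) ->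
  measurable (\bigcup_(i in [set i | D i]) F i) /\
  (P (\bigcup_(i in [set i | D i]) F i) <= (#|D|%:R * b)%:E)%E.
Proof.
move=> h.
have : measurable (\big[setU/set0]_(i | D i) F i) /\
    (P (\big[setU/set0]_(i | D i) F i) <= (\sum_(i | D i) b)%:E)%E.
  apply: (big_ind2 (fun A t => measurable A /\ (P A <= t%:E)%E)) => //.
    by split=> //; rewrite measure0.
  move=> A t B u [mA hA] [mB hB]; split; first exact: measurableU.
  by apply: le_trans (measureU2 P mA mB) _; rewrite EFinD; apply: leeD.
have <- := @bigcup_pred I T D F.
by rewrite sumr_const mulr_natl.
Qed.
End UnionBound.

(** * The good event *)

Section RecoveryEvent.
Context {d : measure_display} {T : measurableType d} {R : realType}.
Variable P : probability T R.
Local Notation C := (R[i]).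
Variables (n m : nat) (p : 'I_m -> nat) (B : forall l : 'I_m, T -> 'M[C]_(p l, n)).
Variables (x : T -> 'cV[C]_n) (S : {set 'I_n}) (Lam : 'I_n -> R) (eps : R).
Hypothesis hB : sensing_setting P B.
Hypothesis hx : random_sign_assumption P (sensing B) x S.
Hypothesis hLam : Lambda_bound P B S Lam.
Hypothesis Sn : (#|S| < n)%N.
Local Notation Lmax := (\big[Num.max/0]_(j | j \notin S) Lam j).
Local Notation L1 := (ln ((6 * #|S|.+1 * (n - #|S|))%:R / eps)).
Local Notation L2 := (ln ((6 * n)%:R / eps)).
Local Notation M w := (adjmx (sensing B w) *m sensing B w).

(** Each j outside S has one bad set. The trace in dimension s + 1 costs isometry the prefactor s +
    1, the sign sum has no such prefactor, and therefore the two logarithms differ. *)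
Lemma recovery_event (dl rho : R) : (0 < #|S|)%N -> 0 < eps < 1 ->
  0 < dl -> dl < 1 -> 0 < rho ->
  2 * L1 * (Lmax / m%:R) <= 1 / 19 -> (2 * L1 + 1) * (19 / 8 * (Lmax / m%:R)) <= dl ^+ 2 ->
  (2 * L2 + 1) * dl ^+ 2 <= rho ^+ 2 * (1 - dl ^+ 2) ->
  exists E : set T, [/\ measurable E, ((1 - eps)%:E <= P E)%E &
    forall w, E w ->
      (forall j, j \notin S -> local_isometry (M w) (S :|: [set j]) dl) /\
      (forall j, j \notin S -> cabs (dot (cramer_vec (M w) S j) (sgvec (x w))) <
         rho * cabs (\det (padded_gram (M w) S)))].
Proof.
move=> s0 e01 dl0 dl1 rho0 h1 h2 h3.
have /andP[L22 L12] := log_factors s0 Sn e01.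
have L11 : 1 <= L1 by apply: le_trans L12; apply: le_trans L22; lra.
have L21 : 1 <= L2 by apply: le_trans L22; lra.
have Lmax0 : 0 <= Lmax by apply: bigmax_ge_id.
have mS : mxfunQ (fun f : T -> R => measurable_fun setT f) (sensing B).
  have HM := meas_fun_algebra (T := T) (R := R).
  apply: (mxfunQ_scale HM (cfunQ_cst HM _)) => r c b.
  have h := sensing_mxfunQ hB (l := tagnat.sig1 r) (tagnat.sig2 r) c b.
  by apply: (funQ_eq _ h) => w; rewrite [in RHS]mxE.
pose b : R := #|S|.+1%:R * (3 * expR (- L1)) + 3 * expR (- L2).
(* The certificate at j presupposes isometry for every i outside S; this premise is discharged only
   after all the bad sets are removed. *)
have /choice[F hF] : forall j, exists A : set T, j \notin S ->
    [/\ measurable A, (P A <= b%:E)%E & forall w, ~ A w ->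
      local_isometry (M w) (S :|: [set j]) dl /\
      ((forall i, i \notin S -> local_isometry (M w) (S :|: [set i]) dl) ->
      cabs (dot (cramer_vec (M w) S j) (sgvec (x w))) < rho * cabs (\det (padded_gram (M w) S)))].
  move=> j; case: (boolP (j \in S)) => jS; first by exists set0.
  have [_ hj] := hLam jS.
  have hj' : {ae P, forall w, forall l : 'I_m,
      opnorm_le (adjmx (B l w *m restr_mx (S :|: [set j])) *m (B l w *m restr_mx (S :|: [set j]))) Lmax}.
    by apply: filterS hj => w h l; apply: opnorm_le_trans (h l); exact: le_bigmax_cond.
  have [B1 [mB1 PB1] hB1] := isometry_tail hB hj' Lmax0 L11 dl0 h1 h2.
  have [B2 [mB2 PB2] hB2] := certificate_tail mS hx L21 (ltW dl0) dl1 rho0 h3 Sn jS.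
  exists (B1 `|` B2) => _; split; first exact: measurableU.
    apply: le_trans (measureU2 P mB1 mB2) _; rewrite /b EFinD; apply: leeD => //.
    by move: PB1; rewrite finset.setUC cardsU1 jS.
  move=> w nF; split; first by apply: hB1 => h; apply: nF; left.
  by move=> iso; apply: hB2 => // h; apply: nF; right.
have hU j : j \notin S -> measurable (F j) /\ (P (F j) <= b%:E)%E by move=> /hF[].
have [mU PU] := prob_union_le hU.
exists (~` \bigcup_(i in [set i | i \notin S]) F i); split; first exact: measurableC.
  apply: le_trans (_ : 1 - P (\bigcup_(i in [set i | i \notin S]) F i) <= _)%E; last first.
    by rewrite -(probability_setC P mU).
  rewrite EFinB; apply: leeB => //; apply: le_trans PU _; rewrite lee_fin.
  have -> : #|(fun i => i \notin S)| = (n - #|S|)%N.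
    have := cardC (mem S); rewrite card_ord => /(congr1 (subn^~ #|S|)); rewrite addKn => <-.
    by apply: eq_card => i; rewrite !inE.
  by case/andP: e01 => e0 _; exact: failure_budget.
move=> w nU; have nF j : j \notin S -> ~ F j w by move=> jS h; apply: nU; exists j.
have iso j (jS : j \notin S) : local_isometry (M w) (S :|: [set j]) dl.
  by have [_ _ /(_ w (nF j jS))[]] := hF j jS.
by split=> // j jS; have [_ _ /(_ w (nF j jS))[_]] := hF j jS; apply.
Qed.
End RecoveryEvent.

(** * Empty support *)

Section Degenerate.
Variable R : realType.
Local Notation C := (R[i]).

Lemma l1norm_le0 n (z : 'cV[C]_n) : l1norm z <= l1norm (0 : 'cV[C]_n) -> z = 0.
Proof.
have -> : l1norm (0 : 'cV[C]_n) = 0 by apply: big1 => i _; rewrite mxE cabs0.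
move=> h; apply: l2norm_eq0; apply/eqP; rewrite eq_le l2norm_ge0 andbT.
exact: le_trans (l2norm_le_l1norm z) h.
Qed.

Lemma BP_recovery0 k n (A : 'M[C]_(k, n)) : BP_unique_minimizer A (A *m 0) 0.
Proof.
have m0 (w : 'cV[C]_n) : l1norm (0 : 'cV[C]_n) <= l1norm w.
  rewrite {1}/l1norm big1 => [|i _]; last by rewrite mxE cabs0.
  by apply: sumr_ge0 => i _; exact: cabs_ge0.
by split=> [|w [_ hw]]; [split|apply: l1norm_le0; exact: hw].
Qed.

Lemma qBP_recovery0 k n (A : 'M[C]_(k, n)) (e : 'cV[C]_k) (eta : R) z : l2norm e <= eta ->
  qBP_minimizer A (A *m 0 + e) eta z -> z = 0.
Proof. by move=> he [_ h]; apply: l1norm_le0; apply: h; rewrite addrC addKr. Qed.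
End Degenerate.

Section SqrtInv.
Variable R : realType.

Lemma sqrt_inv_lt1 (b : R) : 1 < b ->
  [/\ 0 < Num.sqrt b^-1, Num.sqrt b^-1 < 1 & Num.sqrt b^-1 ^+ 2 = b^-1].
Proof.
move=> b1; have b0 : 0 < b by lra.
split; first by rewrite sqrtr_gt0 invr_gt0.
  by rewrite -sqrtr1 ltr_sqrt // invf_lt1.
by rewrite sqr_sqrtr // invr_ge0 ltW.
Qed.

Lemma sampling_ratio (c La L1 L2 m : R) : 0 < m -> c * La * L1 * L2 <= m ->
  c * (La / m) * L1 * L2 <= 1.
Proof.
move=> m0 h; have -> : c * (La / m) * L1 * L2 = c * La * L1 * L2 / m by field; rewrite gt_eqF.
by rewrite ler_pdivrMr // mul1r.
Qed.
End SqrtInv.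

Theorem mainTheorem4 (R : realType) :
  (exists c1 C1 C2 : R, [/\ 0 < c1, 0 < C1, 0 < C2 &
    forall (d : measure_display) (Om : measurableType d) (P : probability Om R)
      (n m : nat) (p : 'I_m -> nat) (B : forall l : 'I_m, Om -> 'M[R[i]]_(p l, n))
      (x : Om -> 'cV[R[i]]_n) (S : {set 'I_n}) (Lam : 'I_n -> R) (eta eps : R),
    sensing_setting P B ->
    random_sign_assumption P (sensing B) x S ->
    Lambda_bound P B S Lam ->
    (#|S| < n)%N -> 0 <= eta -> 0 < eps < 1 ->
    c1 * (\big[Num.max/0]_(j | j \notin S) Lam j)
       * ln ((6 * #|S|.+1 * (n - #|S|))%:R / eps) * ln ((6 * n)%:R / eps)
      <= m%:R ->
    exists E : set Om, [/\ measurable E, ((1 - eps)%:E <= P E)%E &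
      forall w, E w -> forall e : 'cV[R[i]]_(\sum_(l < m) p l),
        l2norm e <= eta ->
        forall z, qBP_minimizer (sensing B w) (sensing B w *m x w + e) eta z ->
        l2norm (x w - z) <= (C1 + C2 * Num.sqrt (#|S|%:R)) * eta]])
  /\
  (forall (d : measure_display) (Om : measurableType d) (P : probability Om R)
      (n m : nat) (p : 'I_m -> nat) (B : forall l : 'I_m, Om -> 'M[R[i]]_(p l, n))
      (x : Om -> 'cV[R[i]]_n) (S : {set 'I_n}) (Lam : 'I_n -> R) (eps : R),
    sensing_setting P B ->
    random_sign_assumption P (sensing B) x S ->
    Lambda_bound P B S Lam ->
    (#|S| < n)%N -> 0 < eps < 1 ->
    19 * (\big[Num.max/0]_(j | j \notin S) Lam j)
       * ln ((6 * #|S|.+1 * (n - #|S|))%:R / eps) * ln ((6 * n)%:R / eps)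
      <= m%:R ->
    exists E : set Om, [/\ measurable E, ((1 - eps)%:E <= P E)%E &
      forall w, E w -> BP_unique_minimizer (sensing B w) (sensing B w *m x w) (x w)]).
Proof.
have setup (d : measure_display) (Om : measurableType d) (P : probability Om R)
    (n m : nat) (p : 'I_m -> nat) (B : forall l : 'I_m, Om -> 'M[R[i]]_(p l, n))
    (S : {set 'I_n}) (Lam : 'I_n -> R) :
    sensing_setting P B ->
    0 < m%:R :> R /\ 0 <= (\big[Num.max/0]_(j | j \notin S) Lam j) / m%:R.
  move=> [[_ m0 _ _] _]; split; first by rewrite ltr0n.
  by rewrite divr_ge0 //; exact: bigmax_ge_id.
have nosupp (Om : Type) n (S : {set 'I_n}) (x : Om -> 'cV[R[i]]_n) :
    #|S| = 0%N -> (forall w i, i \notin S -> x w i 0 = 0) -> forall w, x w = 0.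
  move=> /cards0_eq -> h w; apply/colP => i; rewrite h ?inE //.
  by rewrite mxE.
split.
  (* 100 is the factor in [noisy_constants]; 4 and 40 come from [le_recovery_constants]. *)
  exists 100, 4, 40; split; [lra|lra|lra|].
  move=> d Om P n m p B x S Lam eta eps hB hx hL Sn eta0 e01 hm.
  have [m0 r0] := setup d Om P n m p B S Lam hB.
  (* For empty S the lower bound 2 on the logarithm can fail, for instance at n = 1, but then x = 0
     and recovery is certain. *)
  have [s0|s0] := posnP #|S|.
    exists setT; split=> //.
      by rewrite probability_setT lee_fin; case/andP: e01 => e0 _; lra.
    move=> w _ e he z; have [xS _ _ _] := hx.
    rewrite (nosupp _ _ _ _ s0 xS w) => /(qBP_recovery0 he) ->.
    rewrite subrr l2norm0; apply: mulr_ge0 => //.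
  have /andP[L22 L12] := log_factors s0 Sn e01.
  have [h1 h2 h3] := noisy_constants L22 L12 r0 (sampling_ratio m0 hm).
  have b1 : 1 < 8 * ln ((6 * n)%:R / eps) + 5 by move: L22; move: (ln _) => t; lra.
  have [dl0 dl1 dl2] := sqrt_inv_lt1 b1.
  rewrite -dl2 in h2 h3.
  have rho0 : 0 < 1 / 2 :> R by lra.
  have [E [mE PE hE]] := recovery_event hB hx hL Sn s0 e01 dl0 dl1 rho0 h1 h2 h3.
  exists E; split=> // w /hE [iso cert] e he z hz; have [xS _ _ _] := hx.
  apply: (qBP_stability dl1 iso Sn (xS w) cert erefl _ he hz).
  (* dl <= 1/2 because dl^2 = 1 / (8 L2 + 5) and L2 >= 2. *)
  rewrite -(@ler_pXn2r _ 2) ?nnegrE ?(ltW dl0) ?(ltW rho0) // dl2.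
  rewrite -[_^-1]mul1r ler_pdivrMr; last by lra.
  by move: L22; move: (ln _) => t; lra.
move=> d Om P n m p B x S Lam eps hB hx hL Sn e01 hm.
have [m0 r0] := setup d Om P n m p B S Lam hB.
have [s0|s0] := posnP #|S|.
  exists setT; split=> //.
    by rewrite probability_setT lee_fin; case/andP: e01 => e0 _; lra.
  move=> w _; have [xS _ _ _] := hx; rewrite (nosupp _ _ _ _ s0 xS w).
  exact: BP_recovery0.
have /andP[L22 L12] := log_factors s0 Sn e01.
have [h1 h2 h3] := noiseless_constants L22 L12 r0 (sampling_ratio m0 hm).
have b1 : 1 < 2 * ln ((6 * n)%:R / eps) + 2 by move: L22; move: (ln _) => t; lra.
have [dl0 dl1 dl2] := sqrt_inv_lt1 b1.
rewrite -dl2 in h2 h3.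
have [E [mE PE hE]] := recovery_event hB hx hL Sn s0 e01 dl0 dl1 ltr01 h1 h2 h3.
exists E; split=> // w /hE [iso cert]; have [xS _ _ _] := hx.
exact: (BP_recovery dl1 iso Sn (xS w) cert erefl).
Qed.
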